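(* Let $\pi\colon P\to M$ be a (smooth) principal $G$-bundle, where $M$ is a compact connected smooth manifold with $\dim(M)\ge 2$ and $G$ is a compact connected Lie group. Fix a bi-invariant metric $\langle-,-\rangle$ on $G$. Let $(\mathcal M,d_{GH})$ be the metric space of isometry classes of compact metric spaces with the Gromov-Hausdorff distance, and let $$\mathcal M(P):=\big\{(P,d_g)\ :\ d_g\text{ is the distance induced by a Riemannian metric } g\text{ on } P\big\}\subset\mathcal M.$$ Let $H\subset G$ be a closed connected subgroup, and let $g_T$ be the $G$-invariant Riemannian metric on $G/H$ induced by $\langle-,-\rangle$ which makes the projection $G\to G/H$ a Riemannian submersion. If $\pi\colon P\to M$ is reducible to $H$, then $(G/H,d_{g_T})\in\overline{\mathcal M(P)}^{GH}$, the closure of $\mathcal M(P)$ in $(\mathcal M,d_{GH})$.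
   Context: A reduction of a principal $G$-bundle $\pi\colon P\to M$ to a Lie subgroup $H\subset G$ is a principal $H$-bundle $\pi_Q\colon Q\to M$ together with an $H$-equivariant smooth map $\Psi\colon Q\to P$ covering $\mathrm{id}_M$; $P$ is reducible to $H$ if such a reduction exists. Elements of $\mathcal M(P)$ are regarded as isometry classes. $d_{g}$ denotes the Riemannian distance of $g$. $d_{GH}$ is the Gromov-Hausdorff distance between compact metric spaces: $d_{GH}((X,d_X),(Y,d_Y))=\frac12\inf_{\mathscr R}\mathrm{dis}(\mathscr R)$, where $\mathscr R$ ranges over correspondences between $X$ and $Y$ (subsets of $X\times Y$ projecting onto both factors) and $\mathrm{dis}(\mathscr R)=\sup\{|d_X(x,x')-d_Y(y,y')|:(x,y),(x',y')\in\mathscr R\}$. *)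

(* Defs.v *)
From HB Require Import structures.
From mathcomp Require Import all_boot all_order all_algebra.
From mathcomp Require Import all_classical all_reals all_analysis.
From mathcomp Require Import generic_quotient.

Set Implicit Arguments.
Unset Strict Implicit.
Unset Printing Implicit Defensive.

Import Order.TTheory GRing.Theory Num.Theory numFieldNormedType.Exports.

Local Open Scope classical_set_scope.
Local Open Scope ring_scope.

(* An n-dimensional smooth
   manifold is a topological space X with an atlas A : set (chart R X n) such
   that [smooth_manifold A].  Tangent vectors at x are represented by their
   coordinates v : 'rV[R]_n in a chart around x. *)

HB.structure Definition TopologicalGroup := {T of Topological T & Group T}.
Notation topologicalGroupType := TopologicalGroup.type.

(* Meaningful for open D only; on a finite-dimensional V, asking that all
   x |-> 'd f x v be C^k is asking that the differential be C^k. *)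
Fixpoint Ck (R : realType) (V W : normedModType R) (k : nat)
    (D : set V) (f : V -> W) : Prop :=
  if k is k'.+1 then
    (forall x, D x -> differentiable f x) /\
    (forall v : V, Ck k' D (fun x => 'd f x v))
  else forall x, D x -> {for x, continuous f}.

Definition Cinfty (R : realType) (V W : normedModType R)
    (D : set V) (f : V -> W) : Prop := forall k, Ck k D f.

(* [cinv] is only relevant on the image of [dom], and [cmap] on [dom]. *)
Record chart (R : realType) (X : Type) (n : nat) := Chart {
  dom : set X ;
  cmap : X -> 'rV[R]_n ;
  cinv : 'rV[R]_n -> X }.

Section Manifolds.
Variable R : realType.

Definition is_chart (X : topologicalType) n (phi : chart R X n) : Prop :=
  [/\ open (dom phi),
      open (cmap phi @` dom phi),
      (forall x, dom phi x -> cinv phi (cmap phi x) = x),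
      (forall x, dom phi x -> {for x, continuous (cmap phi)}) &
      (forall x, dom phi x -> {for cmap phi x, continuous (cinv phi)})].

Definition coord_map (X Y : Type) n k (phi : chart R X n) (psi : chart R Y k)
    (f : X -> Y) : 'rV[R]_n -> 'rV[R]_k :=
  fun u => cmap psi (f (cinv phi u)).

Definition smooth_manifold (X : topologicalType) n (A : set (chart R X n)) :
    Prop :=
  [/\ hausdorff_space X,
      @second_countable X,
      (forall phi, A phi -> is_chart phi),
      (forall x, exists2 phi, A phi & dom phi x) &
      (forall phi psi, A phi -> A psi ->
         Cinfty (cmap phi @` (dom phi `&` dom psi)) (coord_map phi psi id))].

(* U is meant to be open. *)
Definition smooth_on (X Y : topologicalType) n k (A : set (chart R X n))
    (B : set (chart R Y k)) (U : set X) (f : X -> Y) : Prop :=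
  (forall x, U x -> {for x, continuous f}) /\
  (forall phi psi, A phi -> B psi ->
     Cinfty (cmap phi @` (dom phi `&` U `&` f @^-1` dom psi))
            (coord_map phi psi f)).

Definition smooth_map (X Y : topologicalType) n k (A : set (chart R X n))
    (B : set (chart R Y k)) (f : X -> Y) : Prop := smooth_on A B setT f.

Definition prod_chart (X Y : Type) n k (phi : chart R X n)
    (psi : chart R Y k) : chart R (X * Y) (n + k) :=
  Chart (dom phi `*` dom psi)
        (fun p => row_mx (cmap phi p.1) (cmap psi p.2))
        (fun u => (cinv phi (lsubmx u), cinv psi (rsubmx u))).

Definition prod_atlas (X Y : Type) n k (A : set (chart R X n))
    (B : set (chart R Y k)) : set (chart R (X * Y) (n + k)) :=
  [set chi | exists phi psi, [/\ A phi, B psi & chi = prod_chart phi psi]].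

(* The differential of f at x in the charts phi at x and psi at f x. *)
Definition tangent (X Y : Type) n k (phi : chart R X n) (psi : chart R Y k)
    (f : X -> Y) (x : X) (v : 'rV[R]_n) : 'rV[R]_k :=
  'd (coord_map phi psi f) (cmap phi x) v.

Definition immersion (X Y : topologicalType) n k (A : set (chart R X n))
    (B : set (chart R Y k)) (f : X -> Y) : Prop :=
  smooth_map A B f /\
  forall phi psi x, A phi -> B psi -> dom phi x -> dom psi (f x) ->
    injective (tangent phi psi f x).

Definition submersion (X Y : topologicalType) n k (A : set (chart R X n))
    (B : set (chart R Y k)) (f : X -> Y) : Prop :=
  smooth_map A B f /\
  forall phi psi x, A phi -> B psi -> dom phi x -> dom psi (f x) ->
    forall w, exists v, tangent phi psi f x v = w.

Definition embedding (X Y : topologicalType) n k (A : set (chart R X n))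
    (B : set (chart R Y k)) (f : X -> Y) : Prop :=
  [/\ immersion A B f,
      injective f &
      (forall U : set X, open U -> exists2 V : set Y, open V & U = f @^-1` V)].

(* A metric tensor on (X, A) is given by its components in the charts of A:
   [g phi u] is the Gram matrix of the coordinate frame of phi at the point
   with coordinates u. *)
Definition tensor (X : Type) n := chart R X n -> 'rV[R]_n -> 'M[R]_n.

Definition inner (X : Type) n (g : tensor X n) (phi : chart R X n) (x : X)
    (v w : 'rV[R]_n) : R :=
  (v *m g phi (cmap phi x) *m w^T) 0 0.

Definition preserves_metric (X Y : Type) n k (A : set (chart R X n))
    (g : tensor X n) (B : set (chart R Y k)) (h : tensor Y k) (f : X -> Y) :
    Prop :=
  forall phi psi x, A phi -> B psi -> dom phi x -> dom psi (f x) ->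
  forall v w, inner h psi (f x) (tangent phi psi f x v) (tangent phi psi f x w)
              = inner g phi x v w.

(* The last clause is the transformation law under changes of charts. *)
Definition riemannian_metric (X : topologicalType) n (A : set (chart R X n))
    (g : tensor X n) : Prop :=
  [/\ (forall phi, A phi -> Cinfty (cmap phi @` dom phi) (g phi)),
      (forall phi x, A phi -> dom phi x ->
         forall v w, inner g phi x v w = inner g phi x w v),
      (forall phi x, A phi -> dom phi x ->
         forall v, v != 0 -> 0 < inner g phi x v v) &
      preserves_metric A g A g id].

Definition riemannian_submersion (X Y : topologicalType) n k
    (A : set (chart R X n)) (g : tensor X n)
    (B : set (chart R Y k)) (h : tensor Y k) (f : X -> Y) : Prop :=
  submersion A B f /\
  forall phi psi x, A phi -> B psi -> dom phi x -> dom psi (f x) ->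
    let T := tangent phi psi f x in
    let horizontal v := forall w, T w = 0 -> inner g phi x v w = 0 in
    forall v w, horizontal v -> horizontal w ->
      inner h psi (f x) (T v) (T w) = inner g phi x v w.

(* A smooth arc is smooth on [0, 1] in the sense that it is smooth on an open
   interval containing [0, 1]. *)
Definition smooth_arc (X : topologicalType) n (A : set (chart R X n))
    (c : R -> X) : Prop :=
  exists2 e : R, 0 < e &
    let D := [set t : R | - e < t < 1 + e] in
    (forall t, D t -> {for t, continuous c}) /\
    (forall phi, A phi ->
       Cinfty (D `&` c @^-1` dom phi) (fun t : R => cmap phi (c t))).

(* The set below is a singleton for every t in [0, 1] when c is a smooth arc:
   the norm of the velocity does not depend on the chart. *)
Definition speed (X : Type) n (A : set (chart R X n)) (g : tensor X n)
    (c : R -> X) (t : R) : R :=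
  get [set s : R | exists phi, [/\ A phi, dom phi (c t) &
    let v := 'D_1 (fun t : R => cmap phi (c t)) t in
    s = Num.sqrt (inner g phi (c t) v v)]].

Definition arc_length (X : Type) n (A : set (chart R X n)) (g : tensor X n)
    (c : R -> X) : R :=
  \int[lebesgue_measure]_(t in `[0, 1]%classic) speed A g c t.

(* A piecewise smooth path from x to y is a finite sequence of consecutive
   smooth arcs, each parametrised by [0, 1]. *)
Fixpoint piecewise_smooth_path (X : topologicalType) n (A : set (chart R X n))
    (x : X) (s : seq (R -> X)) (y : X) : Prop :=
  if s is c :: s' then
    [/\ smooth_arc A c, c 0 = x & piecewise_smooth_path A (c 1) s' y]
  else x = y.

(* On a connected manifold the infimum is over a nonempty set. *)
Definition riemannian_distance (X : topologicalType) n
    (A : set (chart R X n)) (g : tensor X n) (x y : X) : R :=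
  inf [set l : R | exists2 s, piecewise_smooth_path A x s y &
                   l = \sum_(c <- s) arc_length A g c].

Definition lie_group (G : topologicalGroupType) n (A : set (chart R G n)) :
    Prop :=
  [/\ smooth_manifold A,
      smooth_map (prod_atlas A A) A (fun p : G * G => (p.1 * p.2)%g) &
      smooth_map A A (fun a : G => (a^-1)%g)].

Definition bi_invariant_metric (G : topologicalGroupType) n
    (A : set (chart R G n)) (g : tensor G n) : Prop :=
  [/\ riemannian_metric A g,
      (forall a : G, preserves_metric A g A g (fun b : G => (a * b)%g)) &
      (forall a : G, preserves_metric A g A g (fun b : G => (b * a)%g))].

Definition is_subgroup (G : groupType) (H : set G) : Prop :=
  [/\ H 1%g, (forall a b, H a -> H b -> H (a * b)%g) &
      (forall a, H a -> H (a^-1)%g)].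

Definition lcoset (G : groupType) (a : G) (H : set G) : set G :=
  [set (a * h)%g | h in H].

Section CosetSpace.
Variables (G : topologicalGroupType) (H : set G).

Definition same_lcoset (a b : G) : bool := `[< lcoset a H = lcoset b H >].

Lemma same_lcoset_refl : reflexive same_lcoset.
Proof. by move=> a; apply/asboolP. Qed.

Lemma same_lcoset_sym : symmetric same_lcoset.
Proof. by move=> a b; apply/asboolP/asboolP. Qed.

Lemma same_lcoset_trans : transitive same_lcoset.
Proof. by move=> b a c /asboolP ab /asboolP bc; apply/asboolP; rewrite ab. Qed.

Definition same_lcoset_equiv : equiv_rel G :=
  EquivRel same_lcoset same_lcoset_refl same_lcoset_sym same_lcoset_trans.

Definition coset_space : topologicalType :=
  quotient_topology {eq_quot same_lcoset_equiv}%qT.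

Definition coset_proj (a : G) : coset_space :=
  (\pi_({eq_quot same_lcoset_equiv}%qT) a)%qT.

(* aH |-> baH; it does not depend on the chosen representative. *)
Definition coset_translate (b : G) (C : coset_space) : coset_space :=
  coset_proj (b * (repr (C : {eq_quot same_lcoset_equiv}%qT) : G))%g.

End CosetSpace.

(* The local trivialisation over U is the map (x, a) |-> F (x, a) from U x G
   onto the preimage of U, with inverse y |-> (pi y, T y). *)
Definition principal_bundle
    (M : topologicalType) m (AM : set (chart R M m))
    (G : topologicalGroupType) d (AG : set (chart R G d))
    (P : topologicalType) p (AP : set (chart R P p))
    (pi : P -> M) (act : P -> G -> P) : Prop :=
  [/\ [/\ smooth_manifold AM, lie_group AG & smooth_manifold AP],
      smooth_map AP AM pi,
      [/\ smooth_map (prod_atlas AP AG) AP (fun z : P * G => act z.1 z.2),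
          (forall y, act y 1%g = y) &
          (forall y a b, act (act y a) b = act y (a * b)%g)],
      (forall y a, pi (act y a) = pi y) &
      (forall x0 : M, exists (U : set M) (F : M * G -> P) (T : P -> G),
         [/\ [/\ open U & U x0],
             smooth_on (prod_atlas AM AG) AP (U `*` setT) F,
             smooth_on AP AG (pi @^-1` U) T,
             [/\ (forall x a, U x -> pi (F (x, a)) = x),
                 (forall x a, U x -> T (F (x, a)) = a) &
                 (forall y, U (pi y) -> F (pi y, T y) = y)] &
             (forall x a b, U x -> act (F (x, a)) b = F (x, (a * b)%g))])].

(* K, with the embedding i, is H with its structure of Lie subgroup of G
   (unique up to isomorphism). *)
Definition reducible
    (M : topologicalType) m (AM : set (chart R M m))
    (G : topologicalGroupType) d (AG : set (chart R G d))
    (P : topologicalType) p (AP : set (chart R P p))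
    (pi : P -> M) (act : P -> G -> P) (H : set G) : Prop :=
  exists (K : topologicalGroupType) (k : nat) (AK : set (chart R K k))
         (i : K -> G),
    [/\ lie_group AK,
        (forall a b : K, i (a * b)%g = (i a * i b)%g),
        embedding AK AG i,
        range i = H &
        exists (Q : topologicalType) (q : nat) (AQ : set (chart R Q q))
               (piQ : Q -> M) (actQ : Q -> K -> Q) (Psi : Q -> P),
          [/\ principal_bundle AM AK AQ piQ actQ,
              smooth_map AQ AP Psi,
              (forall y a, Psi (actQ y a) = act (Psi y) (i a)) &
              (forall y, pi (Psi y) = piQ y)]].

Definition correspondence (X Y : Type) (C : set (X * Y)) : Prop :=
  (forall x, exists y, C (x, y)) /\ (forall y, exists x, C (x, y)).

Definition distortion (X Y : metricType R) (C : set (X * Y)) : R :=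
  sup [set r : R | exists z z', [/\ C z, C z' &
         r = `|mdist z.1 z'.1 - mdist z.2 z'.2|]].

Definition GH_distance (X Y : metricType R) : R :=
  2^-1 * inf [set distortion C | C in @correspondence X Y].

(* Elements of the Gromov-Hausdorff space are represented by nonempty compact
   metric spaces; subsets of it are predicates on metricType R, which is too
   large a type to be the argument of [set]. *)
Definition GH_space (X : metricType R) : Prop :=
  [set: X] !=set0 /\ compact [set: X].

Definition GH_closure (S : metricType R -> Prop) (X : metricType R) : Prop :=
  GH_space X /\
  forall e : R, 0 < e ->
    exists Y, [/\ GH_space Y, S Y & GH_distance X Y < e].

Definition isometric_to (X : metricType R) (T : Type) (d : T -> T -> R) :
    Prop :=
  exists2 f : X -> T, bijective f & forall x y, d (f x) (f y) = mdist x y.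

(* The isometry classes of (P, d_g), g a Riemannian metric on P. *)
Definition riemannian_classes (P : topologicalType) p
    (A : set (chart R P p)) (X : metricType R) : Prop :=
  exists2 g, riemannian_metric A g & isometric_to X (riemannian_distance A g).

End Manifolds.

(* Main.v *)
(* A reduction Psi : Q -> P to H makes f : P -> G/H, f (Psi(q) a) = a^-1 H, a
   well-defined smooth surjective submersion, whose fibres Psi(Q) a^-1 are
   connected because M and H are.  The pullback f^* gT is a degenerate metric
   tensor on P.  Its length pseudo-distance vanishes along the fibres, and
   curves of G/H lift infinitesimally along f, so it equals
   d_gT (f y) (f y').  For a Riemannian metric h on P, the metrics
   f^* gT + a h decrease to f^* gT as a -> 0, and by compactness of P their
   distances converge uniformly; the graph of f is then a correspondence
   between (P, f^* gT + a h) and (G/H, gT) of arbitrarily small distortion. *)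

Require Import Defs.
From HB Require Import structures.
From mathcomp Require Import all_boot all_order all_algebra.
From mathcomp Require Import all_classical all_reals all_analysis.
From mathcomp Require Import generic_quotient.
From mathcomp Require Import ring lra.
Import Order.TTheory GRing.Theory Num.Theory numFieldNormedType.Exports.
Local Open Scope classical_set_scope.
Local Open Scope ring_scope.
Set Implicit Arguments.
Unset Strict Implicit.
Unset Printing Implicit Defensive.

(** * Calculus of C^k maps *)

(** Lifting a whole curve of G/H horizontally would mean solving a differential equation. Only
    distances matter, however: once the fibres have diameter 0 for the pullback pseudo-distance, a
    lift may be restarted anywhere in a fibre. It then suffices to reach the fibre over a nearby
    point of the curve at a cost of at most (speed + e) times the elapsed time. Graves' theorem
    provides the nearby point, and the bound is integrated along the curve by an argument that asks
    for no differentiability of the distance. The same comparison principle shows that a Riemannian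
    distance separates points.

    Since degenerate and definite tensors have to be compared, lengths and distances are developed
    for positive semidefinite tensors up to the triangle inequality. For the uniform convergence,
    the h-lengths of near-minimal paths are not bounded a priori; a finite net for the largest of
    the distances, that of f^* gT + h, leaves finitely many paths to control. *)

Section DiffLocal.
Variables (R : realType) (V W : normedModType R).
Implicit Types (f g : V -> W) (x : V) (D : set V) (k : nat).

Lemma eqaddo_epsP f (L : V -> W) x :
  (f \o shift x = cst (f x) + L +o_ 0 id) <->
  (forall e, 0 < e ->
     \forall y \near x, `|f y - f x - L (y - x)| <= e * `|y - x|).
Proof.
rewrite eqaddoP; split => h e e0.
- rewrite (near_shift 0 x); have := h e e0; apply: filterS => y /=.
  by rewrite !fctE /= subr0 addrK opprD addrA.
- have := h e e0; rewrite (near_shift 0 x); apply: filterS => y /=.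
  by rewrite !fctE /= subr0 addrK opprD addrA.
Qed.

Lemma diff_eps f (L : {linear V -> W}) x : continuous L ->
  (forall e, 0 < e ->
     \forall y \near x, `|f y - f x - L (y - x)| <= e * `|y - x|) ->
  is_diff x f L.
Proof.
move=> cL /eqaddo_epsP h.
have dE := diff_unique cL h.
by constructor=> //; apply/diff_locallyP; rewrite dE.
Qed.

Lemma differentiable_eps f x : differentiable f x ->
  forall e, 0 < e ->
     \forall y \near x, `|f y - f x - 'd f x (y - x)| <= e * `|y - x|.
Proof. by move=> /diff_locallyP[_ /eqaddo_epsP]. Qed.

(** A coordinate expression agrees with the map it represents only near a point, because [cinv] is
    arbitrary off the image of the chart. Every computation of a differential in charts passes
    through this lemma. *)
Lemma near_is_diff f g x : (\forall y \near x, f y = g y) ->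
  differentiable f x -> is_diff x g ('d f x).
Proof.
move=> fg df; apply: diff_eps => [|e e0]; first exact: diff_continuous.
have fgx := nbhs_singleton fg.
by apply: filterS2 fg (differentiable_eps df e0) => y -> /=; rewrite fgx.
Qed.

Lemma near_diffE f g x v : (\forall y \near x, f y = g y) ->
  differentiable f x -> 'd g x v = 'd f x v.
Proof.
move=> fg df; have [_ E] := near_is_diff fg df.
exact: (congr1 (fun h : V -> W => h v) E).
Qed.

Lemma CkSP k D f : Ck k.+1 D f <->
  (forall x, D x -> differentiable f x) /\
  (forall v : V, Ck k D (fun x => 'd f x v)).
Proof. by []. Qed.

Lemma Ck_eq k D f g : open D -> (forall x, D x -> f x = g x) ->
  Ck k D f -> Ck k D g.
Proof.
move=> oD; elim: k f g => [|k IH] f g fg /=.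
  move=> cf x Dx; have nD : nbhs x D by exact: open_nbhs_nbhs.
  have : f @ x --> g x by rewrite -fg//; exact: cf.
  move=> h; apply: cvg_trans h; apply: near_eq_cvg.
  by apply: filterS nD => y /fg.
have nfg x : D x -> \forall y \near x, f y = g y.
  by move=> Dx; apply: (@filterS _ _ _ D) => //; exact: open_nbhs_nbhs.
move=> [df dvf]; split=> [x Dx|v].
  by have [] := near_is_diff (nfg _ Dx) (df _ Dx).
apply: IH (dvf v) => x Dx.
by case: (near_is_diff (nfg _ Dx) (df _ Dx)) => _ E; exact/esym/(congr1 (fun h : V -> W => h v) E).
Qed.

Lemma Ck_sub k D D' f : D' `<=` D -> Ck k D f -> Ck k D' f.
Proof.
move=> sD; elim: k f => [|k IH] f /=; first by move=> h x /sD/h.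
by move=> [df dv]; split=> [x /sD/df//|v]; exact: IH.
Qed.

(** At every level [Ck] speaks of continuity and differentials in the whole space, taken at the
    points of [D]. It is therefore a pointwise condition, and singletons may be used although they
    are not open. *)
Lemma Ck_pt k D f : (forall x, D x -> Ck k [set x] f) -> Ck k D f.
Proof.
elim: k f => [|k IH] f /= h; first by move=> x /h; exact.
split=> [x /h[+ _]|v]; first exact.
by apply: IH => x /h[_].
Qed.

Lemma Ck_local k D f :
  (forall x, D x -> exists (U : set V) g,
     [/\ open U, U x, forall y, U y -> g y = f y & Ck k U g]) -> Ck k D f.
Proof.
move=> h; apply: Ck_pt => x /h[U [g [oU Ux gf Cg]]].
apply: (@Ck_sub k U); first by move=> _ ->.
exact: Ck_eq Cg.
Qed.

Lemma CkW k D f : Ck k.+1 D f -> Ck k D f.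
Proof.
elim: k f => [|k IH] f /=.
  by move=> [df _] x Dx; apply: differentiable_continuous; exact: df.
by move=> [df dv]; split=> // v; apply: IH.
Qed.

Lemma Ck_cst k D (a : W) : Ck k D (fun=> a).
Proof.
elim: k a => [|k IH] a /=; first by move=> x _; exact: cst_continuous.
split=> [x _|v]; first exact: differentiable_cst.
rewrite (_ : (fun x => _) = fun=> 0); first exact: IH.
by apply: funext => x; rewrite diff_cst.
Qed.

Lemma Ck_add k D f g : open D -> Ck k D f -> Ck k D g -> Ck k D (f \+ g).
Proof.
move=> oD; elim: k f g => [|k IH] f g /=.
  by move=> cf cg x Dx; apply: continuousD; [exact: cf|exact: cg].
move=> [df dvf] [dg dvg]; split=> [x Dx|v].
  by apply: differentiableD; [exact: df|exact: dg].
apply: Ck_eq (IH _ _ (dvf v) (dvg v)) => //= x Dx.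
exact/esym/(congr1 (fun h : V -> W => h v) (diffD (df _ Dx) (dg _ Dx))).
Qed.

Lemma Ck_sum k D (I : Type) (r : seq I) (P : pred I) (F : I -> V -> W) :
  open D -> (forall i, P i -> Ck k D (F i)) ->
  Ck k D (fun x => \sum_(i <- r | P i) F i x).
Proof.
move=> oD h; elim: r => [|i r IH].
  by rewrite (_ : (fun x => _) = fun=> 0); [exact: Ck_cst|apply: funext => x; rewrite big_nil].
case Pi: (P i); last first.
  rewrite (_ : (fun x => _) = fun x => \sum_(i <- r | P i) F i x) //.
  by apply: funext => x; rewrite big_cons Pi.
rewrite (_ : (fun x => _) = F i \+ fun x => \sum_(i <- r | P i) F i x).
  by apply: Ck_add => //; exact: h.
by apply: funext => x; rewrite big_cons Pi.
Qed.

End DiffLocal.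

Lemma diff_compE (R : realType) (U V W : normedModType R) (f : U -> V)
    (g : V -> W) x v : differentiable f x -> differentiable g (f x) ->
  'd (g \o f) x v = 'd g (f x) ('d f x v).
Proof. by move=> df dg; exact: (congr1 (fun h : U -> W => h v) (diff_comp df dg)). Qed.

Lemma cvg_at (T : Type) (V U : topologicalType) (F : set_system T) (FF : Filter F)
    (f : T -> V) (h : V -> U) a :
  {for a, continuous h} -> f @ F --> a -> (fun x => h (f x)) @ F --> h a.
Proof. by move=> ch fa; exact: (continuous_cvg FF ch fa). Qed.

Section DiffComp.
Variables (R : realType) (V : normedModType R).
Implicit Types (D : set V) (k : nat).

Lemma Ck_linear_comp (W Z : normedModType R) k D (L : {linear W -> Z}) (f : V -> W) :
  open D -> continuous L -> Ck k D f -> Ck k D (L \o f).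
Proof.
move=> oD cL; elim: k f => [|k IH] f /=.
  by move=> cf x Dx; apply: continuous_comp; [exact: cf|exact: cL].
move=> [df dvf]; split=> [x Dx|v].
  by apply: differentiable_comp; [exact: df|exact: linear_differentiable].
apply: Ck_eq (IH _ (dvf v)) => //= x Dx.
have -> := diff_comp (df _ Dx) (linear_differentiable (f x) cL).
by rewrite diff_lin.
Qed.

Lemma Ck_linear (W : normedModType R) k D (L : {linear V -> W}) :
  continuous L -> Ck k D L.
Proof.
move=> cL; case: k => [|k] /=; first by move=> x _; exact: cL.
split=> [x _|v]; first exact: linear_differentiable.
rewrite (_ : (fun x => _) = fun=> L v); first exact: Ck_cst.
by apply: funext => x; rewrite diff_lin.
Qed.

Lemma Ck_mul k D (f g : V -> R) : open D -> Ck k D f -> Ck k D g ->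
  Ck k D (fun x => f x * g x).
Proof.
move=> oD; elim: k f g => [|k IH] f g.
  by move=> cf cg x Dx; apply: continuousM; [exact: cf|exact: cg].
move=> Cf Cg; have [/CkSP[df dvf] /CkSP[dg dvg]] := (Cf, Cg); split=> [x Dx|v].
  exact: differentiableM (df _ Dx) (dg _ Dx).
have h1 := IH _ _ (CkW Cf) (dvg v); have h2 := IH _ _ (CkW Cg) (dvf v).
apply: Ck_eq (Ck_add oD h1 h2) => //= x Dx.
exact/esym/(congr1 (fun h : V -> R => h v) (diffM (df _ Dx) (dg _ Dx))).
Qed.

(* The finite basis (e, l) of W turns the chain rule into a finite sum of
   products of scalar functions. *)
Lemma Ck_comp_basis (W : normedModType R) n (e : 'I_n -> W)
    (l : 'I_n -> {linear W -> R}) :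
  (forall i, continuous (l i)) -> (forall w, w = \sum_i l i w *: e i) ->
  forall k D (E : set W) (f : V -> W) (g : W -> R), open D ->
    (forall x, D x -> E (f x)) -> Ck k D f -> Ck k E g -> Ck k D (g \o f).
Proof.
move=> cl le k D E f g oD fDE; elim: k g => [|k IH] g.
  by move=> cf cg x Dx; apply: continuous_comp; [exact: cf|apply: cg; exact: fDE].
move=> Cf /CkSP[dg dvg]; have /CkSP[df dvf] := Cf; split=> [x Dx|v].
  by apply: differentiable_comp; [exact: df|apply: dg; exact: fDE].
have h i : Ck k D (fun x => l i ('d f x v) * 'd g (f x) (e i)).
  apply: Ck_mul => //; first exact: (Ck_linear_comp oD (cl i) (dvf v)).
  exact: (IH _ (CkW Cf) (dvg (e i))).
apply: Ck_eq (Ck_sum (index_enum 'I_n) oD (fun i (_ : true) => h i)) => // x Dx.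
have -> := diff_comp (df _ Dx) (dg _ (fDE _ Dx)); rewrite /=.
rewrite [in RHS](le ('d f x v)) linear_sum; apply: eq_bigr => i _.
by rewrite linearZ.
Qed.

End DiffComp.

Section ScaleLin.
Variables (R : realType) (W : normedModType R) (w : W).
Definition scale_lin (a : R) : W := a *: w.
Lemma scale_lin_linear : linear scale_lin.
Proof. by move=> a u v; rewrite /scale_lin scalerDl scalerA. Qed.
HB.instance Definition _ := GRing.isLinear.Build R R W *:%R scale_lin scale_lin_linear.
End ScaleLin.

Section MxCoord.
Variables (R : realType) (m n : nat) (i : 'I_m) (j : 'I_n).
Definition mxcoord (M : 'M[R]_(m, n)) : R := M i j.
Lemma mxcoord_linear : linear mxcoord.
Proof. by move=> a u v; rewrite /mxcoord !mxE. Qed.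
HB.instance Definition _ := GRing.isLinear.Build R 'M[R]_(m, n) R *:%R mxcoord mxcoord_linear.
Lemma mxcoord_continuous : continuous mxcoord.
Proof. exact: coord_continuous. Qed.

End MxCoord.

Section CkMx.
Variables (R : realType) (V : normedModType R).
Implicit Types (D : set V) (k : nat).

Lemma Ck_mxP k D m n (M : V -> 'M[R]_(m, n)) : open D ->
  Ck k D M <-> forall i j, Ck k D (fun x => M x i j).
Proof.
move=> oD; split=> [CM i j|h].
  exact: (Ck_linear_comp oD (@mxcoord_continuous R m n i j) CM).
have h2 i j : Ck k D (fun x => M x i j *: delta_mx i j : 'M[R]_(m, n)).
  exact: (Ck_linear_comp (L := scale_lin (delta_mx i j)) oD (@scalel_continuous _ _ _) (h i j)).
have := Ck_sum (index_enum _) oD (fun i (_ : true) => Ck_sum (index_enum _) oD (fun j (_ : true)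
  => h2 i j)).
apply: Ck_eq => // x Dx; rewrite [RHS]matrix_sum_delta.
by apply: eq_bigr.
Qed.

Lemma Ck_comp k D n m p (E : set 'rV[R]_n) (f : V -> 'rV[R]_n)
    (g : 'rV[R]_n -> 'M[R]_(m, p)) :
  open D -> (forall x, D x -> E (f x)) -> Ck k D f ->
  (forall i j, Ck k E (fun y => g y i j)) -> Ck k D (g \o f).
Proof.
move=> oD fDE Cf Cg; apply/Ck_mxP => // i j.
apply: (Ck_comp_basis (e := fun j => delta_mx 0 j)
   (l := fun j => @mxcoord R 1 n 0 j : {linear _ -> _}) _ _ oD fDE Cf (Cg i j)).
  by move=> ?; exact: mxcoord_continuous.
by move=> w; rewrite [LHS]row_sum_delta.
Qed.

Lemma Ck_comp_scalar k D (E : set R) (f : V -> R) (g : R -> R) :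
  open D -> (forall x, D x -> E (f x)) -> Ck k D f ->
  Ck k E g -> Ck k D (g \o f).
Proof.
move=> oD fDE Cf Cg.
apply: (@Ck_comp_basis R V R 1 (fun=> 1) (fun=> (idfun : {linear R -> R})) _ _ k D E f g) => //.
  by move=> _ ?.
by move=> w; rewrite big_ord1 /= [RHS]mulr1.
Qed.

End CkMx.

(** * The functions x^-n exp (-1/x) *)

Section Rapid.
Variable R : realType.

Lemma is_diff_is_derive (W : normedModType R) (f : R -> W) (x : R) (a : W) :
  is_derive x 1 f a -> is_diff x f (scale_lin a).
Proof.
move=> [df fa]; apply: DiffDef; first exact/derivable1_diffP.
by rewrite diff1E ?derive1E ?fa //; exact/derivable1_diffP.
Qed.

Lemma is_derive_is_diff (V W : normedModType R) (f : V -> W) (x v : V) (L : V -> W) :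
  is_diff x f L -> is_derive x v f (L v).
Proof.
move=> dL; have df : differentiable f x by [].
apply: DeriveDef; first exact: diff_derivable.
by rewrite deriveE // diff_val.
Qed.

(** Only [rapid 0], the classical flat function, enters the bump functions. The derivative of a
    member involves higher powers of 1/x, so smoothness is proved by induction for all [n] at
    once. *)
Definition rapid n (x : R) : R :=
  if 0 < x then x^-1 ^+ n * expR (- x^-1) else 0.

Lemma rapid_ge0 n x : 0 <= rapid n x.
Proof.
rewrite /rapid; case: ifP => // x0.
by rewrite mulr_ge0 ?expR_ge0// exprn_ge0// invr_ge0 ltW.
Qed.

(** One term of the exponential series suffices: exp (1/x) is at least (1/x)^(n+2) / (n+2)!. The
    quadratic bound makes the derivative at 0 vanish. *)
Lemma rapid_le n x : rapid n x <= (n.+2)`!%:R * x ^+ 2.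
Proof.
rewrite /rapid; case: ifP => x0; last by rewrite mulr_ge0 ?sqr_ge0.
have xV0 : 0 < x^-1 by rewrite invr_gt0.
have fn0 : (0 : R) < (n.+2)`!%:R by rewrite ltr0n fact_gt0.
have h := expR_ge1Dxn n.+1 (ltW xV0).
rewrite expRN -ler_pdivlMr ?invr_gt0 ?expR_gt0// invrK.
have {}h : x^-1 ^+ n.+2 / (n.+2)`!%:R <= expR x^-1 by apply: le_trans h; rewrite lerDr.
apply: (@le_trans _ _ ((n.+2)`!%:R * x ^+ 2 * (x^-1 ^+ n.+2 / (n.+2)`!%:R))); last first.
  by rewrite ler_wpM2l // mulr_ge0 ?sqr_ge0 // ltW.
have e2 : x ^+ n.+2 = x ^+ n * x ^+ 2 by rewrite -exprD addn2.
rewrite !exprVn e2 le_eqVlt; apply/orP; left; apply/eqP.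
have xn0 : x != 0 by rewrite gt_eqF.
move: fn0; set F := (_`!)%:R => fn0; field.
by rewrite expf_neq0 // xn0 gt_eqF.
Qed.

Lemma rapid_derive (n : nat) (x : R) :
  is_derive x 1 (rapid n) (rapid n.+2 x - n%:R * rapid n.+1 x).
Proof.
case: (ltgtP 0 x) => [x0|x0|<-].
- have xn0 : x != 0 by rewrite gt_eqF.
  have nE : \forall y \near x, (fun y => y^-1 ^+ n * expR (- y^-1)) y = rapid n y.
    have : \forall y \near x, 0 < y by exact: lt_nbhsr.
    by apply: filterS => y; rewrite /rapid => ->.
  apply: near_eq_is_derive nE _.
  have dV : is_derive x 1 (fun y : R => y^-1) (- x ^- 2).
    have := @is_deriveV R id x 1 1 xn0 (is_derive_id _ _).
    by rewrite /= scaler1.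
  have dn : is_derive x 1 (fun y : R => y^-1 ^+ n) (- n%:R * x^-1 ^+ n.+1).
    case: n => [|n].
      rewrite (_ : (fun y => _) = cst 1); last by apply: funext => y; rewrite expr0.
      by rewrite mulr0n oppr0 mul0r; exact: is_derive_cst.
    have -> : (fun y : R => y^-1 ^+ n.+1) = (fun y : R => y^-1) ^+ n.+1 by rewrite exprfctE.
    apply: is_derive_eq; rewrite /= -[LHS]/(_ * _) mulrN -mulNr !exprVn !exprS; field.
    by rewrite expf_neq0.
  have dN : is_derive x 1 (fun y : R => - y^-1) (x ^- 2).
    by have := is_deriveN dV; rewrite opprK.
  have de : is_derive x 1 (expR \o (fun y : R => - y^-1)) (x ^- 2 * expR (- x^-1)).
    have d1 := is_diff_is_derive (is_derive_expR (- x^-1)).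
    have d2 := is_diff_is_derive dN.
    have := is_derive_is_diff (1 : R) (is_diff_comp d2 d1).
    by rewrite /= /scale_lin scale1r.
  have [M1 M2] := is_deriveM dn de; apply: (DeriveDef M1); rewrite [LHS]M2.
  rewrite /rapid x0 /= -![_ *: _]/(_ * _) !exprVn !exprS; field.
  by rewrite expf_neq0.
- have -> : rapid n.+2 x - n%:R * rapid n.+1 x = 0.
    by rewrite /rapid ltNge (ltW x0) /= mulr0 subrr.
  apply: (@near_eq_is_derive _ _ _ (cst (0 : R)) _ _ _ _ _ (is_derive_cst (0 : R) x 1)).
  have : \forall y \near x, y < 0 by exact: lt_nbhsl.
  by apply: filterS => y y0; rewrite /rapid ltNge (ltW y0).
- have -> : rapid n.+2 0 - n%:R * rapid n.+1 0 = 0.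
    by rewrite /rapid ltxx mulr0 subrr.
  have : is_diff (0 : R) (rapid n) (scale_lin (0 : R)).
    apply: diff_eps => [|e e0]; first exact: scalel_continuous.
    set C := (n.+2)`!%:R : R.
    have C0 : 0 < C by rewrite ltr0n fact_gt0.
    have d0 : 0 < e / C by rewrite divr_gt0.
    have : \forall y \near (0 : R), `|y| <= e / C by exact: nbhs0_le.
    apply: filterS => y yd.
    rewrite /= {1}/scale_lin scaler0 !subr0 {2}/rapid ltxx subr0 ger0_norm ?rapid_ge0//.
    apply: le_trans (rapid_le n y) _; rewrite -/C -real_normK ?num_real// expr2 mulrA.
    apply: ler_wpM2r => //; rewrite mulrC -ler_pdivlMr //.
  by move/(is_derive_is_diff (1 : R)); rewrite /scale_lin scaler0.
Qed.

Lemma rapid_smooth n : Cinfty setT (rapid n).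
Proof.
move=> k; elim: k n => [|k IH] n.
  move=> x _; apply: differentiable_continuous.
  by have [] := is_diff_is_derive (rapid_derive n x).
apply/CkSP; split=> [x _|v].
  by have [] := is_diff_is_derive (rapid_derive n x).
have -> : (fun x => 'd (rapid n) x v) =
    (fun x => v * rapid n.+2 x) \+ (fun x => - (v * n%:R) * rapid n.+1 x).
  apply: funext => x; have [_ ->] := is_diff_is_derive (rapid_derive n x).
  by rewrite /scale_lin -[LHS]/(_ * _) /= mulrBr mulNr mulrA.
by apply: Ck_add openT _ _; apply: Ck_mul openT (Ck_cst _ _ _) (IH _).
Qed.

End Rapid.

(** * Charts and smooth maps *)

Section Charts.
Variable R : realType.

(** The part of [smooth_manifold] on which composition and locality rest. It passes to [prod_atlas]
    without a study of the transition maps between product charts. *)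
Definition covering_atlas (X : topologicalType) n (A : set (chart R X n)) : Prop :=
  (forall phi, A phi -> is_chart phi) /\
  (forall x, exists2 phi, A phi & dom phi x).

Lemma smooth_manifold_covering (X : topologicalType) n (A : set (chart R X n)) :
  smooth_manifold A -> covering_atlas A.
Proof. by case. Qed.

Lemma near_chart (X : topologicalType) n (phi : chart R X n) x (W : set X) :
  is_chart phi -> dom phi x -> nbhs x W ->
  \forall u \near cmap phi x,
    [/\ dom phi (cinv phi u), W (cinv phi u) & cmap phi (cinv phi u) = u].
Proof.
move=> [od oi K _ ci] dx nW.
have nW' : nbhs (cinv phi (cmap phi x)) (dom phi `&` W).
  by rewrite K //; apply: filterI => //; exact: open_nbhs_nbhs.
have n1 : nbhs (cmap phi x) (fun u => (dom phi `&` W) (cinv phi u)) := ci x dx _ nW'.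
have n2 : nbhs (cmap phi x) (cmap phi @` dom phi).
  by apply: open_nbhs_nbhs; split => //; exists x.
apply: filterS2 n1 n2 => u [du Wu] [y dy yu]; split => //.
by rewrite -yu K.
Qed.

Lemma open_chart_image (X : topologicalType) n (phi : chart R X n) (W : set X) :
  is_chart phi -> (forall x, dom phi x -> W x -> nbhs x W) ->
  open (cmap phi @` (dom phi `&` W)).
Proof.
move=> cphi nW; rewrite openE => u [x [dx Wx] <-].
have := near_chart cphi dx (nW x dx Wx).
by apply: filterS => v [dv Wv vK]; exists (cinv phi v).
Qed.

Lemma nbhs_dom (X : topologicalType) n (phi : chart R X n) x :
  is_chart phi -> dom phi x -> nbhs x (dom phi).
Proof. by move=> [od _ _ _ _] dx; exact: open_nbhs_nbhs. Qed.

Section Smooth.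
Variables (X Y : topologicalType) (n k : nat).
Variables (A : set (chart R X n)) (B : set (chart R Y k)).
Hypotheses (hA : covering_atlas A) (hB : covering_atlas B).

Lemma smooth_domain_open (U : set X) (f : X -> Y) phi psi :
  open U -> (forall x, U x -> {for x, continuous f}) -> A phi -> B psi ->
  open (cmap phi @` (dom phi `&` U `&` f @^-1` dom psi)).
Proof.
move=> oU cf Aphi Bpsi; rewrite -setIA; apply: open_chart_image; first exact: hA.1.
move=> x dx [Ux fx]; apply: filterI; first exact: open_nbhs_nbhs.
by apply: cf => //; exact: nbhs_dom (hB.1 _ Bpsi) fx.
Qed.

Lemma smooth_on_sub (U U' : set X) (f : X -> Y) :
  U' `<=` U -> smooth_on A B U f -> smooth_on A B U' f.
Proof.
move=> sU [cf sf]; split=> [x /sU/cf//|phi psi Aphi Bpsi j].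
apply: Ck_sub (sf _ _ Aphi Bpsi j); apply: image_subset.
by apply: setSI; apply: setIS.
Qed.

Lemma smooth_on_local (U : set X) (f : X -> Y) : open U ->
  (forall x, U x -> exists (U' : set X) g,
     [/\ open U', U' x, forall y, U' y -> g y = f y & smooth_on A B U' g]) ->
  smooth_on A B U f.
Proof.
move=> oU h.
have cf x : U x -> {for x, continuous f}.
  move=> /h[U' [g [oU' U'x gf [cg _]]]].
  have nU : nbhs x U' by exact: open_nbhs_nbhs.
  have : g @ x --> f x by rewrite -gf//; exact: cg.
  by apply: cvg_trans; apply: near_eq_cvg; apply: filterS nU => y /gf.
split=> // phi psi Aphi Bpsi j; apply: Ck_local => u [x [[dx Ux] fx] <-].
have [U' [g [oU' U'x gf [cg sg]]]] := h x Ux.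
exists (cmap phi @` (dom phi `&` U' `&` g @^-1` dom psi)), (coord_map phi psi g).
have [_ _ K _ _] := hA.1 _ Aphi.
split.
- exact: smooth_domain_open.
- by exists x => //; split => //=; rewrite gf.
- by move=> _ [y [[dy U'y] gy] <-]; rewrite /coord_map K // gf.
- exact: sg.
Qed.

Lemma smooth_on_cst (U : set X) (b : Y) : smooth_on A B U (fun=> b).
Proof.
split=> [x _|phi psi _ _ j]; first exact: cst_continuous.
exact: Ck_cst.
Qed.

Lemma smooth_on_differentiable (U : set X) (f : X -> Y) phi psi x :
  smooth_on A B U f -> A phi -> B psi -> U x -> dom phi x -> dom psi (f x) ->
  differentiable (coord_map phi psi f) (cmap phi x).
Proof.
move=> [_ sf] Aphi Bpsi Ux dx fx; have /CkSP[h _] := sf phi psi Aphi Bpsi 1%N.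
by apply: h; exists x.
Qed.

Lemma coord_mapE (f : X -> Y) (phi : chart R X n) (psi : chart R Y k) x : A phi -> dom phi x ->
  coord_map phi psi f (cmap phi x) = cmap psi (f x).
Proof. by move=> Aphi dx; have [_ _ K _ _] := hA.1 _ Aphi; rewrite /coord_map K. Qed.

End Smooth.

(** The chart of the middle space has to follow the point, so the coordinate expression of the
    composite factors only locally, whence [Ck_local]. *)
Lemma smooth_on_comp (X Y Z : topologicalType) n k l (A : set (chart R X n))
    (B : set (chart R Y k)) (C : set (chart R Z l)) (U : set X) (W : set Y) f g :
  covering_atlas A -> covering_atlas B -> covering_atlas C -> open U ->
  open W -> (forall x, U x -> W (f x)) ->
  smooth_on A B U f -> smooth_on B C W g -> smooth_on A C U (g \o f).
Proof.
move=> hA hB hC oU oW fUW [cf sf] [cg sg].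
have cgf x : U x -> {for x, continuous (g \o f)}.
  by move=> Ux; apply: continuous_comp; [exact: cf|apply: cg; exact: fUW].
split=> // phi chi Aphi Cchi j; apply: Ck_local => u [x [[dx Ux] gfx] <-].
have [psi Bpsi fx] := hB.2 (f x).
have [_ _ KA _ _] := hA.1 _ Aphi.
have [_ _ KB _ _] := hB.1 _ Bpsi.
exists (cmap phi @` (dom phi `&` (U `&` (f @^-1` dom psi `&` (g \o f) @^-1` dom chi)))),
  (coord_map psi chi g \o coord_map phi psi f).
have oD : open (cmap phi @` (dom phi `&` (U `&` (f @^-1` dom psi `&` (g \o f) @^-1` dom chi)))).
  apply: open_chart_image; first exact: hA.1.
  move=> y dy [Uy [fy gfy]]; apply: filterI; first exact: open_nbhs_nbhs.
  apply: filterI; first by apply: cf => //; exact: nbhs_dom (hB.1 _ Bpsi) fy.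
  by apply: (cgf _ Uy); exact: nbhs_dom (hC.1 _ Cchi) gfy.
split=> //.
- by exists x.
- by move=> _ [y [dy [Uy [fy gfy]]] <-]; rewrite /coord_map /= KA // KB.
- apply: (@Ck_comp R _ _ _ _ _ _ (cmap psi @` (dom psi `&` W `&` g @^-1` dom chi))) => //.
  + move=> _ [y [dy [Uy [fy gfy]]] <-]; exists (f y); last by rewrite /coord_map KA.
    by split => //; split => //; exact: fUW.
  + apply: Ck_sub (sf _ _ Aphi Bpsi j).
    by move=> _ [y [dy [Uy [fy gfy]]] <-]; exists y.
  + have oE := smooth_domain_open hB hC oW cg Bpsi Cchi.
    exact: (proj1 (Ck_mxP _ _ oE) (sg _ _ Bpsi Cchi j)).
Qed.

Section TangentComp.
Variables (X Y Z : topologicalType) (n k l : nat) (A : set (chart R X n)).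
Variables (B : set (chart R Y k)) (C : set (chart R Z l)).
Hypotheses (hA : covering_atlas A) (hB : covering_atlas B) (hC : covering_atlas C).

Lemma tangent_comp (U : set X) (W : set Y) f g phi psi chi x :
  open U -> smooth_on A B U f -> smooth_on B C W g ->
  A phi -> B psi -> C chi -> U x -> W (f x) ->
  dom phi x -> dom psi (f x) -> dom chi (g (f x)) ->
  forall v, tangent phi chi (g \o f) x v = tangent psi chi g (f x) (tangent phi psi f x v).
Proof.
move=> oU sf sg Aphi Bpsi Cchi Ux Wfx dx dfx dgfx v.
have df := smooth_on_differentiable sf Aphi Bpsi Ux dx dfx.
have dg := smooth_on_differentiable sg Bpsi Cchi Wfx dfx dgfx.
rewrite /tangent.
have E0 := coord_mapE hA f psi Aphi dx.
rewrite -E0 in dg *.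
have [_ E] : is_diff (cmap phi x) (coord_map phi chi (g \o f))
    ('d (coord_map psi chi g \o coord_map phi psi f) (cmap phi x)).
  apply: near_is_diff; last exact: differentiable_comp.
  have := near_chart (hA.1 _ Aphi) dx (sf.1 x Ux _ (nbhs_dom (hB.1 _ Bpsi) dfx)).
  apply: filterS => u [_ /= du _]; rewrite /coord_map /=.
  by have [_ _ KB _ _] := hB.1 _ Bpsi; rewrite KB.
rewrite (congr1 (fun h : _ -> _ => h v) E).
exact: (congr1 (fun h : _ -> _ => h v) (diff_comp df dg)).
Qed.

End TangentComp.

Lemma smooth_map_id (X : topologicalType) n (A : set (chart R X n)) :
  smooth_manifold A -> smooth_map A A id.
Proof.
move=> [_ _ _ _ h]; split=> [x _|phi psi Aphi Apsi]; first exact: id.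
by rewrite setIT; exact: h.
Qed.

Lemma tangent_id (X : topologicalType) n (phi : chart R X n) x v :
  is_chart phi -> dom phi x -> tangent phi phi id x v = v.
Proof.
move=> cphi dx; rewrite /tangent.
have h : \forall u \near cmap phi x, id u = coord_map phi phi id u.
  have := near_chart cphi dx (nbhs_dom cphi dx).
  by apply: filterS => u [_ _ uK]; rewrite /coord_map uK.
have [d1 d2] := is_diff_id (cmap phi x).
have [_ E] := near_is_diff h d1.
rewrite (congr1 (fun h : _ -> _ => h v) E).
exact: (congr1 (fun h : _ -> _ => h v) d2).
Qed.

Lemma continuous_at_pair (S T1 T2 : topologicalType) (f : S -> T1) (g : S -> T2) x :
  {for x, continuous f} -> {for x, continuous g} ->
  {for x, continuous (fun p => (f p, g p))}.
Proof. by move=> cf cg; apply: cvg_pair; [exact: cf|exact: cg]. Qed.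

Section Products.
Variables (X Y Z : topologicalType) (n k l : nat) (A : set (chart R X n)).
Variables (B : set (chart R Y k)) (C : set (chart R Z l)).
Hypotheses (hA : covering_atlas A) (hB : covering_atlas B) (hC : covering_atlas C).

Lemma continuous_row_mx :
  continuous (fun p : 'rV[R]_k * 'rV[R]_l => row_mx p.1 p.2).
Proof.
move=> [a b]; apply/cvgrPdist_lt => e e0.
have : nbhs (a, b) [set p | `|a - p.1| < e /\ `|b - p.2| < e].
  exists (ball a e, ball b e) => /=; first by split; exact: nbhsx_ballx.
  by move=> p []; rewrite -!ball_normE.
apply: filterS => p [pa pb].
rewrite /= opp_row_mx add_row_mx [ltLHS]/Num.Def.normr /= mx_normrE.
apply: bigmax_lt => //= -[i j] _ /=; rewrite mxE.
case: (splitP j) => j' _.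
  apply: le_lt_trans pa; rewrite [leRHS]/Num.Def.normr /= mx_normrE.
  exact: (le_bigmax _ (fun ij => `|(a - p.1) ij.1 ij.2|) (i, j')).
apply: le_lt_trans pb; rewrite [leRHS]/Num.Def.normr /= mx_normrE.
exact: (le_bigmax _ (fun ij => `|(b - p.2) ij.1 ij.2|) (i, j')).
Qed.

Lemma covering_prod_atlas : covering_atlas (prod_atlas B C).
Proof.
split=> [_ [phi [psi [Bphi Cpsi ->]]]|[y z]]; last first.
  have [phi Bphi dy] := hB.2 y; have [psi Cpsi dz] := hC.2 z.
  by exists (prod_chart phi psi) => //; exists phi, psi.
have [od1 oi1 K1 c1 ci1] := hB.1 _ Bphi; have [od2 oi2 K2 c2 ci2] := hC.1 _ Cpsi.
split=> /=.
- rewrite openE => -[a b] [/= da db]; exists (dom phi, dom psi) => //=.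
  by split; exact: open_nbhs_nbhs.
- rewrite (_ : _ @` _ = (lsubmx @^-1` (cmap phi @` dom phi))
  `&` (rsubmx @^-1` (cmap psi @` dom psi))).
    apply: openI; apply: open_comp => // u _.
      exact: continuous_lsubmx.
    exact: continuous_rsubmx.
  apply/seteqP; split=> [_ [[a b] /= [da db] <-]|u [[a da ua] [b db ub]]] /=.
    by rewrite row_mxKl row_mxKr; split; [exists a|exists b].
  by exists (a, b) => //=; rewrite ua ub hsubmxK.
- by move=> [a b] [/= da db]; rewrite row_mxKl row_mxKr K1 // K2.
- move=> [a b] [/= da db].
  apply: (@continuous_comp _ _ _ (fun p : Y * Z => (cmap phi p.1, cmap psi p.2))
    (fun p => row_mx p.1 p.2)); last exact: continuous_row_mx.
  apply: continuous_at_pair.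
    by apply: continuous_comp; [exact: cvg_fst|exact: c1].
  by apply: continuous_comp; [exact: cvg_snd|exact: c2].
- move=> [a b] [/= da db]; apply: continuous_at_pair.
    apply: continuous_comp; first exact: continuous_lsubmx.
    by rewrite row_mxKl; exact: ci1.
  apply: continuous_comp; first exact: continuous_rsubmx.
  by rewrite row_mxKr; exact: ci2.
Qed.

Lemma smooth_on_pair (U : set X) (f : X -> Y) (g : X -> Z) : open U ->
  smooth_on A B U f -> smooth_on A C U g ->
  smooth_on A (prod_atlas B C) U (fun x => (f x, g x)).
Proof.
move=> oU [cf sf] [cg sg].
have cfg x : U x -> {for x, continuous (fun x => (f x, g x))}.
  by move=> Ux; apply: cvg_pair; [exact: cf|exact: cg].
split=> // phi chi Aphi Pchi.
have oD := smooth_domain_open hA covering_prod_atlas oU cfg Aphi Pchi.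
have [psi1 [psi2 [Bpsi1 Cpsi2 chiE]]] := Pchi; subst chi => j.
apply/Ck_mxP => // i r; rewrite /coord_map /=.
have oD1 := smooth_domain_open hA hB oU cf Aphi Bpsi1.
have oD2 := smooth_domain_open hA hC oU cg Aphi Cpsi2.
case: (splitP r) => r' rE.
  rewrite (_ : (fun x => _) = (fun u => coord_map phi psi1 f u i r')); last first.
    by apply: funext => u; rewrite -(row_mxEl (coord_map phi psi1 f u)
      (cmap psi2 (g (cinv phi u)))); congr (row_mx _ _ _ _); exact: val_inj.
  have h := proj1 (Ck_mxP _ _ oD1) (sf _ _ Aphi Bpsi1 j); apply: Ck_sub (h i r').
  by move=> _ [x [[dx Ux] [d1 d2]] <-]; exists x.
rewrite (_ : (fun x => _) = (fun u => coord_map phi psi2 g u i r')); last first.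
  by apply: funext => u; rewrite -(row_mxEr (cmap psi1 (f (cinv phi u)))
    (coord_map phi psi2 g u)); congr (row_mx _ _ _ _); exact: val_inj.
have h := proj1 (Ck_mxP _ _ oD2) (sg _ _ Aphi Cpsi2 j); apply: Ck_sub (h i r').
by move=> _ [x [[dx Ux] [d1 d2]] <-]; exists x.
Qed.

End Products.
End Charts.

Lemma continuous_at_comp (S T U : topologicalType) (f : S -> T) (g : T -> U) x :
  {for x, continuous f} -> {for f x, continuous g} ->
  {for x, continuous (fun y => g (f y))}.
Proof. by move=> cf cg; exact: (@cvg_at _ _ _ (nbhs x) _ f g (f x) cg cf). Qed.

(** * Bilinear forms on row vectors and their norm estimates *)

Section QuadraticForms.
Variable R : realType.

Definition qform n (M : 'M[R]_n) (v w : 'rV[R]_n) : R := (v *m M *m w^T) 0 0.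

Lemma qformE n (M : 'M[R]_n) v w :
  qform M v w = \sum_j (\sum_i v 0 i * M i j) * w 0 j.
Proof. by rewrite /qform mxE; apply: eq_bigr => j _; rewrite !mxE. Qed.

Lemma qformZ n (M : 'M[R]_n) a v w : qform M (a *: v) w = a * qform M v w.
Proof. by rewrite /qform -!scalemxAl !mxE. Qed.

Lemma qformZr n (M : 'M[R]_n) a v w : qform M v (a *: w) = a * qform M v w.
Proof. by rewrite /qform linearZ /= -scalemxAr !mxE. Qed.

Lemma qformNN n (M : 'M[R]_n) v : qform M (- v) (- v) = qform M v v.
Proof. by rewrite -scaleN1r qformZ qformZr mulrA mulN1r opprK mul1r. Qed.

Lemma cvg_sum_fin (T : Type) (F : set_system T) (FF : Filter F) (I : Type) (r : seq I)
    (f : I -> T -> R) (l : I -> R) : (forall i, f i @ F --> l i) ->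
  (fun x => \sum_(i <- r) f i x) @ F --> \sum_(i <- r) l i.
Proof.
move=> h; elim: r => [|i r IH].
  rewrite big_nil (_ : (fun x => _) = cst 0); first exact: cvg_cst.
  by apply: funext => x; rewrite big_nil.
rewrite big_cons (_ : (fun x => _) = f i \+ (fun x => \sum_(i <- r) f i x)).
  exact: cvgD.
by apply: funext => x; rewrite big_cons.
Qed.

Lemma cvg_coord (T : Type) (F : set_system T) (FF : Filter F) m n
    (f : T -> 'M[R]_(m, n)) (l : 'M[R]_(m, n)) i j : f @ F --> l -> (fun x => f x i j)
      @ F --> l i j.
Proof. by move=> fl; apply: (@cvg_at _ _ _ _ _ f (fun M : 'M[R]_(m, n) => M i j) l) => //;
  exact: coord_continuous. Qed.

Lemma cvg_qform (T : Type) (F : set_system T) (FF : Filter F) n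
    (M : T -> 'M[R]_n) (v w : T -> 'rV[R]_n) (M0 : 'M[R]_n) (v0 w0 : 'rV[R]_n) :
  M @ F --> M0 -> v @ F --> v0 -> w @ F --> w0 ->
  (fun x => qform (M x) (v x) (w x)) @ F --> qform M0 v0 w0.
Proof.
move=> hM hv hw; rewrite qformE.
rewrite (_ : (fun x => _) = (fun x => \sum_j (\sum_i v x 0 i * M x i j) * w x 0 j)); last first.
  by apply: funext => x; rewrite qformE.
apply: cvg_sum_fin => j; apply: cvgM; last exact: cvg_coord.
by apply: cvg_sum_fin => i; apply: cvgM; exact: cvg_coord.
Qed.

Lemma le_mx_norm m n (v : 'M[R]_(m, n)) i j : `|v i j| <= `|v|.
Proof.
rewrite [leRHS]/Num.Def.normr /= mx_normrE.
exact: (le_bigmax _ (fun ij => `|v ij.1 ij.2|) (i, j)).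
Qed.

Lemma mx_norm_le m n (v : 'M[R]_(m, n)) e : 0 <= e ->
  (forall i j, `|v i j| <= e) -> `|v| <= e.
Proof.
move=> e0 h; rewrite [leLHS]/Num.Def.normr /= mx_normrE.
by apply: bigmax_le => // -[i j] _ /=.
Qed.

(** The norm of a matrix is its largest entry in absolute value, so [n * n] counts the terms of the
    double sum. *)
Lemma qform_le n (M : 'M[R]_n) v w : `|qform M v w| <= (n * n)%:R * `|M| * `|v| * `|w|.
Proof.
rewrite qformE.
have h j : `|(\sum_i v 0 i * M i j) * w 0 j| <= n%:R * `|M| * `|v| * `|w|.
  rewrite normrM; apply: ler_pM => //; last exact: le_mx_norm.
  apply: (le_trans (ler_norm_sum _ _ _)).
  apply: (@le_trans _ _ (\sum_(i < n) `|M| * `|v|)).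
    apply: ler_sum => i _; rewrite normrM mulrC.
    by apply: ler_pM => //; exact: le_mx_norm.
  by rewrite sumr_const card_ord -[leLHS]mulr_natl mulrA.
apply: (le_trans (ler_norm_sum _ _ _)).
apply: (le_trans (ler_sum _ (fun j _ => h j))).
by rewrite sumr_const card_ord -[leLHS]mulr_natl natrM !mulrA.
Qed.

End QuadraticForms.

(** * Arcs, speed and length *)

Section Arcs.
Variable R : realType.

(* Unlike for a Riemannian metric, degenerate tensors are allowed, so that
   pullbacks along submersions are included. *)
Definition semi_metric (X : topologicalType) n (A : set (chart R X n))
    (g : tensor R X n) : Prop :=
  [/\ (forall phi, A phi -> Cinfty (cmap phi @` dom phi) (g phi)),
      (forall phi x, A phi -> dom phi x ->
         forall v w, inner g phi x v w = inner g phi x w v),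
      (forall phi x, A phi -> dom phi x -> forall v, 0 <= inner g phi x v v) &
      preserves_metric A g A g id].

Lemma innerE (X : Type) n (g : tensor R X n) (phi : chart R X n) x v w :
  inner g phi x v w = qform (g phi (cmap phi x)) v w.
Proof. by []. Qed.

Lemma riemannian_semi_metric (X : topologicalType) n (A : set (chart R X n))
    (g : tensor R X n) : riemannian_metric A g -> semi_metric A g.
Proof.
move=> [h1 h2 h3 h4]; split=> // phi x Aphi dx v.
have [->|v0] := eqVneq v 0; last exact/ltW/h3.
by rewrite /inner !mul0mx mxE.
Qed.

Definition arc_on (X : topologicalType) n (A : set (chart R X n)) (D : set R)
    (c : R -> X) : Prop :=
  (forall t, D t -> {for t, continuous c}) /\
  (forall phi, A phi ->
     Cinfty (D `&` c @^-1` dom phi) (fun t : R => cmap phi (c t))).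

Definition ival (e : R) : set R := [set t : R | - e < t < 1 + e].

Lemma open_ival e : open (ival e).
Proof.
rewrite (_ : ival e = [set` `]- e, 1 + e[%R]); first exact: itv_open.
by apply/seteqP; split => t /=; rewrite in_itv.
Qed.

Definition velocity (X : Type) n (phi : chart R X n) (c : R -> X) (t : R) : 'rV[R]_n :=
  'D_1 (fun t : R => cmap phi (c t)) t.

Section OneManifold.
Variables (X : topologicalType) (n : nat) (A : set (chart R X n)).
Hypothesis hA : smooth_manifold A.
Let cA := smooth_manifold_covering hA.

Lemma arc_dom_open D c phi : open D -> arc_on A D c -> A phi ->
  open (D `&` c @^-1` dom phi).
Proof.
move=> oD [cc _] Aphi; rewrite openE => t [Dt ct]; apply: filterI.
  exact: open_nbhs_nbhs.
exact: cc (nbhs_dom (cA.1 _ Aphi) ct).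
Qed.

Lemma arc_differentiable D c phi t : arc_on A D c -> A phi -> D t -> dom phi (c t) ->
  differentiable (fun t : R => cmap phi (c t)) t.
Proof. by move=> [_ sc] Aphi Dt ct; have /CkSP[h _] := sc phi Aphi 1%N; apply: h. Qed.

Lemma velocity_continuous D c phi t : open D -> arc_on A D c -> A phi -> D t ->
  dom phi (c t) -> {for t, continuous (velocity phi c)}.
Proof.
move=> oD ac Aphi Dt ct.
have nD : nbhs t (D `&` c @^-1` dom phi).
  by apply: open_nbhs_nbhs; split => //; exact: arc_dom_open.
have /CkSP[df /(_ 1) dv] := ac.2 phi Aphi 1%N.
have h : (fun s : R => 'd (fun t : R => cmap phi (c t)) s (1 : R)) @ t --> velocity phi c t.
  rewrite /velocity deriveE; last exact: df.
  exact: dv.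
apply: cvg_trans h; apply: near_eq_cvg; apply: filterS nD => s Ds.
by rewrite /velocity deriveE //; exact: df.
Qed.

Lemma arc_cmap_continuous D c phi t : arc_on A D c -> A phi -> D t ->
  dom phi (c t) -> {for t, continuous (fun s => cmap phi (c s))}.
Proof.
by move=> ac Aphi Dt ct; apply: differentiable_continuous;
  exact: (arc_differentiable ac Aphi Dt ct).
Qed.

Variable g : tensor R X n.
Hypothesis hg : semi_metric A g.

Lemma smooth_arcP c : smooth_arc A c <-> exists2 e, 0 < e & arc_on A (ival e) c.
Proof. by []. Qed.

Lemma velocity_change D c phi psi t : open D -> arc_on A D c -> A phi -> A psi -> D t ->
  dom phi (c t) -> dom psi (c t) ->
  velocity psi c t = tangent phi psi id (c t) (velocity phi c t).
Proof.
move=> oD ac Aphi Apsi Dt pt qt.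
have df := arc_differentiable ac Aphi Dt pt.
have dg := arc_differentiable ac Apsi Dt qt.
have dh := smooth_on_differentiable (smooth_map_id hA) Aphi Apsi (I : setT (c t)) pt qt.
rewrite /velocity !deriveE //.
have near_t : \forall s \near t, (coord_map phi psi id \o (fun t : R => cmap phi (c t)))
  s = cmap psi (c s).
  have nD : nbhs t (D `&` c @^-1` dom phi).
    by apply: open_nbhs_nbhs; split => //; exact: arc_dom_open.
  apply: filterS nD => s [Ds ps] /=; rewrite /coord_map /=.
  by have [_ _ K _ _] := cA.1 _ Aphi; rewrite K.
have E := near_diffE (1 : R) near_t (differentiable_comp df dh).
exact: etrans E (diff_compE (1 : R) df dh).
Qed.

(** By the transformation law of the tensor all charts give the same value, so [get] picks from a
    singleton and not a default. *)
Lemma speedE D c phi t : open D -> arc_on A D c -> A phi -> D t -> dom phi (c t) ->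
  speed A g c t =
    Num.sqrt (inner g phi (c t) (velocity phi c t) (velocity phi c t)).
Proof.
move=> oD ac Aphi Dt ct; rewrite /speed; apply: get_unique.
  by exists phi.
move=> _ [psi [Apsi dt ->]]; rewrite -/(velocity psi c t).
rewrite (velocity_change oD ac Aphi Apsi Dt ct dt).
by have [_ _ _ h] := hg; have := h _ _ (c t) Aphi Apsi ct dt => /= ->.
Qed.

Lemma tensor_continuous phi x : A phi -> dom phi x ->
  {for cmap phi x, continuous (g phi)}.
Proof. by move=> Aphi dx; have [h _ _ _] := hg; apply: (h phi Aphi 0%N); exists x. Qed.

Lemma speed_continuous D c t : open D -> arc_on A D c -> D t ->
  {for t, continuous (speed A g c)}.
Proof.
move=> oD ac Dt; have [phi Aphi ct] := cA.2 (c t).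
have nD : nbhs t (D `&` c @^-1` dom phi).
  by apply: open_nbhs_nbhs; split => //; exact: arc_dom_open.
have h : (fun s : R => Num.sqrt (qform (g phi (cmap phi (c s))) (velocity phi c s)
  (velocity phi c s))) @ t
    --> speed A g c t.
  rewrite (speedE oD ac Aphi Dt ct).
  apply: (@cvg_at _ _ _ _ _ _ (Num.sqrt : R -> R)); first exact: sqrt_continuous.
  have cv := velocity_continuous oD ac Aphi Dt ct.
  apply: cvg_qform => //.
  apply: (@cvg_at _ _ _ _ _ _ (g phi)); first exact: tensor_continuous.
  exact: arc_cmap_continuous ac Aphi Dt ct.
apply: cvg_trans h; apply: near_eq_cvg; apply: filterS nD => s [Ds cs].
by rewrite (speedE oD ac Aphi Ds cs).
Qed.

Lemma speed_ge0 D c t : open D -> arc_on A D c -> D t -> 0 <= speed A g c t.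
Proof.
move=> oD ac Dt; have [phi Aphi ct] := cA.2 (c t).
by rewrite (speedE oD ac Aphi Dt ct) sqrtr_ge0.
Qed.

Lemma speed_within D c a b : open D -> arc_on A D c ->
  (forall t, a <= t <= b -> D t) -> {within `[a, b], continuous (speed A g c)}.
Proof.
move=> oD ac h; apply: continuous_in_subspaceT => t.
by rewrite inE /= in_itv /= => tab; by apply: (speed_continuous oD ac); exact: h.
Qed.

Lemma speed_integrable D c a b : open D -> arc_on A D c ->
  (forall t, a <= t <= b -> D t) ->
  (@lebesgue_measure R).-integrable `[a, b] (EFin \o speed A g c).
Proof.
move=> oD ac h; apply: continuous_compact_integrable; first exact: segment_compact.
exact: speed_within h.
Qed.

Lemma ival01 e t : 0 < e -> 0 <= t <= 1 -> ival e t.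
Proof. by move=> e0 /andP[t0 t1]; rewrite /ival /=; apply/andP; split; lra. Qed.

Lemma arc_length_ge0 c : smooth_arc A c -> 0 <= arc_length A g c.
Proof.
move=> /smooth_arcP[e e0 ac]; apply: Rintegral_ge0 => t; rewrite /= in_itv /= => t01.
have := speed_ge0 (@open_ival e) ac (ival01 e0 t01).
exact.
Qed.

Lemma arc_length_le c C : smooth_arc A c ->
  (forall t, 0 <= t <= 1 -> speed A g c t <= C) -> arc_length A g c <= C.
Proof.
move=> /smooth_arcP[e e0 ac] h.
have -> : C = \int[lebesgue_measure]_(t in `[0, 1]%classic) (cst C t).
  rewrite Rintegral_cst //= lebesgue_measure_itv /= lte_fin ltr01 oppr0 adde0.
  by rewrite mulr1.
apply: le_Rintegral => //.
- have := @speed_integrable _ c 0 1 (@open_ival e) ac (fun t => ival01 e0).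
  exact.
- apply: continuous_compact_integrable; first exact: segment_compact.
  by apply: continuous_subspaceT; exact: cst_continuous.
Qed.

(** The velocity changes sign and a quadratic form is even, so the substitution of 1 - t for t
    preserves the integral. This is the source of the symmetry of the distance. *)
Lemma arc_reverse c : smooth_arc A c -> smooth_arc A (fun t => c (1 - t)) /\
  arc_length A g (fun t => c (1 - t)) = arc_length A g c.
Proof.
move=> /smooth_arcP[e e0 ac].
have rv t : ival e t -> ival e (1 - t).
  by rewrite /ival /= => /andP[? ?]; apply/andP; split; lra.
have cr : continuous (fun t : R => 1 - t).
  by move=> t; apply: continuousB; [exact: cst_continuous|exact: id].
have Cr k D : open D -> Ck k D (fun t : R => 1 - t).
  move=> oD.
  have co : continuous (GRing.opp : R -> R) by move=> x; exact: opp_continuous.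
  have := Ck_add oD (Ck_cst k D (1 : R)) (@Ck_linear R R R k D (GRing.opp : {linear R -> R}) co).
  exact.
have ar : arc_on A (ival e) (fun t => c (1 - t)).
  split=> [t /rv Dt|phi Aphi k].
    apply: (@continuous_at_comp _ _ _ (fun t : R => 1 - t) c); [exact: cr|exact: ac.1].
  have oD := arc_dom_open (@open_ival e) ac Aphi.
  have oD' : open (ival e `&` (fun t => c (1 - t)) @^-1` dom phi).
    rewrite (_ : _ `&` _ = (fun t => 1 - t) @^-1` (ival e `&` c @^-1` dom phi)).
      by apply: open_comp => // t _; exact: cr.
    apply/seteqP; split => t /= [h1 h2]; split=> //; first exact: rv.
    by rewrite (_ : t = 1 - (1 - t)); [exact: rv|lra].
  have h := proj1 (Ck_mxP _ _ oD) (ac.2 phi Aphi k).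
  apply/Ck_mxP => // i j.
  have hD (t : R) : (ival e `&` (fun t => c (1 - t)) @^-1` dom phi) t ->
      (ival e `&` c @^-1` dom phi) (1 - t) by move=> [/rv ? ?].
  exact: (@Ck_comp_scalar R R k _ _ (fun t : R => 1 - t)
    (fun t : R => cmap phi (c t) i j) oD' hD (Cr _ _ oD') (h i j)).
split; first by exists e.
have le01 : 0 <= (1 : R) <= 1 by rewrite ler01 lexx.
have S := @Rintegration_by_substitution_onem R (speed A g c) 1 le01
  (speed_within (@open_ival e) ac (fun t => @ival01 e t e0)).
rewrite /arc_length; apply/esym; apply: etrans S _.
rewrite (_ : unstable.onem 1 = 0 :> R); last by rewrite /unstable.onem subrr.
apply: eq_Rintegral => t; rewrite inE /= in_itv /= => t01.
have Dt := ival01 e0 t01; have [phi Aphi ct] := cA.2 (c (1 - t)).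
apply: etrans (speedE (@open_ival e) ac Aphi (rv _ Dt) ct) _.
rewrite (speedE (@open_ival e) ar Aphi Dt ct).
have -> : velocity phi (fun t => c (1 - t)) t = - velocity phi c (1 - t).
  have df := arc_differentiable ac Aphi (rv _ Dt) ct.
  have dr : is_diff t (fun t : R => 1 - t) (- (id : R -> R)).
    have -> : (fun t : R => 1 - t) = cst 1 - id by [].
    by apply: is_diff_eq; rewrite sub0r.
  have dc := is_diff_comp dr (differentiableP df).
  have := is_derive_is_diff (1 : R) dc => -[_ E].
  rewrite /velocity [LHS]E /= deriveE //.
  by rewrite [(- id) 1]/(- 1) linearN.
by rewrite !innerE qformNN.
Qed.

End OneManifold.
End Arcs.

(** * The Riemannian distance *)

Section LocalToGlobal.
Variable R : realType.

(** Real induction on the set [E] of times at which the bound from 0 holds. The left half of the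
    local estimate at T = sup E puts T into [E]; if T < 1, the right half gives a later element. *)
Lemma local_slope_global (psi : R -> R) (e : R) :
  (forall t : R, 0 <= t <= 1 -> exists2 d : R, 0 < d & forall s : R, 0 <= s <= 1 ->
     `|s - t| < d -> (t <= s -> psi s - psi t <= e * (s - t)) /\
                     (s <= t -> psi t - psi s <= e * (t - s))) ->
  psi 1 - psi 0 <= e.
Proof.
move=> h.
pose E := [set t : R | 0 <= t <= 1 /\ psi t - psi 0 <= e * t].
have E0 : E 0 by rewrite /E /= lexx ler01 subrr mulr0 lexx.
have hE : has_sup E by split; [exists 0|exists 1 => t [/andP[]]].
set T := sup E.
have T0 : 0 <= T by apply: ub_le_sup => //; exact: hE.2.
have T1 : T <= 1 by apply: ge_sup; [exists 0|move=> t [/andP[]]].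
have T01 : 0 <= T <= 1 by rewrite T0.
have [d d0 hd] := h T T01.
have [t [t01 Et] tT] := sup_adherent d0 hE.
have tleT : t <= T by apply: ub_le_sup; [exact: hE.2|].
have ET : psi T - psi 0 <= e * T.
  have dt : `|t - T| < d by rewrite ler0_norm; [rewrite -/T in tT; lra|lra].
  have [_ /(_ tleT) h1] := hd t t01 dt.
  by lra.
have [T1'|T1'] := ltP T 1; last first.
  have -> : (1 : R) = T by apply/eqP; rewrite eq_le T1 T1'.
  by apply: le_trans ET _; rewrite (_ : T = 1) ?mulr1//; apply/eqP; rewrite eq_le T1 T1'.
pose s := Num.min 1 (T + d / 2).
have Ts : T < s by rewrite /s lt_min T1' /=; lra.
have s1 : s <= 1 by rewrite /s ge_min lexx.
have sd : s <= T + d / 2 by rewrite /s ge_min lexx orbT.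
have s01 : 0 <= s <= 1 by rewrite s1 andbT; lra.
have ds : `|s - T| < d by rewrite ger0_norm; lra.
have [/(_ (ltW Ts)) h2 _] := hd s s01 ds.
have Es : E s by split => //; lra.
have : s <= T by apply: ub_le_sup; [exact: hE.2|].
by rewrite leNgt Ts.
Qed.

(** Here [th] will be a distance along an arc, which has no derivative in general. Subtracting the
    primitive [I] of [sg] leaves a function whose local slopes are at most [d] for any [d] > 0, so
    [local_slope_global] applies. *)
Lemma local_growth_integral (th sg : R -> R) (e : R) : 0 < e ->
  (forall t : R, - e < t < 1 + e -> {for t, continuous sg}) ->
  (forall t : R, 0 <= t <= 1 -> forall e' : R, 0 < e' -> exists2 d : R, 0 < d &
     forall s : R, 0 <= s <= 1 -> `|s - t| < d ->
       `|th s - th t| <= (sg t + e') * `|s - t|) ->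
  th 1 - th 0 <= \int[lebesgue_measure]_(t in `[0, 1]%classic) sg t.
Proof.
move=> e0 csg h.
(* The primitive starts before 0 and the integrand is controlled beyond 1, so that [I] is
   differentiable at both ends of [0, 1] as well. *)
pose a := - (e / 2); pose b := 1 + e / 2.
have int : (@lebesgue_measure R).-integrable `[a, b] (EFin \o sg).
  apply: continuous_compact_integrable; first exact: segment_compact.
  apply: continuous_in_subspaceT => t; rewrite inE /= in_itv /= => /andP[ta tb].
  by apply: csg; rewrite /a /b in ta tb; apply/andP; split; lra.
pose I x := \int[lebesgue_measure]_(t in `[a, x]) sg t.
have dI (t : R) : 0 <= t <= 1 -> is_derive t 1 I (sg t).
  move=> /andP[t0 t1].
  have tb : t < b by rewrite /b; lra.
  have at_ : a < t by rewrite /a; lra.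
  have ct : {for t, continuous sg} by apply: csg; apply/andP; split; lra.
  have [d1 d2] := continuous_FTC1_closed tb int at_ ct.
  exact: (DeriveDef d1 (etrans (esym (derive1E _ _)) d2)).
have -> : \int[lebesgue_measure]_(t in `[0, 1]%classic) sg t = I 1 - I 0.
  rewrite /I (@Rintegral_itvB R sg (BLeft a) (BRight 1) 0).
  - by rewrite Rintegral_itv_obnd_cbnd //; apply: integrableS int => // t /=;
    rewrite !in_itv /= /a /b => /andP[? ?]; apply/andP; split; lra.
  - by apply: integrableS int => // t /=; rewrite !in_itv /= /a /b => /andP[? ?]; apply/andP;
    split; lra.
  - by rewrite bnd_simp /a; lra.
  - by rewrite bnd_simp.
apply/ler_addgt0Pr => d d0.
pose psi t := th t - I t.
suff : psi 1 - psi 0 <= d by rewrite /psi; lra.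
apply: local_slope_global => t t01.
have d20 : 0 < d / 2 by lra.
have [d1 d10 h1] := h t t01 _ d20.
have [_ E] := is_diff_is_derive (dI t t01).
have df : differentiable I t by have [] := is_diff_is_derive (dI t t01).
have /nbhs_ballP[d2 /= d20' h2] := differentiable_eps df d20.
exists (Num.min d1 d2); first by rewrite lt_min d10.
move=> s s01; rewrite lt_min => /andP[sd1 sd2].
have hs1 := h1 s s01 sd1.
have hs2 : `|I s - I t - sg t * (s - t)| <= d / 2 * `|s - t|.
  have := h2 s; rewrite -ball_normE /= distrC => /(_ sd2).
  by rewrite E /scale_lin /= [(s - t) *: _]mulrC.
have := ler_norm (th s - th t); have := ler_norm (th t - th s).
rewrite distrC => n1 n2.
move: hs2; rewrite ler_norml => /andP[hs2 hs3].
by split=> st; move: hs1 hs2 hs3; rewrite /psi; [rewrite (@ger0_norm _ (s - t));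
  lra|rewrite (@ler0_norm _ (s - t)); lra].
Qed.

End LocalToGlobal.

Section Segments.

(** * Straight segments in a chart *)

Variable R : realType.
Variables (X : topologicalType) (n : nat) (A : set (chart R X n)).
Hypothesis hA : smooth_manifold A.
Let cA := smooth_manifold_covering hA.
Variables (phi : chart R X n) (u0 : 'rV[R]_n) (r : R).
Hypotheses (Aphi : A phi) (ball_im : ball u0 r `<=` cmap phi @` dom phi).

Definition segment (u u' : 'rV[R]_n) (t : R) : X := cinv phi (u + t *: (u' - u)).

Lemma ball_segment u u' (t : R) : ball u0 r u -> ball u0 r u' -> 0 <= t <= 1 ->
  ball u0 r (u + t *: (u' - u)).
Proof.
rewrite -!ball_normE /= => hu hu' /andP[t0 t1].
have -> : u0 - (u + t *: (u' - u)) = (1 - t) *: (u0 - u) + t *: (u0 - u').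
  by rewrite scalerBl scale1r !scalerBr addrAC opprD addrA opprB; apply/matrixP => i j;
    rewrite !mxE; ring.
apply: (le_lt_trans (ler_normD _ _)); rewrite !normrZ !ger0_norm //; last lra.
set a := `|u0 - u| in hu *; set b := `|u0 - u'| in hu' *.
have [ab|/ltW ab] := leP a b.
  have : 0 <= (1 - t) * (b - a) by apply: mulr_ge0; lra.
  by lra.
have : 0 <= t * (a - b) by apply: mulr_ge0; lra.
by lra.
Qed.

(** A smooth arc must be smooth on an open interval around [0, 1], so the segment is prolonged
    beyond both ends while it stays in the ball. *)
Lemma ball_segment_nbhs u u' : ball u0 r u -> ball u0 r u' ->
  exists2 e : R, 0 < e & forall t, ival e t -> ball u0 r (u + t *: (u' - u)).
Proof.
rewrite -!ball_normE /= => hu hu'.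
set a := `|u0 - u| in hu *; set b := `|u0 - u'| in hu' *.
have a0 : 0 <= a := normr_ge0 _; have b0 : 0 <= b := normr_ge0 _.
pose m := Num.max a b.
have am : a <= m by rewrite /m le_max lexx.
have bm : b <= m by rewrite /m le_max lexx orbT.
have mr : m < r by rewrite /m gt_max hu.
have r0 : 0 < r by lra.
(* For t in [ival e] one has |1 - t| + |t| <= 1 + 2e, and 2er = r - m gives (1 + 2e) m = m + (r - m)
   m / r < r. *)
exists ((r - m) / (2 * r)); first by rewrite divr_gt0 //; lra.
set e := _ / _ => t /=; rewrite /ival /= => /andP[t0 t1].
have -> : u0 - (u + t *: (u' - u)) = (1 - t) *: (u0 - u) + t *: (u0 - u').
  by apply/matrixP => i j; rewrite !mxE; ring.
apply: (le_lt_trans (ler_normD _ _)); rewrite !normrZ -/a -/b.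
have h1 : `|1 - t| + `|t| <= 1 + 2 * e.
  have e0 : 0 < e by rewrite divr_gt0 //; lra.
  have [?|?] := lerP 0 t; have [?|?] := lerP t 1.
  - by rewrite ger0_norm; lra.
  - by rewrite ger0_norm; lra.
  - by rewrite ltr0_norm; lra.
  - by lra.
have h2 : (1 + 2 * e) * m < r.
  have er : 2 * e * r = r - m by rewrite /e; field; lra.
  have [-> |m0] := eqVneq m 0; first by rewrite mulr0.
  have m0' : 0 <= m by lra.
  have : 2 * e * m <= 2 * e * r by rewrite ler_wpM2l //; [rewrite mulr_ge0 // divr_ge0; lra|lra].
  have : 2 * e * m < 2 * e * r by rewrite ltr_pM2l //; rewrite mulr_gt0 // divr_gt0; lra.
  by lra.
apply: le_lt_trans h2.
apply: (@le_trans _ _ ((`|1 - t| + `|t|) * m)); last by rewrite ler_wpM2r //; lra.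
by rewrite mulrDl lerD // ler_wpM2l.
Qed.

Lemma image_cmapK u : (cmap phi @` dom phi) u -> dom phi (cinv phi u) /\ cmap phi (cinv phi u) = u.
Proof. by have [_ _ K _ _] := cA.1 _ Aphi; move=> [x dx <-]; rewrite K. Qed.

Lemma segment_arc u u' : ball u0 r u -> ball u0 r u' ->
  exists2 e : R, 0 < e & arc_on A (ival e) (segment u u').
Proof.
move=> hu hu'; have [e e0 he] := ball_segment_nbhs hu hu'.
exists e => //.
pose l (t : R) : 'rV[R]_n := u + t *: (u' - u).
have Cl k D : open D -> Ck k D l.
  move=> oD; apply: (Ck_add oD (Ck_cst k D u)).
  by apply: (Ck_linear k D (L := scale_lin (u' - u))); exact: scalel_continuous.
have cc (t : R) : ival e t -> {for t, continuous (segment u u')}.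
  move=> /he/ball_im iu.
  apply: (@continuous_at_comp _ _ _ l (cinv phi)).
    exact: (Cl 0%N setT openT).
  have [_ _ _ _ ci] := cA.1 _ Aphi; case: iu => x dx; rewrite /l => <-; exact: ci.
split=> // psi Apsi k.
have oD : open (ival e `&` segment u u' @^-1` dom psi).
  rewrite openE => t [Dt ct]; apply: filterI; first by apply: open_nbhs_nbhs; split=> //;
    exact: open_ival.
  exact: cc (nbhs_dom (cA.1 _ Apsi) ct).
apply: (@Ck_comp R _ _ _ _ _ _ (cmap phi @` (dom phi `&` setT `&` id @^-1` dom psi))
  l (coord_map phi psi id)) => //.
- move=> t [/he/ball_im/image_cmapK[d1 d2] d3].
  by exists (cinv phi (l t)).
- exact: Cl.
- have oE := smooth_domain_open cA cA openT (smooth_map_id hA).1 Aphi Apsi.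
  exact: (proj1 (Ck_mxP _ _ oE) ((smooth_map_id hA).2 _ _ Aphi Apsi k)).
Qed.

Lemma segment_velocity u u' (t : R) : ball u0 r u -> ball u0 r u' -> 0 <= t <= 1 ->
  [/\ dom phi (segment u u' t), cmap phi (segment u u' t) = u + t *: (u' - u) &
      velocity phi (segment u u') t = u' - u].
Proof.
move=> hu hu' t01; have [e e0 he] := ball_segment_nbhs hu hu'.
have Dt : ival e t by exact: ival01.
have [d1 d2] := image_cmapK (ball_im (he t Dt)).
split=> //; rewrite /velocity.
have h : is_derive t 1 (fun t : R => u + t *: (u' - u)) (u' - u).
  have d := is_derive_is_diff (1 : R) (is_diff_scalel t (u' - u)).
  have := is_deriveD (is_derive_cst u t 1) d.
  by rewrite add0r scale1r.
have nt : \forall s \near t, (fun s : R => u + s *: (u' - u)) s = cmap phi (segment u u' s).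
  have nD : nbhs t (ival e) by apply: open_nbhs_nbhs; split=> //; exact: open_ival.
  by apply: filterS nD => s /he/ball_im/image_cmapK[].
by have [_ ->] := near_eq_is_derive nt h.
Qed.

Variable g : tensor R X n.
Hypothesis hg : semi_metric A g.

Lemma segment_length_le u u' C : ball u0 r u -> ball u0 r u' ->
  (forall t : R, 0 <= t <= 1 ->
     Num.sqrt (qform (g phi (u + t *: (u' - u))) (u' - u) (u' - u)) <= C) ->
  arc_length A g (segment u u') <= C.
Proof.
move=> hu hu' h; have [e e0 ac] := segment_arc hu hu'.
apply: (arc_length_le hA hg); first by exists e.
move=> t t01; have [d1 d2 d3] := segment_velocity hu hu' t01.
rewrite (speedE hA hg (@open_ival _ e) ac Aphi (ival01 e0 t01) d1) d3 innerE d2.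
exact: h.
Qed.

End Segments.

(** * The length pseudo-distance of a semi-metric *)

Section Paths.
Variable R : realType.
Variables (X : topologicalType) (n : nat) (A : set (chart R X n)).
Hypothesis hA : smooth_manifold A.
Let cA := smooth_manifold_covering hA.

(** The infimum of the empty set is 0, so points joined by no path would be at distance 0. The
    triangle inequality and the lower bounds on distances rest on this condition. *)
Definition path_connected_atlas : Prop :=
  forall x y, exists s, piecewise_smooth_path A x s y.

Lemma path_cat x y z s s' : piecewise_smooth_path A x s y ->
  piecewise_smooth_path A y s' z -> piecewise_smooth_path A x (s ++ s') z.
Proof.
elim: s x => [|c s IH] x /=; first by move=> ->.
by move=> [ac cx pth] pth'; split=> //; exact: IH.
Qed.

Lemma smooth_arc_cst x : smooth_arc A (fun=> x).
Proof.
exists 1 => //; split=> [t _|phi Aphi]; first exact: cst_continuous.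
by move=> j; exact: Ck_cst.
Qed.

Variable g : tensor R X n.
Hypothesis hg : semi_metric A g.
Local Notation dist := (riemannian_distance A g).
Local Notation len s := (\sum_(c <- s) arc_length A g c).

Lemma path_length_ge0 x s y : piecewise_smooth_path A x s y -> 0 <= len s.
Proof.
elim: s x => [|c s IH] x /=; first by rewrite big_nil.
move=> [ac _ /IH h]; rewrite big_cons addr_ge0 //.
exact: (arc_length_ge0 hA hg ac).
Qed.

Lemma path_rev x s y : piecewise_smooth_path A x s y ->
  exists2 s', piecewise_smooth_path A y s' x & len s' = len s.
Proof.
elim: s x => [|c s IH] x /=; first by move=> ->; exists [::].
move=> [ac cx /IH[s' ps' ls']].
have [ac' lc'] := arc_reverse hA hg ac.
exists (s' ++ [:: fun t => c (1 - t)]).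
  by apply: path_cat ps' _ => /=; split; rewrite ?subr0 ?subrr.
by rewrite big_cat /= big_seq1 lc' ls' big_cons addrC.
Qed.

Let lengths x y := [set l : R | exists2 s, piecewise_smooth_path A x s y & l = len s].

Lemma lengths_lbound x y : has_lbound (lengths x y).
Proof. by exists 0 => _ [s ps ->]; exact: path_length_ge0 ps. Qed.

Lemma dist_le_path x s y : piecewise_smooth_path A x s y -> dist x y <= len s.
Proof. by move=> ps; apply: ge_inf; [exact: lengths_lbound|exists s]. Qed.

Lemma dist_ge0 x y : 0 <= dist x y.
Proof.
rewrite /riemannian_distance -/(lengths x y).
have [->|/set0P[l hl]] := eqVneq (lengths x y) set0; first by rewrite inf0.
by apply: lb_le_inf; [exists l|move=> _ [s ps ->]; exact: path_length_ge0 ps].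
Qed.

Lemma distxx x : dist x x = 0.
Proof.
apply/eqP; rewrite eq_le dist_ge0 andbT.
by have := @dist_le_path x [::] x (erefl _); rewrite big_nil.
Qed.

Lemma dist_sym x y : dist x y = dist y x.
Proof.
rewrite /riemannian_distance; congr inf; apply/seteqP; split=> l [s ps ->].
  by have [s' ps' ls'] := path_rev ps; exists s'.
by have [s' ps' ls'] := path_rev ps; exists s'.
Qed.

Hypothesis conn : path_connected_atlas.

Lemma dist_path x y e : 0 < e ->
  exists2 s, piecewise_smooth_path A x s y & len s < dist x y + e.
Proof.
move=> e0; have hi : has_inf (lengths x y).
  by split; [have [s ps] := conn x y; exists (len s), s|exact: lengths_lbound].
by have [l [s ps ->] h] := inf_adherent e0 hi; exists s.
Qed.

Lemma dist_triangle x y z : dist x z <= dist x y + dist y z.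
Proof.
apply/ler_addgt0Pr => e e0.
have e20 : 0 < e / 2 by lra.
have [s ps ls] := dist_path x y e20.
have [s' ps' ls'] := dist_path y z e20.
by have := dist_le_path (path_cat ps ps'); rewrite big_cat /=; lra.
Qed.

(** The function s -> rho (c 0) (c s) grows no faster than the speed, by the reverse triangle
    inequality. [local_growth_integral] turns this into a bound by the length of each arc, and the
    triangle inequality adds up the arcs. Both lower bounds on distances come from here: positivity
    in [dist_gt0] and the comparison in [dist_pullback_le]. *)
Lemma le_dist_of_local (rho : X -> X -> R) :
  (forall x, rho x x = 0) -> (forall x y, rho x y = rho y x) ->
  (forall y x z, rho x z <= rho x y + rho y z) ->
  (forall D c t, open D -> arc_on A D c -> D t -> forall e : R, 0 < e ->
    \forall s \near t, rho (c t) (c s) <= (speed A g c t + e) * `|s - t|) ->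
  forall x y, rho x y <= dist x y.
Proof.
move=> r0 rS rT hloc x y.
have harc c : smooth_arc A c -> rho (c 0) (c 1) <= arc_length A g c.
  move=> /smooth_arcP[e e0 ac].
  have h := @local_growth_integral R (fun t => rho (c 0) (c t)) (speed A g c) e e0.
  suff : rho (c 0) (c 1) - rho (c 0) (c 0) <= arc_length A g c by rewrite r0 subr0.
  apply: h => [t Dt|t t01 e' e'0].
    exact: (speed_continuous hA hg (@open_ival _ e) ac).
  have Dt := ival01 e0 t01.
  have /nbhs_ballP[d /= d0 hd] := hloc _ c t (@open_ival _ e) ac Dt e' e'0.
  exists d => // s s01 sd.
  have {}hd : rho (c t) (c s) <= (speed A g c t + e') * `|s - t|.
    by apply: hd; rewrite -ball_normE /= distrC.
  apply: le_trans hd; rewrite ler_norml; apply/andP; split.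
    by have := rT (c s) (c 0) (c t); rewrite (rS (c s)); lra.
  by have := rT (c t) (c 0) (c s); lra.
apply: lb_le_inf; first by have [s ps] := conn x y; exists (len s), s.
move=> _ [s ps ->]; elim: s x ps => [|c s IH] x /=.
  by move=> ->; rewrite big_nil r0.
move=> [ac <- /IH h]; rewrite big_cons.
by apply: le_trans (rT (c 1) _ _) _; rewrite lerD // harc.
Qed.

Lemma chart_ball phi x (P : set 'rV[R]_n) : A phi -> dom phi x -> nbhs (cmap phi x) P ->
  exists r : R, [/\ 0 < r, ball (cmap phi x) r `<=` cmap phi @` dom phi &
    ball (cmap phi x) r `<=` P].
Proof.
move=> Aphi dx nP; have [_ oi _ _ _] := cA.1 _ Aphi.
have nI : nbhs (cmap phi x) (cmap phi @` dom phi).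
  by apply: open_nbhs_nbhs; split=> //; exists x.
have : nbhs (cmap phi x) ((cmap phi @` dom phi) `&` P) by exact: filterI.
move=> /nbhs_ballP[r /= r0 hr].
by exists r; split=> // u /hr[].
Qed.

(** Near the point the components of the tensor are bounded by [m], so straight segments of the
    chart are paths of length at most sqrt (n * n * m) times the coordinate distance. *)
Lemma dist_locally_lipschitz phi x : A phi -> dom phi x ->
  exists C r : R, [/\ 0 <= C, 0 < r, ball (cmap phi x) r `<=` cmap phi @` dom phi &
    forall u u', ball (cmap phi x) r u -> ball (cmap phi x) r u' ->
      dist (cinv phi u) (cinv phi u') <= C * `|u' - u|].
Proof.
move=> Aphi dx.
have cg := tensor_continuous hg Aphi dx.
pose m := `|g phi (cmap phi x)| + 1.
have nP : nbhs (cmap phi x) [set u | `|g phi u| <= m].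
  have : nbhs (g phi (cmap phi x)) [set M | `|M| <= m].
    apply/nbhs_ballP; exists 1 => //= M; rewrite -ball_normE /= => h.
    have := ler_normD (M - g phi (cmap phi x)) (g phi (cmap phi x)).
    rewrite subrK distrC => h2.
    by apply: le_trans h2 _; rewrite addrC lerD2l ltW.
  exact: cg.
have [r [r0 rim rP]] := chart_ball Aphi dx nP.
pose K := (n * n)%:R * m.
have K0 : 0 <= K by rewrite mulr_ge0 // addr_ge0.
exists (Num.sqrt K), r; split=> //.
move=> u u' hu hu'.
have [e e0 ac] := segment_arc hA Aphi rim hu hu'.
have := @dist_le_path (cinv phi u) [:: segment phi u u'] (cinv phi u').
rewrite big_seq1 => h; apply: (le_trans (h _)).
  by split; [exists e|rewrite /segment scale0r addr0|rewrite /= /segment scale1r addrC subrK].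
apply: (segment_length_le hA Aphi rim hg hu hu') => t t01.
have /rP := ball_segment hu hu' t01; rewrite /= => hm.
rewrite -(ger0_norm (normr_ge0 (u' - u))) -sqrtr_sqr -sqrtrM //.
apply: ler_wsqrtr; apply: (le_trans (ler_norm _)); apply: (le_trans (qform_le _ _ _)).
by rewrite expr2 mulrA ler_wpM2r // ler_wpM2r // ler_wpM2l.
Qed.

(** The manifold topology is finer than that of the distance: compactness passes to the metric
    space, and compactness of X yields finite nets for the distance. *)
Lemma dist_near x (e : R) : 0 < e -> \forall y \near x, dist x y < e.
Proof.
move=> e0; have [phi Aphi dx] := cA.2 x.
have [C [r [C0 r0 rim h]]] := dist_locally_lipschitz Aphi dx.
have [_ _ K cc _] := cA.1 _ Aphi.
pose d := Num.min r (e / (C + 1)).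
have d0 : 0 < d by rewrite lt_min r0 divr_gt0 //; lra.
have nd : nbhs x [set y | ball (cmap phi x) d (cmap phi y)] :=
  cc x dx _ (nbhsx_ballx (cmap phi x) d d0).
apply: filterS2 nd (nbhs_dom (cA.1 _ Aphi) dx) => y yd dy.
have yr : ball (cmap phi x) r (cmap phi y).
  by apply: le_ball yd; rewrite ge_min lexx.
have := h _ _ (ballxx _ r0) yr; rewrite !K // => /le_lt_trans; apply.
move: yd; rewrite -ball_normE /= distrC lt_min => /andP[_].
rewrite ltr_pdivlMr; last by lra.
apply: le_lt_trans; rewrite mulrC ler_wpM2l //; lra.
Qed.

End Paths.

Definition is_distance (R : realType) (T : Type) (d : T -> T -> R) : Prop :=
  [/\ (forall x, d x x = 0), (forall x y, d x y = 0 -> x = y),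
      (forall x y, d x y = d y x) & (forall y x z, d x z <= d x y + d y z)].

Section MetricSpaceOf.
Variables (R : realType) (T : choiceType) (d : T -> T -> R).

(** The proof is a phantom argument: it tells apart the copies of one carrier, so that each metric
    tensor gives the same set its own canonical metric structure. *)
Definition metric_space_of (dP : is_distance d) : Type := T.

Variable dP : is_distance d.
Local Notation S := (metric_space_of dP).
HB.instance Definition _ := Choice.copy S T.
Let dxx : forall x : S, d x x = 0. Proof. by case: dP. Qed.
Let d_eq0 : forall x y : S, d x y = 0 -> x = y. Proof. by case: dP. Qed.
Let d_sym : forall x y : S, d x y = d y x. Proof. by case: dP. Qed.
Let d_triangle : forall y x z : S, d x z <= d x y + d y z. Proof. by case: dP. Qed.
HB.instance Definition _ := isMetric.Build R S dxx d_eq0 d_sym d_triangle.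

End MetricSpaceOf.

(** The image of the compact ball is compact, hence closed in a Hausdorff space. A function that is
    constant outside it is then constant near every exterior point, which is how functions given in
    one chart extend to X. *)
Lemma chart_closed_ball (R : realType) (X : topologicalType) n (A : set (chart R X n))
    (phi : chart R X n) (u0 : 'rV[R]_n) (r r0 : R) :
  smooth_manifold A -> A phi -> ball u0 r0 `<=` cmap phi @` dom phi -> r < r0 ->
  closed (cinv phi @` [set u | `|u - u0| <= r]).
Proof.
move=> hA Aphi rim rr0.
have [_ _ _ _ ci] := (smooth_manifold_covering hA).1 _ Aphi.
apply: compact_closed; first by have [] := hA.
apply: continuous_compact.
  apply: continuous_in_subspaceT => u; rewrite inE /= => ur.
  have : ball u0 r0 u by rewrite -ball_normE /= distrC; exact: le_lt_trans rr0.
  by move=> /rim[z dz <-]; exact: ci.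
apply: bounded_closed_compact.
  exists (`|u0| + r); split => // [|M hM u /= hu]; first by rewrite num_real.
  apply: ltW; apply: le_lt_trans hM.
  have := ler_normD (u - u0) u0; rewrite subrK; lra.
have -> : [set u | `|u - u0| <= r] = (fun u => `|u - u0|) @^-1` [set t | t <= r] by [].
apply: closed_comp => [u _|]; last exact: closed_le.
apply: (@continuous_at_comp _ _ _ (fun u : 'rV[R]_n => u - u0) (fun v : 'rV[R]_n => `|v|)).
  by apply: continuousB; [exact: id|exact: cst_continuous].
exact: norm_continuous.
Qed.

(** * A Riemannian metric separates points *)

Section Separation.
Variable R : realType.
Variables (X : topologicalType) (n : nat) (A : set (chart R X n)).
Hypothesis hA : smooth_manifold A.
Let cA := smooth_manifold_covering hA.
Variable g : tensor R X n.
Hypothesis hg : riemannian_metric A g.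
Hypothesis conn : path_connected_atlas A.
Let sg := riemannian_semi_metric hg.

Lemma qformB (M N : 'M[R]_n) v w : qform (M - N) v w = qform M v w - qform N v w.
Proof. by rewrite /qform mulmxBr mulmxBl !mxE. Qed.

(** On the unit sphere the form at x has a positive minimum [mu], which extends to all vectors by
    homogeneity. By continuity of the tensor, half of it survives at nearby points. *)
Lemma metric_lower_bound phi x : A phi -> dom phi x ->
  exists2 l : R, 0 < l & \forall u \near cmap phi x,
    forall w, l * `|w| <= Num.sqrt (qform (g phi u) w w).
Proof.
move=> Aphi dx.
pose S := [set w : 'rV[R]_n | `|w| = 1].
have cS : compact S.
  apply: bounded_closed_compact.
    by exists 1; split => // y y1 w /= ->; exact: ltW.
  have -> : S = Num.norm @^-1` [set 1] by [].
  apply: closed_comp => [w _|]; first exact: norm_continuous.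
  exact: closed_eq.
pose q w := qform (g phi (cmap phi x)) w w.
have cq : continuous q.
  move=> w; exact: (@cvg_qform R _ (nbhs w) _ n (fun=> g phi (cmap phi x))
    id id _ w w (cvg_cst _) cvg_id cvg_id).
(* In dimension 0 the sphere is empty and any positive [mu] will do. *)
have [mu mu0 hmu] : exists2 mu : R, 0 < mu & forall w, S w -> mu <= q w.
  have [S0|/set0P S0] := eqVneq S set0; first by exists 1 => // w; rewrite S0.
  have [w0 /set_mem w0S hw] := compact_EVT_min S0 cS (continuous_subspaceT cq).
  exists (q w0); last by move=> w /mem_set; exact: hw.
  have [_ _ pos _] := hg; apply: pos => //.
  by apply: contra_eqN w0S => /eqP ->; rewrite normr0 eq_sym oner_eq0.
have hq w : mu * `|w| ^+ 2 <= q w.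
  have [->|w0] := eqVneq w 0; first by rewrite normr0 expr0n mulr0 /q /qform !mul0mx mxE.
  have nw : 0 < `|w| by rewrite normr_gt0.
  have := hmu (`|w|^-1 *: w); rewrite /S /= normrZ normfV normr_id mulVf ?gt_eqF //.
  rewrite /q qformZ qformZr => /(_ erefl) h.
  rewrite -ler_pdivlMr ?exprn_gt0 //; apply: le_trans h _.
  by rewrite le_eqVlt; apply/orP; left; apply/eqP; field; rewrite gt_eqF.
exists (Num.sqrt (mu / 2)); first by rewrite sqrtr_gt0; lra.
have cg := tensor_continuous sg Aphi dx.
(* By [qform_le], moving the tensor by less than [d] changes the form by at most (n * n) * d * |w|^2
   <= mu/2 * |w|^2. The added 1 keeps the denominator nonzero. *)
pose d := mu / 2 / ((n * n)%:R + 1).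
have n0 : (0 : R) < (n * n)%:R + 1 by rewrite ltr_wpDl.
have d0 : 0 < d by rewrite !divr_gt0.
have nP : nbhs (cmap phi x) [set u | `|g phi (cmap phi x) - g phi u| < d].
  have nd : nbhs (cmap phi x) [set u | ball (g phi (cmap phi x)) d (g phi u)] :=
    cg _ (nbhsx_ballx (g phi (cmap phi x)) d d0).
  by apply: filterS nd => u /=; rewrite -ball_normE.
apply: filterS nP => u /= hu w.
rewrite -(ger0_norm (normr_ge0 w)) -sqrtr_sqr -sqrtrM; last by lra.
apply: ler_wsqrtr.
have h1 := qform_le (g phi (cmap phi x) - g phi u) w w.
have h2 : (n * n)%:R * `|g phi (cmap phi x) - g phi u| * `|w| * `|w| <= mu / 2 * `|w| ^+ 2.
  rewrite -mulrA -expr2 ler_wpM2r ?sqr_ge0 //.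
  apply: (@le_trans _ _ ((n * n)%:R * d)); first by rewrite ler_wpM2l // ltW.
  rewrite /d mulrCA ler_piMr //; first lra.
  by rewrite ler_pdivrMr // mul1r lerDl.
have h3 := ler_norm (qform (g phi (cmap phi x) - g phi u) w w).
have h4 : qform (g phi (cmap phi x) - g phi u) w w = q w - qform (g phi u) w w by rewrite qformB.
have := hq w; lra.
Qed.

(** The coordinate distance to x, truncated at [r] and set to [r] outside the chart, is a function
    [N] on all of X. By the choice of [l], the pseudo-distance l * |N z - N z'| grows along arcs no
    faster than the speed, and it puts x and y at distance l * r. *)
Lemma dist_gt0 x y : x <> y -> 0 < riemannian_distance A g x y.
Proof.
move=> xy; have [phi Aphi dx] := cA.2 x.
have [l l0 nl] := metric_lower_bound Aphi dx.
have [r0 [r00 rim rP]] := chart_ball hA Aphi dx nl.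
have [_ _ K cc ci] := cA.1 _ Aphi.
set u0 := cmap phi x in rim rP *.
(* [r] < [r0] makes the truncation level reached inside the chart; the last condition makes [N] take
   the value [r] at y. *)
have [r [rp rr0 ry]] : exists r : R, [/\ 0 < r, r < r0 & dom phi y -> r <= `|cmap phi y - u0|].
  have [dy|dy] := pselect (dom phi y); last by exists (r0 / 2); split => //; lra.
  have yx : 0 < `|cmap phi y - u0|.
    rewrite normr_gt0 subr_eq0; apply/negP => /eqP E; apply: xy.
    by rewrite -(K x dx) -/u0 -E K.
  exists (Num.min (r0 / 2) `|cmap phi y - u0|); split.
  - by rewrite lt_min yx andbT; lra.
  - by rewrite gt_min; apply/orP; left; lra.
  - by rewrite ge_min lexx orbT.
pose N z := if `[< dom phi z >] then Num.min r `|cmap phi z - u0| else r.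
pose KK := cinv phi @` [set u | `|u - u0| <= r].
have KKcl : closed KK := chart_closed_ball hA Aphi rim rr0.
have Nfar z : ~ KK z -> N z = r.
  move=> zK; rewrite /N; case: asboolP => // dz.
  apply/min_idPl; rewrite leNgt; apply/negP => h; apply: zK.
  by exists (cmap phi z); [exact: ltW|exact: K].
have h : forall z z', l * `|N z - N z'| <= riemannian_distance A g z z'.
  apply: (le_dist_of_local hA sg conn) => //.
  - by move=> z; rewrite subrr normr0 mulr0.
  - by move=> z z'; rewrite distrC.
  - by move=> z' z z''; rewrite -mulrDr ler_wpM2l ?(ltW l0) // ler_distD.
  move=> D c t oD ac Dt e e0.
  have sp0 := speed_ge0 hA sg oD ac Dt.
  (* Outside the closed set [KK] the function [N] is constant near [c t]; inside, the arc is read in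
     the chart [phi]. *)
  have [cK|cK] := pselect (KK (c t)); last first.
    have nK : \forall s \near t, ~ KK (c s).
      have oK : nbhs (c t) (~` KK) by apply: open_nbhs_nbhs; split => //; exact: closed_openC.
      exact: ac.1 t Dt _ oK.
    apply: filterS nK => s /Nfar ->; rewrite (Nfar _ cK) subrr normr0 mulr0.
    by rewrite mulr_ge0 // addr_ge0 // ltW.
  have [u ur uc] := cK.
  have ub : ball u0 r0 u by rewrite -ball_normE /= distrC; exact: le_lt_trans rr0.
  have [z dz zu] := rim u ub.
  have cz : c t = z by rewrite -uc -zu K.
  have dct : dom phi (c t) by rewrite cz.
  have cu : cmap phi (c t) = u by rewrite cz.
  have df := arc_differentiable ac Aphi Dt dct.
  have nD : nbhs t (D `&` c @^-1` dom phi).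
    by apply: open_nbhs_nbhs; split => //; exact: (arc_dom_open hA).
  have el0 : 0 < e / l by rewrite divr_gt0.
  apply: filterS2 nD (differentiable_eps df el0) => s [Ds ds].
  have -> : 'd (fun t : R => cmap phi (c t)) t (s - t) = (s - t) *: velocity phi c t.
    by rewrite /velocity deriveE // -linearZ /= [_ *: 1]mulr1.
  move=> hs.
  have lv : l * `|velocity phi c t| <= speed A g c t.
    rewrite (speedE hA sg oD ac Aphi Dt dct) innerE cu; exact: rP ub _.
  have hN : `|N (c t) - N (c s)| <= `|cmap phi (c s) - cmap phi (c t)|.
    rewrite /N; case: asboolP => // _; case: asboolP => // _.
    set a := `|cmap phi (c t) - u0|; set b := `|cmap phi (c s) - u0|.
    have : `|a - b| <= `|cmap phi (c s) - cmap phi (c t)|.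
      apply: le_trans (ler_dist_dist _ _) _.
      by rewrite opprB addrA subrK distrC.
    apply: le_trans; rewrite /Num.min.
    by case: ltP => h1; case: ltP => h2; rewrite ?subrr ?normr0 //; rewrite !ler_norml;
      apply/andP; split; have := ler_norm (a - b); have := ler_norm (b - a); rewrite (distrC b);
        lra.
  have h2 : `|cmap phi (c s) - cmap phi (c t)| <= (`|velocity phi c t| + e / l) * `|s - t|.
    have := ler_normD (cmap phi (c s) - cmap phi (c t) - (s - t) *: velocity phi c t) ((s - t)
      *: velocity phi c t).
    rewrite subrK normrZ; lra.
  apply: (@le_trans _ _ (l * ((`|velocity phi c t| + e / l) * `|s - t|))).
    by rewrite ler_wpM2l ?(ltW l0) // (le_trans hN).
  rewrite mulrA ler_wpM2r // mulrDr [l * (e / l)]mulrC divfK ?gt_eqF // lerD2r //.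
have := h x y.
have -> : N x = 0.
  rewrite /N; case: asboolP => // _; rewrite subrr normr0; apply/min_idPr; exact: ltW.
have -> : N y = r.
  by rewrite /N; case: asboolP => // dy; apply/min_idPl; exact: ry.
by apply: lt_le_trans; rewrite sub0r normrN gtr0_norm // mulr_gt0.
Qed.

Lemma dist_eq0 x y : riemannian_distance A g x y = 0 -> x = y.
Proof.
move=> d0; apply: contrapT => /dist_gt0; by rewrite d0 ltxx.
Qed.

Lemma riemannian_is_distance : is_distance (riemannian_distance A g).
Proof.
split; [exact: (distxx hA sg)|exact: dist_eq0|exact: (dist_sym hA sg)|].
by move=> y x z; exact: (dist_triangle hA sg conn).
Qed.

Definition riemannian_space : metricType R := metric_space_of riemannian_is_distance.

Lemma riemannian_space_isometric :
  isometric_to riemannian_space (riemannian_distance A g).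
Proof. by exists id => //; exists id. Qed.

Lemma riemannian_space_GH : [set: X] !=set0 -> compact [set: X] ->
  GH_space riemannian_space.
Proof.
move=> X0 cX; split=> // F PF FT.
have [p [_ clp]] := cX F PF FT.
exists (p : riemannian_space); split=> // B C FB /nbhs_ballP[e /= e0 he].
apply: clp => //.
apply: filterS (dist_near hA sg p e0) => y yd; apply: he.
by rewrite ballEmdist.
Qed.

End Separation.

(** * Linear openness *)

Section Graves.
Variable R : realType.

Lemma mulmx_norm_le m n (w : 'rV[R]_m) (M : 'M[R]_(m, n)) :
  `|w *m M| <= m%:R * `|M| * `|w|.
Proof.
apply: mx_norm_le => [|i j]; first by rewrite !mulr_ge0.
rewrite mxE; apply: (le_trans (ler_norm_sum _ _ _)).
apply: (@le_trans _ _ (\sum_(i < m) `|M| * `|w|)).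
  by apply: ler_sum => l _; rewrite normrM mulrC ler_pM // le_mx_norm.
by rewrite sumr_const card_ord -[leLHS]mulr_natl mulrA.
Qed.

Lemma mulmxr_continuous m n (M : 'M[R]_(m, n)) :
  continuous (fun w : 'rV[R]_m => w *m M).
Proof.
have : continuous (mulmxr M : {linear 'rV[R]_m -> 'rV[R]_n}).
  apply/linear_bounded_continuous/bounded_funP => r; exists (m%:R * `|M| * r) => x xr.
  by apply: (le_trans (mulmx_norm_le _ _)); rewrite ler_wpM2l // mulr_ge0.
exact.
Qed.

Lemma is_diff_affine (W : normedModType R) (u w : W) (s : R) :
  is_diff s (fun t : R => u + t *: w) (scale_lin w).
Proof.
apply: diff_eps => [|e e0]; first exact: scalel_continuous.
near=> y; rewrite /= /scale_lin scalerBl opprD addrACA subrr add0r subrr normr0.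
by rewrite mulr_ge0 // ltW.
Unshelve. all: by end_near. Qed.

Variables (n k : nat) (F : 'rV[R]_n -> 'rV[R]_k) (D : set 'rV[R]_n) (u0 : 'rV[R]_n).
Hypotheses (oD : open D) (Du0 : D u0) (CF : Ck 1 D F).

Lemma diff_jacobian u w : 'd F u w = w *m jacobian F u.
Proof. by rewrite /jacobian mul_rV_lin1. Qed.

Lemma diff_near_center (e : R) : 0 < e -> exists2 r : R, 0 < r &
  ball u0 r `<=` D /\
  (forall u w, ball u0 r u -> `|'d F u w - 'd F u0 w| <= e * `|w|).
Proof.
move=> e0; have [dF cF] := proj1 (CkSP _ _ _) CF.
have cJ : {for u0, continuous (jacobian F)}.
  have h : Ck 0 D (jacobian F).
    apply/Ck_mxP => // i j.
    have := proj1 (Ck_mxP _ _ oD) (cF (delta_mx 0 i)) 0 j.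
    by congr Ck; apply: funext => u; rewrite diff_jacobian -rowE mxE.
  exact: h.
pose d := e / (n%:R + 1).
have n0 : (0 : R) < n%:R + 1 by rewrite ltr_wpDl.
have d0 : 0 < d by rewrite divr_gt0.
have nJ : nbhs u0 [set u | ball (jacobian F u0) d (jacobian F u)] :=
  cJ _ (nbhsx_ballx _ _ d0).
have nD : nbhs u0 D by apply: open_nbhs_nbhs.
have : nbhs u0 (D `&` [set u | ball (jacobian F u0) d (jacobian F u)]) by exact: filterI.
move=> /nbhs_ballP[r /= r0 hr]; exists r => //; split; first by move=> u /hr[].
move=> u w /hr[_] /=; rewrite -ball_normE /= => hJ.
have -> : 'd F u w - 'd F u0 w = w *m (jacobian F u - jacobian F u0).
  exact: etrans (congr2 (fun a b : 'rV[R]_k => a - b) (diff_jacobian u w)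
    (diff_jacobian u0 w)) (esym (mulmxBr w (jacobian F u) (jacobian F u0))).
apply: (le_trans (mulmx_norm_le _ _)).
rewrite ler_wpM2r //; rewrite distrC in hJ.
apply: (@le_trans _ _ (n%:R * d)); first by rewrite ler_wpM2l // ltW.
by rewrite /d mulrCA ler_piMr ?(ltW e0) // ler_pdivrMr // mul1r lerDl.
Qed.

(** The mean value theorem holds for real functions only, so it is applied along the segment to each
    coordinate of F minus its linear part. As the norm is the maximum norm, bounding the coordinates
    is enough. *)
Lemma strict_differentiability (e : R) : 0 < e -> exists2 r : R, 0 < r &
  [/\ ball u0 r `<=` D,
  (forall u w, ball u0 r u -> `|'d F u w - 'd F u0 w| <= e * `|w|) &
  (forall u u', ball u0 r u -> ball u0 r u' ->
     `|F u' - F u - 'd F u0 (u' - u)| <= e * `|u' - u|)].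
Proof.
move=> e0; have [r r0 [rD hr]] := diff_near_center e0.
exists r => //; split=> // u u' hu hu'.
have [dF cF] := proj1 (CkSP _ _ _) CF.
apply: mx_norm_le => [|i j]; first by rewrite mulr_ge0 // ltW.
pose l (s : R) : 'rV[R]_n := u + s *: (u' - u).
pose th (s : R) : R := F (l s) i j - s * 'd F u0 (u' - u) i j.
have bl (s : R) : 0 <= s <= 1 -> ball u0 r (l s).
  by move=> s01; exact: ball_segment.
have dth (s : R) : 0 <= s <= 1 ->
    is_derive s 1 th ('d F (l s) (u' - u) i j - 'd F u0 (u' - u) i j).
  move=> s01; have dFl := dF _ (rD _ (bl s s01)).
  have dl : is_diff s l (scale_lin (u' - u)).
    exact: is_diff_affine.
  have dFl' : is_diff (l s) F ('d F (l s)) by exact: differentiableP.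
  have dc' : is_diff (F (l s)) (@mxcoord R 1 k i j) (@mxcoord R 1 k i j).
    by apply: DiffDef; [apply: linear_differentiable; exact: mxcoord_continuous|rewrite diff_lin
      //; exact: mxcoord_continuous].
  have d1 := is_derive_is_diff (1 : R) (is_diff_comp (is_diff_comp dl dFl') dc').
  have d2 : is_derive s 1 (fun s : R => s * 'd F u0 (u' - u) i j) ('d F u0 (u' - u) i j).
    have dd : is_diff s (scale_lin ('d F u0 (u' - u) i j)) (scale_lin ('d F u0 (u' - u) i j)).
      by apply: DiffDef; [apply: linear_differentiable; exact: scalel_continuous|rewrite
        diff_lin //; exact: scalel_continuous].
    have := is_derive_is_diff (1 : R) dd.
    by rewrite {2}/scale_lin scale1r.
  have := is_deriveB d1 d2.
  by rewrite /= /scale_lin scale1r.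
have [c c01 hc] : exists2 c, c \in `]0, 1[%R & th 1 - th 0 =
   ('d F (l c) (u' - u) i j - 'd F u0 (u' - u) i j) * (1 - 0).
  apply: (MVT ltr01).
    by move=> x; rewrite in_itv /= => /andP[x0 x1]; apply: dth; rewrite !ltW.
  apply: derivable_within_continuous => x; rewrite in_itv /= => x01.
  by have [] := dth x x01.
have -> : (F u' - F u - 'd F u0 (u' - u)) i j = th 1 - th 0.
  rewrite /th /l scale1r scale0r addr0 mul1r mul0r subr0 [u + _]addrC subrK.
  by rewrite !mxE; ring.
move: c01; rewrite in_itv /= => /andP[/ltW c0 /ltW c1].
rewrite hc subr0 mulr1.
have := le_mx_norm ('d F (l c) (u' - u) - 'd F u0 (u' - u)) i j.
rewrite !mxE => /le_trans; apply; apply: hr.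
by apply: bl; rewrite c0.
Qed.

Lemma right_inverse_mx : (forall w, exists v, 'd F u0 v = w) ->
  exists B : 'M[R]_(k, n), B *m jacobian F u0 = 1%:M.
Proof.
move=> surj; have /choice[b hb] (i : 'I_k) := surj (delta_mx 0 i).
exists (\matrix_i b i); apply/row_matrixP => i.
by rewrite row_mul rowK -diff_jacobian hb row1.
Qed.

(* Graves' theorem *)
Lemma linear_openness : (forall w, exists v, 'd F u0 v = w) ->
  exists C : R, 0 <= C /\ forall rho : R, 0 < rho -> exists2 d : R, 0 < d &
    forall z, `|z - F u0| < d ->
      exists u, [/\ F u = z, ball u0 rho u & `|u - u0| <= C * `|z - F u0|].
Proof.
move=> /right_inverse_mx[B hB].
pose b := k%:R * `|B| + 1.
have b0 : 0 < b by rewrite ltr_wpDl // mulr_ge0.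
have hb (y : 'rV[R]_k) : `|y *m B| <= b * `|y|.
  apply: (le_trans (mulmx_norm_le _ _)); rewrite ler_wpM2r // /b; lra.
exists (2 * b); split; first by lra.
move=> rho rho0.
(* [b] bounds the right inverse [B], so an error of (2b)^-1 |(y - y') B| is at most half of |y -
   y'|: the contraction ratio below. *)
have e0 : 0 < (2 * b)^-1 by rewrite invr_gt0; lra.
have [r' r'0 [rD' _ hr']] := strict_differentiability e0.
pose r := Num.min r' rho.
have r0 : 0 < r by rewrite lt_min r'0.
have sub_r : ball u0 r `<=` ball u0 r' by apply: le_ball; rewrite ge_min lexx.
have sub_rho : ball u0 r `<=` ball u0 rho by apply: le_ball; rewrite ge_min lexx orbT.
pose s := r / (2 * b).
have s0 : 0 < s by rewrite divr_gt0 //; lra.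
have bs : b * s < r by rewrite /s mulrCA invfM [b * _]mulrC divfK ?gt_eqF //; lra.
(* Since |Phi 0| = |z - F u0| < s / 2 and the ratio is 1/2, the map [Phi] below sends the ball of
   radius [s] into itself. *)
exists (s / 2); first lra.
move=> z hz.
pose U := [set y : 'rV[R]_k | `|y| <= s].
(* A fixed point solves F (u0 + y B) = z. [Phi] is a contraction because y -> F (u0 + y B) has the
   identity as differential at 0. *)
pose Phi (y : 'rV[R]_k) : 'rV[R]_k := y - (F (u0 + y *m B) - z).
have inr y : U y -> ball u0 r (u0 + y *m B).
  move=> yU; rewrite -ball_normE /= opprD addrA subrr sub0r normrN.
  by apply: le_lt_trans bs; apply: le_trans (hb y) _; rewrite ler_wpM2l // ltW.
have ctr y y' : U y -> U y' -> `|Phi y - Phi y'| <= 2^-1 * `|y - y'|.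
  move=> yU y'U; have := hr' _ _ (sub_r _ (inr y' y'U)) (sub_r _ (inr y yU)).
  have -> : u0 + y *m B - (u0 + y' *m B) = (y - y') *m B.
    by rewrite opprD addrACA subrr add0r mulmxBl.
  rewrite diff_jacobian -mulmxA hB mulmx1.
  have -> : F (u0 + y *m B) - F (u0 + y' *m B) - (y - y') = - (Phi y - Phi y').
    by rewrite /Phi; apply/matrixP => i j; rewrite !mxE; ring.
  rewrite normrN => /le_trans; apply.
  rewrite invfM -mulrA ler_wpM2l ?invr_ge0 // mulrC ler_pdivrMr // mulrC; exact: hb.
have U0 : U 0 by rewrite /U /= normr0 ltW.
have P0 : `|Phi 0| = `|z - F u0| by rewrite /Phi mul0mx addr0 sub0r opprB.
have PU : {homo Phi : y / U y >-> U y}.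
  move=> y yU; rewrite /U /=.
  have := ler_normD (Phi y - Phi 0) (Phi 0); rewrite subrK P0.
  have := ctr _ _ yU U0; rewrite subr0; rewrite /U /= in yU; lra.
have clU : closed U.
  have -> : U = Num.norm @^-1` [set t | t <= s] by [].
  apply: closed_comp => [w _|]; [exact: norm_continuous|exact: closed_le].
have cU : compact U.
  apply: bounded_closed_compact => //; exists s; split; first exact: num_real.
  by move=> t st w /= /le_trans; apply; exact: ltW.
have cPhi : {within U, continuous (fun y => `|Phi y - y|)}.
  apply: continuous_in_subspaceT => y; rewrite inE => yU.
  apply: (@continuous_at_comp _ _ _ (fun y : 'rV[R]_k => Phi y - y) (fun v : 'rV[R]_k => `|v|));
    last exact: norm_continuous.
  apply: continuousB; last exact: id.
  apply: continuousB; first exact: id.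
  apply: continuousB; last exact: cst_continuous.
  apply: (@continuous_at_comp _ _ _ (fun y : 'rV[R]_k => u0 + y *m B) F).
    apply: continuousD; first exact: cst_continuous.
    exact: mulmxr_continuous.
  have [dF _] := proj1 (CkSP _ _ _) CF.
  by apply: differentiable_continuous; apply: dF; apply: rD'; apply: sub_r; exact: inr.
(* The fixed point is a minimiser of |Phi y - y| on the compact ball: passing from y to Phi y halves
   this displacement at least, so the minimum is 0. *)
have [y /set_mem yU ymin] := compact_EVT_min (ex_intro _ 0 U0) cU cPhi.
have {}yE : y = Phi y.
  apply/eqP; rewrite eq_sym -subr_eq0 -normr_eq0 eq_le normr_ge0 andbT.
  have PyU := PU _ yU.
  have := ymin _ (mem_set PyU); have := ctr _ _ PyU yU; lra.
have Fy : F (u0 + y *m B) = z.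
  apply/eqP; rewrite -subr_eq0; apply/eqP.
  move: yE; rewrite /Phi => /esym/eqP; rewrite -subr_eq0 addrAC subrr add0r oppr_eq0 => /eqP.
  exact.
have ny : `|y| <= 2 * `|z - F u0|.
  have := ler_normD (Phi y - Phi 0) (Phi 0); rewrite subrK P0 -yE.
  have := ctr _ _ yU U0; rewrite subr0 -yE; lra.
exists (u0 + y *m B); split=> //; first exact: sub_rho (inr y yU).
rewrite addrAC subrr add0r; apply: le_trans (hb y) _.
by rewrite [2 * b]mulrC -mulrA ler_wpM2l // ltW.
Qed.

End Graves.

(** * Pullback along a submersion *)

Section PullbackForms.
Variable R : realType.

Lemma qform_conj n k (J : 'M[R]_(n, k)) (H : 'M[R]_k) v w :
  qform (J *m H *m J^T) v w = qform H (v *m J) (w *m J).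
Proof. by rewrite /qform trmx_mul !mulmxA. Qed.

Lemma qform_pull n k (F : 'rV[R]_n -> 'rV[R]_k) u (H : 'M[R]_k) v w :
  qform (jacobian F u *m H *m (jacobian F u)^T) v w = qform H ('d F u v) ('d F u w).
Proof. by rewrite qform_conj !diff_jacobian. Qed.

Lemma qform_delta n (M : 'M[R]_n) i j : qform M (delta_mx 0 i) (delta_mx 0 j) = M i j.
Proof.
rewrite /qform -rowE mxE (bigD1 j) //= big1 ?addr0; last first.
  by move=> l lj; rewrite !mxE (negbTE lj) mulr0.
by rewrite !mxE !eqxx mulr1.
Qed.

Lemma Ck_mxmul (V : normedModType R) k (D : set V) m n p
    (M : V -> 'M[R]_(m, n)) (N : V -> 'M[R]_(n, p)) :
  open D -> Ck k D M -> Ck k D N -> Ck k D (fun u => M u *m N u).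
Proof.
move=> oD CM CN; apply/Ck_mxP => // i j.
have -> : (fun u => (M u *m N u) i j) = (fun u => \sum_l M u i l * N u l j).
  by apply: funext => u; rewrite mxE.
apply: Ck_sum => // l _; apply: Ck_mul => //.
  exact: (proj1 (Ck_mxP _ _ oD) CM).
exact: (proj1 (Ck_mxP _ _ oD) CN).
Qed.

Lemma Ck_trmx (V : normedModType R) k (D : set V) m n (M : V -> 'M[R]_(m, n)) :
  open D -> Ck k D M -> Ck k D (fun u => (M u)^T).
Proof.
move=> oD CM; apply/Ck_mxP => // i j.
have -> : (fun u => (M u)^T i j) = (fun u => M u j i) by apply: funext => u; rewrite mxE.
exact: (proj1 (Ck_mxP _ _ oD) CM).
Qed.

Lemma Ck_jacobian n k j (D : set 'rV[R]_n) (F : 'rV[R]_n -> 'rV[R]_k) :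
  open D -> Ck j.+1 D F -> Ck j D (jacobian F).
Proof.
move=> oD /CkSP[_ cF]; apply/Ck_mxP => // i l.
have := proj1 (Ck_mxP _ _ oD) (cF (delta_mx 0 i)) 0 l.
by congr Ck; apply: funext => u; rewrite diff_jacobian -rowE mxE.
Qed.

End PullbackForms.

Section Pullback.
Variable R : realType.
Variables (X Y : topologicalType) (n k : nat).
Variables (A : set (chart R X n)) (B : set (chart R Y k)) (f : X -> Y).
Hypotheses (hA : smooth_manifold A) (hB : smooth_manifold B).
Hypothesis hf : smooth_map A B f.
Let cA := smooth_manifold_covering hA.
Let cB := smooth_manifold_covering hB.

Definition chart_at (y : Y) : chart R Y k := s2val (cid2 (cB.2 y)).
Lemma chart_atP y : B (chart_at y) /\ dom (chart_at y) y.
Proof. by split; [exact: (s2valP (cid2 (cB.2 y)))|exact: (s2valP' (cid2 (cB.2 y)))]. Qed.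

Variable h : tensor R Y k.
Hypothesis hh : semi_metric B h.

(** The chart of Y is chosen at each point with no continuity at all. [pullback_inner] shows that
    any chart gives the same form, and smoothness is obtained by fixing one chart locally. *)
Definition pullback : tensor R X n := fun phi u =>
  let y := f (cinv phi u) in
  let psi := chart_at y in
  let J := jacobian (coord_map phi psi f) u in
  J *m h psi (cmap psi y) *m J^T.

Lemma tangent_change phi psi psi' x v : A phi -> B psi -> B psi' ->
  dom phi x -> dom psi (f x) -> dom psi' (f x) ->
  tangent phi psi' f x v = tangent psi psi' id (f x) (tangent phi psi f x v).
Proof.
move=> Aphi Bpsi Bpsi' dx df df'.
exact: (tangent_comp cA cB openT hf (smooth_map_id hB) Aphi Bpsi Bpsi' I I dx df df').
Qed.

Lemma pullback_inner phi psi x v w : A phi -> B psi -> dom phi x -> dom psi (f x) ->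
  inner pullback phi x v w =
  inner h psi (f x) (tangent phi psi f x v) (tangent phi psi f x w).
Proof.
move=> Aphi Bpsi dx df.
have [_ _ K _ _] := cA.1 _ Aphi.
rewrite innerE /pullback K // qform_conj -!diff_jacobian.
have [Bc dc] := chart_atP (f x).
set psi' := chart_at (f x) in Bc dc *.
have [_ _ _ hp] := hh.
rewrite (tangent_change v Aphi Bc Bpsi dx dc df) (tangent_change w Aphi Bc Bpsi dx dc df).
by have := hp _ _ (f x) Bc Bpsi dc df => /= ->.
Qed.

Lemma pullback_qform phi psi u v w : A phi -> B psi ->
  (cmap phi @` (dom phi `&` f @^-1` dom psi)) u ->
  qform (pullback phi u) v w =
  qform (h psi (coord_map phi psi f u)) ('d (coord_map phi psi f) u v)
    ('d (coord_map phi psi f) u w).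
Proof.
move=> Aphi Bpsi [x [dx fx] <-].
rewrite -innerE (pullback_inner v w Aphi Bpsi dx fx) innerE.
by rewrite (coord_mapE cA f psi Aphi dx).
Qed.

Lemma semi_metric_pullback : semi_metric A pullback.
Proof.
have [h1 h2 h3 h4] := hh; split.
- move=> phi Aphi j; apply: Ck_local => u [x dx <-].
  have [psi Bpsi fx] := cB.2 (f x).
  set E := cmap phi @` (dom phi `&` setT `&` f @^-1` dom psi).
  have oE : open E := smooth_domain_open cA cB openT hf.1 Aphi Bpsi.
  have CF i : Ck i E (coord_map phi psi f) := hf.2 _ _ Aphi Bpsi i.
  exists E, (fun u => jacobian (coord_map phi psi f) u *m
     h psi (coord_map phi psi f u) *m (jacobian (coord_map phi psi f) u)^T).
  split; first exact: oE.
  + by exists x.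
  (* Independence of the chart is known for the bilinear forms; evaluating them on basis vectors
     turns it into an equality of matrices. *)
  + move=> v [y [[dy _] fy] <-]; apply/matrixP => i l.
    apply: etrans (esym (qform_delta _ i l)) _; apply: etrans _ (qform_delta _ i l).
    apply: etrans (qform_pull _ _ _ _ _) _; apply/esym.
    by apply: (pullback_qform _ _ Aphi Bpsi); exists y.
  + have CJ := Ck_jacobian oE (CF j.+1).
    apply: Ck_mxmul => //; last exact: Ck_trmx.
    apply: Ck_mxmul => //.
    have oD : open (cmap psi @` dom psi) by have [_ ] := cB.1 _ Bpsi.
    apply: (@Ck_comp R _ j E k k k (cmap psi @` dom psi) (coord_map phi psi f) (h psi)) => //.
      move=> v [y [[dy _] fy] <-]; exists (f y) => //.
      by rewrite (coord_mapE cA f psi Aphi dy).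
    by apply/Ck_mxP => //; exact: h1.
- move=> phi x Aphi dx v w; have [psi Bpsi fx] := cB.2 (f x).
  by rewrite !(pullback_inner _ _ Aphi Bpsi dx fx); exact: h2.
- move=> phi x Aphi dx v; have [psi Bpsi fx] := cB.2 (f x).
  by rewrite !(pullback_inner _ _ Aphi Bpsi dx fx); exact: h3.
- move=> phi psi x Aphi Apsi dx dx' v w; have [chi Bchi fx] := cB.2 (f x).
  rewrite (pullback_inner _ _ Apsi Bchi dx' fx) (pullback_inner _ _ Aphi Bchi dx fx).
  have E v' : tangent psi chi f x (tangent phi psi id x v') = tangent phi chi f x v'.
    exact/esym/(tangent_comp cA cA openT (smooth_map_id hA) hf Aphi Apsi Bchi I I dx dx' fx v').
  by rewrite /= !E.
Qed.

Lemma arc_comp D c : open D -> arc_on A D c -> arc_on B D (f \o c).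
Proof.
move=> oD ac.
have cc t : D t -> {for t, continuous (f \o c)}.
  by move=> Dt; apply: continuous_at_comp; [exact: ac.1|exact: hf.1].
split=> // psi Bpsi j; apply: Ck_local => t [Dt ct].
have [phi Aphi dt] := cA.2 (c t).
have oE : open (D `&` c @^-1` dom phi `&` (f \o c) @^-1` dom psi).
  rewrite openE => s [[Ds ds] cs]; apply: filterI; first apply: filterI.
  - exact: open_nbhs_nbhs.
  - exact: ac.1 s Ds _ (nbhs_dom (cA.1 _ Aphi) ds).
  - exact: cc s Ds _ (nbhs_dom (cB.1 _ Bpsi) cs).
exists (D `&` c @^-1` dom phi `&` (f \o c) @^-1` dom psi),
  (coord_map phi psi f \o (fun t => cmap phi (c t))).
split=> //.
- by move=> s [[Ds ds] cs] /=; rewrite (coord_mapE cA f psi Aphi ds).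
- have oF := smooth_domain_open cA cB openT hf.1 Aphi Bpsi.
  apply: (@Ck_comp R _ j _ n 1 k (cmap phi @` (dom phi `&` setT `&` f @^-1` dom psi))) => //.
  + by move=> s [[Ds ds] cs]; exists (c s).
  + by apply: Ck_sub (ac.2 phi Aphi j) => s [].
  + exact: (proj1 (Ck_mxP _ _ oF) (hf.2 _ _ Aphi Bpsi j)).
Qed.

Lemma velocity_comp D c phi psi t : open D -> arc_on A D c -> A phi -> B psi -> D t ->
  dom phi (c t) -> dom psi (f (c t)) ->
  velocity psi (f \o c) t = tangent phi psi f (c t) (velocity phi c t).
Proof.
move=> oD ac Aphi Bpsi Dt ct fct.
have df := arc_differentiable ac Aphi Dt ct.
have dg := arc_differentiable (arc_comp oD ac) Bpsi Dt fct.
have dh := smooth_on_differentiable hf Aphi Bpsi (I : setT (c t)) ct fct.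
rewrite /velocity !deriveE //.
have near_t : \forall s \near t, (coord_map phi psi f \o (fun t : R => cmap phi (c t)))
  s = cmap psi ((f \o c) s).
  have nD : nbhs t (D `&` c @^-1` dom phi).
    by apply: open_nbhs_nbhs; split => //; exact: (arc_dom_open hA oD ac Aphi).
  by apply: filterS nD => s [Ds ps]; exact: (coord_mapE cA f psi Aphi ps).
have E := near_diffE (1 : R) near_t (differentiable_comp df dh).
exact: etrans E (diff_compE (1 : R) df dh).
Qed.

Lemma speed_comp D c t : open D -> arc_on A D c -> D t ->
  speed A pullback c t = speed B h (f \o c) t.
Proof.
move=> oD ac Dt; have [phi Aphi ct] := cA.2 (c t).
have [psi Bpsi fct] := cB.2 (f (c t)).
rewrite (speedE hA semi_metric_pullback oD ac Aphi Dt ct).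
rewrite (speedE hB hh oD (arc_comp oD ac) Bpsi Dt fct).
by rewrite (pullback_inner _ _ Aphi Bpsi ct fct) (velocity_comp oD ac Aphi Bpsi Dt ct fct).
Qed.

Lemma smooth_arc_comp c : smooth_arc A c -> smooth_arc B (f \o c).
Proof. by move=> /smooth_arcP[e e0 ac]; exists e => //; apply: arc_comp => //;
  exact: open_ival. Qed.

Lemma arc_length_comp c : smooth_arc A c ->
  arc_length A pullback c = arc_length B h (f \o c).
Proof.
move=> /smooth_arcP[e e0 ac]; apply: eq_Rintegral => t.
rewrite inE /= in_itv /= => t01.
exact: (speed_comp (@open_ival _ e) ac (ival01 e0 t01)).
Qed.

Lemma path_comp x s y : piecewise_smooth_path A x s y ->
  piecewise_smooth_path B (f x) [seq f \o c | c <- s] (f y).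
Proof.
elim: s x => [|c s IH] x /=; first by move=> ->.
by move=> [ac <- /IH h']; split=> //; exact: smooth_arc_comp.
Qed.

Lemma path_length_comp x s y : piecewise_smooth_path A x s y ->
  \sum_(c <- [seq f \o c | c <- s]) arc_length B h c =
  \sum_(c <- s) arc_length A pullback c.
Proof.
elim: s x => [|c s IH] x /=; first by rewrite !big_nil.
by move=> [ac _ /IH h']; rewrite !big_cons h' arc_length_comp.
Qed.

Lemma dist_comp_le x y : path_connected_atlas A ->
  riemannian_distance B h (f x) (f y) <= riemannian_distance A pullback x y.
Proof.
move=> conn; apply/ler_addgt0Pr => e e0.
have [s ps ls] := dist_path hA semi_metric_pullback conn x y e0.
apply: le_trans (dist_le_path hB hh (path_comp ps)) _.
by rewrite (path_length_comp ps) ltW.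
Qed.

(** The pullback length of an arc is the length of its image, and the images here are constant
    arcs. *)
Lemma fiber_path_length x s y z : piecewise_smooth_path A x s y ->
  (forall c, List.In c s -> forall t, f (c t) = z) ->
  \sum_(c <- s) arc_length A pullback c = 0.
Proof.
elim: s x => [|c s IH] x /=; first by rewrite big_nil.
move=> [ac _ /IH h'] hz; rewrite big_cons (arc_length_comp ac) h'; last first.
  by move=> c' cs; apply: hz; right.
have -> : f \o c = fun=> z by apply: funext => t; apply: hz; left.
rewrite addr0; apply/eqP; rewrite eq_le (arc_length_ge0 hB hh (smooth_arc_cst _ z)) andbT.
have acz : arc_on B (ival 1) (fun=> z).
  by split=> [t _|phi Bphi j]; [exact: cst_continuous|exact: Ck_cst].
apply: (arc_length_le hB hh (smooth_arc_cst _ z)) => t t01.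
have [psi Bpsi zt] := cB.2 z.
rewrite (speedE hB hh (@open_ival _ 1) acz Bpsi (ival01 ltr01 t01) zt).
rewrite /velocity derive_cst innerE /qform mul0mx mul0mx mxE sqrtr0 //.
Qed.

End Pullback.

Lemma subr_trans3 (V : zmodType) (a b c d : V) : a - d = (a - b) + (b - c) + (c - d).
Proof. by rewrite (addrA (a - b)) subrK addrA subrK. Qed.

(** * Distances of a pullback along a submersion *)

Section Submersion.
Variable R : realType.
Variables (X Y : topologicalType) (n k : nat).
Variables (A : set (chart R X n)) (B : set (chart R Y k)) (f : X -> Y).
Hypotheses (hA : smooth_manifold A) (hB : smooth_manifold B).
Hypothesis sf : submersion A B f.
Let hf : smooth_map A B f := sf.1.
Let cA := smooth_manifold_covering hA.
Let cB := smooth_manifold_covering hB.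
Variable h : tensor R Y k.
Hypothesis hh : semi_metric B h.
Local Notation pb := (pullback f hB h).
Let spb : semi_metric A pb := semi_metric_pullback hA hB hf hh.

Lemma qform_sqrt_near (psi : chart R Y k) z0 (v : 'rV[R]_k) (e : R) :
  {for z0, continuous (h psi)} -> 0 < e -> exists2 d : R, 0 < d &
  forall z a, `|z - z0| < d -> `|a - v| < d ->
    Num.sqrt (qform (h psi z) a a) <= Num.sqrt (qform (h psi z0) v v) + e.
Proof.
move=> ch e0.
pose q (p : 'rV[R]_k * 'rV[R]_k) := qform (h psi p.1) p.2 p.2.
have cq : q @ (z0, v) --> q (z0, v).
  apply: cvg_qform; last 2 first; [exact: cvg_snd|exact: cvg_snd|].
  apply: (@cvg_at _ _ _ _ _ _ (h psi) _ ch); exact: cvg_fst.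
have cs : (fun p => Num.sqrt (q p)) @ (z0, v) --> Num.sqrt (q (z0, v)).
  by apply: (@cvg_at _ _ _ _ _ _ (Num.sqrt : R -> R) _ _ cq); exact: sqrt_continuous.
have : nbhs (z0, v) [set p | `|Num.sqrt (q (z0, v)) - Num.sqrt (q p)| < e].
  exact: (proj1 (cvgrPdist_lt _ _) cs e e0).
move=> /nbhs_ballP[d /= d0 hd]; exists d => // z a hz ha.
have : ball (z0, v) d (z, a) by split; rewrite -ball_normE /= distrC.
move=> /hd /=; rewrite distrC => hq.
by have := le_lt_trans (ler_norm _) hq; rewrite /q /=; lra.
Qed.

(** [linear_openness] gives a preimage [us] of the coordinates of [c s] with |us - u0| = O(|s - t|).
    Along the segment from [u0] to [us] the image of the direction [w] differs from (s - t) v by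
    o(|s - t|), and the pullback measures that image alone. Hence the sharp constant, although [w]
    need not be horizontal. *)
Lemma local_lift D c t y (e : R) : open D -> arc_on B D c -> D t -> f y = c t -> 0 < e ->
  \forall s \near t, exists2 y', f y' = c s &
    riemannian_distance A pb y y' <= (speed B h c t + e) * `|s - t|.
Proof.
move=> oD ac Dt fy e0.
have [phi Aphi dy] := cA.2 y; have [psi Bpsi dfy] := cB.2 (f y).
have [_ _ KA _ _] := cA.1 _ Aphi; have [_ _ KB _ _] := cB.1 _ Bpsi.
have ct : dom psi (c t) by rewrite -fy.
pose u0 := cmap phi y; pose F := coord_map phi psi f.
have oE := smooth_domain_open cA cB openT hf.1 Aphi Bpsi.
set E := cmap phi @` _ in oE.
have Eu0 : E u0 by exists y.
have CF : Ck 1 E F := hf.2 _ _ Aphi Bpsi 1%N.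
have surj w : exists v, 'd F u0 v = w := sf.2 _ _ y Aphi Bpsi dy dfy w.
have Fu0 : F u0 = cmap psi (c t) by rewrite /F /u0 (coord_mapE cA f psi Aphi dy) fy.
set v := velocity psi c t.
have spE : speed B h c t = Num.sqrt (qform (h psi (F u0)) v v).
  by rewrite (speedE hB hh oD ac Bpsi Dt ct) innerE Fu0.
have ch : {for F u0, continuous (h psi)}.
  by rewrite Fu0; exact: (tensor_continuous hh Bpsi ct).
have [kap kap0 hkap] := qform_sqrt_near v ch e0.
have [C [C0 hC]] := linear_openness oE Eu0 CF surj.
(* Lipschitz constant of the lift: |us - u0| <= C |zs - F u0|, and |zs - F u0| <= (|v| + 1) |s - t|
   because the linearisation error of [c] is at most |s - t|, by [eta1] <= 1. *)
pose L := C * (`|v| + 1).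
have L0 : 0 <= L by rewrite mulr_ge0 // addr_ge0.
have L20 : 0 < 2 * L + 2 by rewrite ltr_wpDl // mulr_ge0.
(* Three errors must stay below kap |de|: the variation of 'd F along the segment and the
   linearisation of [F], each at most eta * L * |de|, and the linearisation of [c], at most eta *
   |de|. The 2 in place of 1 makes the inequality strict. *)
pose eta := kap / (2 * L + 2).
have eta0 : 0 < eta by rewrite divr_gt0.
have etaE : (2 * L + 2) * eta = kap by rewrite /eta mulrC divfK // gt_eqF.
have [r r0 [rE hr1 hr2]] := strict_differentiability oE Eu0 CF eta0.
have [r2 r20 hr3] : exists2 r2 : R, 0 < r2 & forall u, ball u0 r2 u -> `|F u - F u0| < kap.
  have [dF _] := proj1 (CkSP _ _ _) CF.
  have cF : {for u0, continuous F} := differentiable_continuous (dF _ Eu0).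
  have : nbhs u0 [set u | ball (F u0) kap (F u)] := cF _ (nbhsx_ballx _ _ kap0).
  by move=> /nbhs_ballP[r2 /= r20 h2]; exists r2 => // u /h2 /=; rewrite -ball_normE /= distrC.
pose rho := Num.min r r2.
have rho0 : 0 < rho by rewrite lt_min r0.
have rho_r : ball u0 rho `<=` ball u0 r by apply: le_ball; rewrite ge_min lexx.
have rho_r2 : ball u0 rho `<=` ball u0 r2 by apply: le_ball; rewrite ge_min lexx orbT.
have [d d0 hd] := hC rho rho0.
pose eta1 := Num.min eta 1.
have eta10 : 0 < eta1 by rewrite lt_min eta0 /=.
have dz := arc_differentiable ac Bpsi Dt ct.
have cz : {for t, continuous (fun s => cmap psi (c s))} := differentiable_continuous dz.
have n1 : nbhs t [set s | ball (cmap psi (c t)) d (cmap psi (c s))] :=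
  cz _ (nbhsx_ballx _ _ d0).
have n2 : nbhs t (D `&` c @^-1` dom psi).
  by apply: open_nbhs_nbhs; split => //; exact: (arc_dom_open hB oD ac Bpsi).
have n3 := differentiable_eps dz eta10.
have n12 : nbhs t ([set s | ball (cmap psi (c t)) d (cmap psi (c s))] `&` (D `&` c @^-1` dom
  psi)) by exact: filterI.
apply: filterS2 n12 n3 => s [hs1 [Ds cs]].
have -> : 'd (fun t : R => cmap psi (c t)) t (s - t) = (s - t) *: v.
  by rewrite /v /velocity deriveE // -linearZ /= [_ *: 1]mulr1.
rewrite -Fu0; set zs := cmap psi (c s) => hs2.
have {}hs1 : `|zs - F u0| < d by move: hs1; rewrite /= -ball_normE /= distrC Fu0.
have [us [Fus bus nus]] := hd zs hs1.
have b0 : ball u0 rho u0 by exact: ballxx.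
have rho_im : ball u0 rho `<=` cmap phi @` dom phi.
  by move=> u /rho_r/rE[x [[dx _] _] <-]; exists x.
have fys : f (cinv phi us) = c s.
  have [x [[dx _] fx] xus] := rE us (rho_r _ bus).
  rewrite -xus KA // -(KB _ fx) -(KB _ cs); congr cinv.
  by rewrite -(coord_mapE cA f psi Aphi dx) xus; exact: Fus.
exists (cinv phi us) => //.
have [e' e'0 acs] := segment_arc hA Aphi rho_im b0 bus.
have := @dist_le_path R X n A hA pb spb (cinv phi u0) [:: segment phi u0 us] (cinv phi us).
rewrite big_seq1 /u0 KA // -/u0 => hle; apply: (le_trans (hle _)).
  by split; [exists e'|rewrite /segment scale0r addr0 KA|rewrite /= /segment scale1r addrC subrK].
apply: (segment_length_le hA Aphi rho_im spb b0 bus) => tau tau01.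
have bu := ball_segment b0 bus tau01.
set u := u0 + tau *: (us - u0) in bu *; set w := us - u0.
have Eu := rE u (rho_r _ bu).
have Eu' : (cmap phi @` (dom phi `&` f @^-1` dom psi)) u.
  by case: Eu => x [[dx _] fx] <-; exists x.
rewrite (pullback_qform hA hB hf hh w w Aphi Bpsi Eu') -/F.
set de := s - t in hs2 *.
have nw : `|w| <= L * `|de|.
  apply: (le_trans nus); rewrite /L -mulrA ler_wpM2l //.
  have := ler_normD (zs - F u0 - de *: v) (de *: v); rewrite subrK normrZ.
  have : eta1 * `|de| <= 1 * `|de| by rewrite ler_wpM2r // ge_min lexx orbT.
  by clear fy fys Fu0 Fus; lra.
(* The rescaling by [de] below excludes s = t, where the segment is constant. *)
have [de0|de0] := eqVneq de 0.
  have -> : w = 0.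
    by apply/eqP; rewrite -normr_le0; apply: le_trans nw _; rewrite de0 normr0 mulr0.
  by rewrite linear0 /qform mul0mx mul0mx mxE sqrtr0 de0 normr0 mulr0.
have nde : 0 < `|de| by rewrite normr_gt0.
(* The image of [w] per unit of time, which has to be close to the velocity [v] of the arc. *)
pose a := de^-1 *: 'd F u w.
have aE : 'd F u w = de *: a by rewrite /a scalerA divff // scale1r.
have ha : `|a - v| < kap.
  have -> : a - v = de^-1 *: ('d F u w - de *: v).
    by rewrite scalerBr scalerA mulVf // scale1r.
  rewrite normrZ normfV mulrC ltr_pdivrMr //.
  have k1 := hr1 u w (rho_r _ bu).
  have k2 := hr2 u0 us (rho_r _ b0) (rho_r _ bus).
  rewrite -/w Fus distrC in k2.
  have k3 := hs2.
  have -> : 'd F u w - de *: v = ('d F u w - 'd F u0 w) + ('d F u0 w - (zs - F u0))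
    + (zs - F u0 - de *: v).
    exact: subr_trans3.
  have := ler_normD (('d F u w - 'd F u0 w) + ('d F u0 w - (zs - F u0))) (zs - F u0 - de *: v).
  have := ler_normD ('d F u w - 'd F u0 w) ('d F u0 w - (zs - F u0)).
  have e1 : eta1 * `|de| <= eta * `|de| by rewrite ler_wpM2r // ge_min lexx.
  have e2 : eta * `|w| <= eta * (L * `|de|) by rewrite ler_wpM2l // ltW.
  have e3 : 0 < eta * `|de| by rewrite mulr_gt0.
  have -> : kap * `|de| = 2 * (eta * (L * `|de|)) + 2 * (eta * `|de|) by rewrite -etaE; ring.
  by clear fy fys Fu0 Fus; lra.
rewrite aE qformZ qformZr mulrA -expr2 sqrtrM ?sqr_ge0 // sqrtr_sqr mulrC.
rewrite ler_wpM2r // spE; exact: (hkap _ _ (hr3 u (rho_r2 _ bu)) ha).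
Qed.

Hypothesis conn : path_connected_atlas A.
Hypothesis surj : forall z, exists y, f y = z.

Lemma path_connected_image : path_connected_atlas B.
Proof.
move=> z z'; have [y <-] := surj z; have [y' <-] := surj z'.
by have [s ps] := conn y y'; exists [seq f \o c | c <- s]; exact: (path_comp hA hB hf).
Qed.

Hypothesis fib : forall y y', f y = f y' -> riemannian_distance A pb y y' = 0.

(** As fibres have diameter 0, an arbitrary section [s] carries the pullback pseudo-distance over to
    Y, without any continuity. [local_lift] starts at s (c t) and ends somewhere in the fibre over c
    s', from which s (c s') is at distance 0; so the growth along an arc is bounded by its speed and
    [le_dist_of_local] applies. *)
Lemma dist_pullback_le y y' :
  riemannian_distance A pb y y' <= riemannian_distance B h (f y) (f y').
Proof.
have /choice[s hs] := surj.
pose rho z z' := riemannian_distance A pb (s z) (s z').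
have tri := dist_triangle hA spb conn.
have key : rho (f y) (f y') <= riemannian_distance B h (f y) (f y').
  apply: (le_dist_of_local hB hh path_connected_image).
  - by move=> z; exact: (distxx hA spb).
  - by move=> z z'; exact: (dist_sym hA spb).
  - by move=> z z' z''; exact: tri.
  move=> D c t oD ac Dt e e0.
  have := local_lift oD ac Dt (hs (c t)) e0.
  apply: filterS => s' [y1 fy1 hy1]; apply: le_trans hy1.
  apply: le_trans (tri _ y1 _) _; rewrite (fib (y' := s (c s'))) ?addr0 //.
  by rewrite hs.
have h1 := tri y (s (f y)) y'; have h2 := tri (s (f y)) (s (f y')) y'.
rewrite (fib (y := y) (y' := s (f y))) ?hs // add0r in h1.
rewrite (fib (y := s (f y')) (y' := y')) ?hs // addr0 in h2.
exact: le_trans h1 (le_trans h2 key).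
Qed.

End Submersion.

(** * Existence of Riemannian metrics *)

(** The near-covering form of compactness is used with the filter of finite sequences that contain a
    given one: what holds near each point for all large enough sequences holds everywhere for one of
    them. *)
Lemma compact_finite_cover (X : topologicalType) (U : X -> set X) :
  compact [set: X] -> (forall x, nbhs x (U x)) ->
  exists s : seq X, forall z, exists2 x, x \in s & U x z.
Proof.
rewrite compact_near_coveringP => cX nU.
pose F := filter_from setT (fun D0 : seq X => [set D : seq X | {subset D0 <= D}]).
have FF : Filter F.
  apply: filter_from_filter; first by exists [::].
  move=> D0 D1 _ _; exists (D0 ++ D1) => // D sD.
  by split=> x xD; apply: sD; rewrite mem_cat xD ?orbT.
have [x _|D0 _ h] := cX _ F (fun (D : seq X) z => exists2 x, x \in D & U x z) FF.
  exists (U x, [set D : seq X | {subset [:: x] <= D}]).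
    by split; [exact: nU|exists [:: x]].
  by move=> [z D] [/= Uz xD]; exists x => //; apply: xD; rewrite mem_seq1.
by exists D0 => z; apply: (h D0).
Qed.

Section SmoothFunctions.
Variable R : realType.
Variables (X : topologicalType) (n : nat) (A : set (chart R X n)).
Hypothesis hA : smooth_manifold A.
Let cA := smooth_manifold_covering hA.

Definition smooth_function (E : X -> R) : Prop :=
  forall phi, A phi -> Cinfty (cmap phi @` dom phi) (fun u => E (cinv phi u)).

Definition dfun (E : X -> R) (phi : chart R X n) (u v : 'rV[R]_n) : R :=
  'd (fun u => E (cinv phi u)) u v.

(** The tensor dE (x) dE, the pullback of the metric of the line by E. It is smooth and semidefinite
    for every smooth E, so finite sums of such tensors replace a partition of unity. *)
Definition sq_dfun (E : X -> R) : tensor R X n := fun phi u =>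
  \matrix_(i, l) (dfun E phi u (delta_mx 0 i) * dfun E phi u (delta_mx 0 l)).

Lemma sq_dfun_inner E phi x v w :
  inner (sq_dfun E) phi x v w = dfun E phi (cmap phi x) v * dfun E phi (cmap phi x) w.
Proof.
rewrite innerE qformE.
have lin v' : dfun E phi (cmap phi x) v' =
    \sum_i v' 0 i * dfun E phi (cmap phi x) (delta_mx 0 i).
  rewrite {1}[v']row_sum_delta /dfun linear_sum; apply: eq_bigr => i _.
  by rewrite linearZ.
rewrite [in RHS]lin [X in _ * X]lin big_distrr /=; apply: eq_bigr => j _.
rewrite [RHS]mulrCA [RHS]mulrC; congr (_ * _); rewrite big_distrl /=.
by apply: eq_bigr => i _; rewrite mxE mulrA.
Qed.

Lemma smooth_function_differentiable E phi x : smooth_function E -> A phi -> dom phi x ->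
  differentiable (fun u => E (cinv phi u)) (cmap phi x).
Proof. by move=> sE Aphi dx; have /CkSP[h _] := sE phi Aphi 1%N; apply: h; exists x. Qed.

Lemma dfun_change E phi psi x v : smooth_function E -> A phi -> A psi ->
  dom phi x -> dom psi x ->
  dfun E psi (cmap psi x) (tangent phi psi id x v) = dfun E phi (cmap phi x) v.
Proof.
move=> sE Aphi Apsi dx dx'.
have [_ _ K _ _] := cA.1 _ Aphi; have [_ _ K' _ _] := cA.1 _ Apsi.
have dh := smooth_on_differentiable (smooth_map_id hA) Aphi Apsi (I : setT x) dx dx'.
have dE := smooth_function_differentiable sE Apsi dx'.
have E0 : coord_map phi psi id (cmap phi x) = cmap psi x by rewrite /coord_map K.
rewrite -E0 in dE.
have nE : \forall u \near cmap phi x,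
    ((fun u => E (cinv psi u)) \o coord_map phi psi id) u = E (cinv phi u).
  have := near_chart (cA.1 _ Aphi) dx (nbhs_dom (cA.1 _ Apsi) dx').
  by apply: filterS => u [_ du _]; rewrite /= /coord_map K'.
have E1 := near_diffE v nE (differentiable_comp dh dE).
apply/esym; apply: etrans E1 _; apply: etrans (diff_compE v dh dE) _.
by rewrite E0.
Qed.

Lemma semi_metric_sq_dfun E : smooth_function E -> semi_metric A (sq_dfun E).
Proof.
move=> sE; split.
- move=> phi Aphi k.
  have oD : open (cmap phi @` dom phi) by have [_ ] := cA.1 _ Aphi.
  apply/Ck_mxP => // i l; have /CkSP[_ dE] := sE phi Aphi k.+1.
  have -> : (fun u => sq_dfun E phi u i l) =
    (fun u => dfun E phi u (delta_mx 0 i) * dfun E phi u (delta_mx 0 l)).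
    by apply: funext => u; rewrite mxE.
  by apply: Ck_mul => //; exact: dE.
- by move=> phi x Aphi dx v w; rewrite !sq_dfun_inner mulrC.
- by move=> phi x Aphi dx v; rewrite sq_dfun_inner -expr2 sqr_ge0.
- move=> phi psi x Aphi Apsi dx dx' v w.
  by rewrite !sq_dfun_inner /= !(dfun_change _ sE Aphi Apsi dx dx').
Qed.

Definition tensor_sum (I : Type) (r : seq I) (t : I -> tensor R X n) : tensor R X n :=
  fun phi u => \sum_(i <- r) t i phi u.

Lemma qform_sum (I : Type) (r : seq I) (M : I -> 'M[R]_n) v w :
  qform (\sum_(i <- r) M i) v w = \sum_(i <- r) qform (M i) v w.
Proof.
elim: r => [|i r IH]; first by rewrite !big_nil /qform mulmx0 mul0mx mxE.
by rewrite !big_cons -IH /qform mulmxDr mulmxDl mxE.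
Qed.

Lemma tensor_sum_inner (I : Type) (r : seq I) t phi x v w :
  inner (tensor_sum r t) phi x v w = \sum_(i <- r) inner (t i) phi x v w :> R.
Proof. by rewrite innerE qform_sum; apply: eq_bigr => i _; rewrite innerE. Qed.

Lemma semi_metric_sum (I : Type) (r : seq I) (t : I -> tensor R X n) :
  (forall i, semi_metric A (t i)) -> semi_metric A (tensor_sum r t).
Proof.
move=> ht; split.
- move=> phi Aphi k.
  have oD : open (cmap phi @` dom phi) by have [_ ] := cA.1 _ Aphi.
  by apply: Ck_sum => // i _; have [h _ _ _] := ht i; exact: h.
- move=> phi x Aphi dx v w; rewrite !tensor_sum_inner; apply: eq_bigr => i _.
  by have [_ h _ _] := ht i; exact: h.
- move=> phi x Aphi dx v; rewrite tensor_sum_inner; apply: sumr_ge0 => i _.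
  by have [_ _ h _] := ht i; exact: h.
- move=> phi psi x Aphi Apsi dx dx' v w; rewrite !tensor_sum_inner.
  by apply: eq_bigr => i _; have [_ _ _ h] := ht i; exact: h.
Qed.

Definition tensor_add (g : tensor R X n) (a : R) (h : tensor R X n) : tensor R X n :=
  fun phi u => g phi u + a *: h phi u.

Lemma tensor_add_inner g a h phi x v w :
  inner (tensor_add g a h) phi x v w = inner g phi x v w + a * inner h phi x v w :> R.
Proof.
by rewrite !innerE /tensor_add /qform mulmxDr mulmxDl -scalemxAr -scalemxAl !mxE.
Qed.

Lemma semi_metric_add g (a : R) h : 0 <= a ->
  semi_metric A g -> semi_metric A h -> semi_metric A (tensor_add g a h).
Proof.
move=> a0 [g1 g2 g3 g4] [h1 h2 h3 h4]; split.
- move=> phi Aphi k.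
  have oD : open (cmap phi @` dom phi) by have [_ ] := cA.1 _ Aphi.
  apply: Ck_add => //; first exact: g1.
  have ca : continuous ( *:%R a : 'M[R]_n -> 'M[R]_n) by move=> M; exact: scaler_continuous.
  exact: (Ck_linear_comp (L := ( *:%R a : {linear 'M[R]_n -> 'M[R]_n})) oD ca (h1 phi Aphi k)).
- by move=> phi x Aphi dx v w; rewrite !tensor_add_inner g2 // h2.
- by move=> phi x Aphi dx v; rewrite tensor_add_inner addr_ge0 ?g3 // mulr_ge0 ?h3.
- move=> phi psi x Aphi Apsi dx dx' v w; rewrite !tensor_add_inner.
  by rewrite (g4 phi psi x Aphi Apsi dx dx') (h4 phi psi x Aphi Apsi dx dx').
Qed.

Definition positive_at (g : tensor R X n) (x : X) : Prop :=
  forall phi, A phi -> dom phi x -> forall v, v != 0 -> 0 < inner g phi x v v.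

Lemma semi_metric_riemannian g : semi_metric A g -> (forall x, positive_at g x) ->
  riemannian_metric A g.
Proof. by move=> [h1 h2 h3 h4] pos; split=> // phi x Aphi dx; exact: pos. Qed.

Lemma tangent_idK phi psi x v : A phi -> A psi -> dom phi x -> dom psi x ->
  tangent psi phi id x (tangent phi psi id x v) = v.
Proof.
move=> Aphi Apsi dx dx'.
have := tangent_comp cA cA openT (smooth_map_id hA) (smooth_map_id hA)
  Aphi Apsi Aphi I I dx dx' dx v.
by rewrite /= => <-; exact: (tangent_id v (cA.1 _ Aphi) dx).
Qed.

(** Definiteness transfers to the other charts since tangent maps between charts are invertible, by
    [tangent_idK]. *)
Lemma positive_at_chart g phi x : semi_metric A g -> A phi -> dom phi x ->
  (forall v, inner g phi x v v = 0 -> v = 0) -> positive_at g x.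
Proof.
move=> sg Aphi dx h psi Apsi dx' v v0.
have [_ _ ge0 tr] := sg; rewrite lt0r ge0 // andbT.
apply: contra_neq v0 => gv.
have := tr psi phi x Apsi Aphi dx' dx v v; rewrite /= gv => /h E.
by rewrite -(tangent_idK v Apsi Aphi dx' dx) E /tangent linear0.
Qed.

End SmoothFunctions.

Section Bump.
Variable R : realType.
Variables (X : topologicalType) (n : nat) (A : set (chart R X n)).
Hypothesis hA : smooth_manifold A.
Let cA := smooth_manifold_covering hA.
Variables (phi : chart R X n) (u0 : 'rV[R]_n) (r r0 : R).
Hypotheses (Aphi : A phi) (rim : ball u0 r0 `<=` cmap phi @` dom phi).
Hypotheses (r_gt0 : 0 < r) (rr0 : r < r0).

(** The Euclidean square: the norm of ['rV[R]_n] is the maximum norm, which is not smooth. *)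
Definition sqdist (u : 'rV[R]_n) : R := \sum_i (u 0 i - u0 0 i) ^+ 2.

Definition bump (u : 'rV[R]_n) : R := rapid 0 (r ^+ 2 - sqdist u).

Definition cutoff (q : 'rV[R]_n -> R) (z : X) : R :=
  if `[< dom phi z >] then bump (cmap phi z) * q (cmap phi z) else 0.

Lemma Ck_coord k D (j : 'I_n) : open D -> Ck k D (fun u : 'rV[R]_n => u 0 j).
Proof. by move=> oD; exact: (Ck_linear k D (L := @mxcoord R 1 n 0 j)
  (@mxcoord_continuous R 1 n 0 j)). Qed.

Lemma Ck_sqdist k : Ck k setT sqdist.
Proof.
apply: Ck_sum; first exact: openT.
move=> i _; have C1 : Ck k setT (fun u : 'rV[R]_n => u 0 i - u0 0 i).
  apply: (Ck_add openT (Ck_coord k i openT)); exact: Ck_cst.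
have -> : (fun u : 'rV[R]_n => (u 0 i - u0 0 i) ^+ 2) =
  (fun u => (u 0 i - u0 0 i) * (u 0 i - u0 0 i)) by apply: funext => u; rewrite expr2.
exact: (Ck_mul openT C1 C1).
Qed.

Lemma Ck_bump k : Ck k setT bump.
Proof.
apply: (@Ck_comp_scalar R _ k setT setT (fun u => r ^+ 2 - sqdist u) (rapid 0) openT) => //;
  last exact: rapid_smooth.
have -> : (fun u => r ^+ 2 - sqdist u) = (fun=> r ^+ 2) \+ (fun u => (-1) * sqdist u).
  by apply: funext => u /=; rewrite mulN1r.
by apply: (Ck_add openT (Ck_cst _ _ _)); apply: Ck_mul openT (Ck_cst _ _ _) (Ck_sqdist k).
Qed.

Lemma bump_far u : r < `|u - u0| -> bump u = 0.
Proof.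
move=> hr; rewrite /bump /rapid ltNge (_ : _ <= 0) //.
rewrite subr_le0.
have [i hi] : exists i, r < `|(u - u0) 0 i|.
  apply: contrapT => h.
  have : `|u - u0| <= r.
    apply: mx_norm_le => [|i j]; first exact: ltW.
    by rewrite ord1 leNgt; apply/negP => hj; apply: h; exists j.
  by rewrite leNgt hr.
rewrite /sqdist (bigD1 i) //=.
apply: (@le_trans _ _ ((u 0 i - u0 0 i) ^+ 2)); last first.
  by rewrite lerDl sumr_ge0 // => j _; rewrite sqr_ge0.
rewrite -[leRHS]real_normK ?num_real // lerXn2r ?nnegrE ?(ltW r_gt0) //.
by move: hi; rewrite !mxE => /ltW.
Qed.

Lemma bump_near u : sqdist u < r ^+ 2 -> 0 < bump u.
Proof.
by rewrite -subr_gt0 => h; rewrite /bump /rapid h expr0 mul1r expR_gt0.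
Qed.

(** Inside the chart the cutoff is a product of smooth functions. A point outside the chart has a
    neighbourhood that avoids the closed set [KK], and there the cutoff is 0. *)
Lemma smooth_cutoff q : Cinfty setT q -> smooth_function A (cutoff q).
Proof.
move=> Cq psi Apsi k; apply: Ck_local => u [z dz <-].
have [_ _ K _ _] := cA.1 _ Aphi; have [_ _ K' _ _] := cA.1 _ Apsi.
have [dpz|dpz] := pselect (dom phi z).
- have oE := smooth_domain_open cA cA openT (smooth_map_id hA).1 Apsi Aphi.
  exists (cmap psi @` (dom psi `&` setT `&` id @^-1` dom phi)),
    ((fun u => bump u * q u) \o coord_map psi phi id).
  split=> //.
  + by exists z.
  + move=> _ [y [[dy _] /= dy'] <-]; rewrite /cutoff K' //.
    by case: asboolP => // _; rewrite /= /coord_map K'.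
  + pose Q := (fun u => (bump u * q u)%:M : 'rV[R]_1).
    have CQ : Ck k setT (fun u => bump u * q u) by exact: Ck_mul openT (Ck_bump k) (Cq k).
    apply: (Ck_comp_basis (e := fun j => delta_mx 0 j)
      (l := fun j => @mxcoord R 1 n 0 j : {linear _ -> _}) _ _ oE _
      ((smooth_map_id hA).2 _ _ Apsi Aphi k) CQ) => //.
      by move=> ?; exact: mxcoord_continuous.
    by move=> w; rewrite [LHS]row_sum_delta.
- pose KK := cinv phi @` [set u | `|u - u0| <= r].
  have KKcl : closed KK := chart_closed_ball hA Aphi rim rr0.
  have zK : ~ KK z.
    move=> [v vr vz].
    have /rim[y dy yv] : ball u0 r0 v by rewrite -ball_normE /= distrC; exact: le_lt_trans rr0.
    by apply: dpz; rewrite -vz -yv K.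
  exists (cmap psi @` (dom psi `&` ~` KK)), (fun=> 0); split.
  + apply: open_chart_image; first exact: cA.1.
    by move=> y _ yK; apply: open_nbhs_nbhs; split => //; exact: closed_openC.
  + by exists z.
  + move=> _ [y [dy yK] <-]; rewrite K' // /cutoff; case: asboolP => // dy'.
    rewrite bump_far ?mul0r // ltNge; apply/negP => h; apply: yK.
    by exists (cmap phi y) => //; rewrite K.
  + exact: Ck_cst.
Qed.

Lemma cutoff_dfun q z v : dom phi z -> Cinfty setT q ->
  dfun (cutoff q) phi (cmap phi z) v =
  bump (cmap phi z) * 'd q (cmap phi z) v + q (cmap phi z) * 'd bump (cmap phi z) v.
Proof.
move=> dz Cq; have [_ _ K _ _] := cA.1 _ Aphi.
have db : differentiable bump (cmap phi z) by have /CkSP[h _] := Ck_bump 1; exact: h.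
have dq : differentiable q (cmap phi z) by have /CkSP[h _] := Cq 1%N; exact: h.
have nE : \forall u \near cmap phi z, (bump * q) u = cutoff q (cinv phi u).
  have := near_chart (cA.1 _ Aphi) dz (nbhs_dom (cA.1 _ Aphi) dz).
  apply: filterS => u [du _ uK]; rewrite /cutoff; case: asboolP => // _.
  by rewrite uK.
apply: etrans (near_diffE v nE (differentiableM db dq)) _.
exact: (congr1 (fun h : _ -> R => h v) (diffM db dq)).
Qed.

(** The pullback of the Euclidean metric by (b, b u_1, ..., b u_n), where b is the bump. Since d(b
    u_j) = b du_j + u_j db, a vector killed by db and by all d(b u_j) is 0 wherever b > 0. *)
Definition bump_tensor : tensor R X n :=
  tensor_add (sq_dfun (cutoff (fun=> 1))) 1
    (tensor_sum (index_enum 'I_n) (fun j => sq_dfun (cutoff (fun u => u 0 j)))).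

Lemma semi_metric_bump : semi_metric A bump_tensor.
Proof.
apply: (semi_metric_add hA) => //.
  by apply: (semi_metric_sq_dfun hA); apply: smooth_cutoff => k; exact: Ck_cst.
apply: (semi_metric_sum hA) => j.
by apply: (semi_metric_sq_dfun hA); apply: smooth_cutoff => k; exact: Ck_coord openT.
Qed.

Lemma bump_tensor_positive z : dom phi z -> sqdist (cmap phi z) < r ^+ 2 ->
  positive_at A bump_tensor z.
Proof.
move=> dz zr; apply: (positive_at_chart hA semi_metric_bump Aphi dz) => v.
have b0 := bump_near zr.
have iE : inner bump_tensor phi z v v =
    dfun (cutoff (fun=> 1)) phi (cmap phi z) v ^+ 2 +
    \sum_j inner (sq_dfun (cutoff (fun u => u 0 j))) phi z v v.
  apply: etrans (tensor_add_inner _ _ _ _ _ _ _) _.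
  by rewrite mul1r; congr (_ + _); [exact: sq_dfun_inner|exact: tensor_sum_inner].
rewrite iE.
have s0 : 0 <= \sum_j inner (sq_dfun (cutoff (fun u => u 0 j))) phi z v v.
  by apply: sumr_ge0 => j _; rewrite sq_dfun_inner -expr2 sqr_ge0.
move/eqP; rewrite paddr_eq0 ?sqr_ge0 // sqrf_eq0 => /andP[/eqP E1 /eqP E2].
have db0 : 'd bump (cmap phi z) v = 0.
  have := etrans (esym (cutoff_dfun v dz (fun k => Ck_cst k setT (1 : R)))) E1.
  have [_ e0] := @is_diff_cst R 'rV[R]_n R 1 (cmap phi z).
  have e1 : 'd (fun=> 1 : R) (cmap phi z) v = 0 := congr1 (fun h : 'rV[R]_n -> R => h v) e0.
  by rewrite e1 mulr0 add0r mul1r.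
apply/rowP => j; rewrite mxE.
have : inner (sq_dfun (cutoff (fun u => u 0 j))) phi z v v = 0.
  move: E2 => /eqP; rewrite psumr_eq0; last first.
    by move=> l _; rewrite sq_dfun_inner -expr2 sqr_ge0.
  by move=> /allP/(_ j (mem_index_enum _))/eqP.
rewrite sq_dfun_inner -expr2 => /eqP; rewrite sqrf_eq0 => /eqP.
rewrite (cutoff_dfun v dz (fun k => Ck_coord k j openT)) db0 mulr0 addr0.
have -> : 'd (fun u : 'rV[R]_n => u 0 j) (cmap phi z) v = v 0 j.
  exact: (congr1 (fun h : 'rV[R]_n -> R => h v) (diff_lin (cmap phi z)
    (@mxcoord_continuous R 1 n 0 j))).
by move/eqP; rewrite mulf_eq0 gt_eqF //= => /eqP.
Qed.

End Bump.

Section Existence.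
Variable R : realType.
Variables (X : topologicalType) (n : nat) (A : set (chart R X n)).
Hypothesis hA : smooth_manifold A.
Let cA := smooth_manifold_covering hA.

Lemma local_metric (x : X) : exists t : tensor R X n, exists U : set X,
  [/\ semi_metric A t, open U, U x & forall z, U z -> positive_at A t z].
Proof.
have [phi Aphi dx] := cA.2 x.
have [r0 [r00 rim _]] := chart_ball hA Aphi dx (filterT : nbhs (cmap phi x) setT).
have r20 : 0 < r0 / 2 by lra.
have rr : r0 / 2 < r0 by lra.
exists (bump_tensor phi (cmap phi x) (r0 / 2)).
exists (dom phi `&` (sqdist (cmap phi x) \o cmap phi) @^-1` [set t | t < (r0 / 2) ^+ 2]).
have cs : continuous (sqdist (cmap phi x)).
  by move=> u; have h := Ck_sqdist (cmap phi x) 0; exact: (h u I).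
split.
- exact: (semi_metric_bump hA Aphi rim r20 rr).
- rewrite openE => z [dz /= hz]; apply: filterI; first exact: nbhs_dom (cA.1 _ Aphi) dz.
  have [_ _ _ cc _] := cA.1 _ Aphi.
  have czz : {for z, continuous (fun y => sqdist (cmap phi x) (cmap phi y))}.
    apply: continuous_at_comp; [exact: cc|exact: cs].
  by apply: czz; exact: lt_nbhsl.
- split=> //=; rewrite /sqdist big1 ?exprn_gt0 // => i _.
  by rewrite subrr expr0n.
- by move=> z [dz hz]; exact: (bump_tensor_positive hA Aphi rim r20 rr dz hz).
Qed.

(** The tensors of [local_metric] are defined and semidefinite on all of X, so a finite sum is
    definite as soon as the sets on which its terms are definite cover X. *)
Lemma riemannian_metric_exists : compact [set: X] ->
  exists g : tensor R X n, riemannian_metric A g.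
Proof.
move=> cX.
have [t ht] := choice local_metric.
have [U hU] := choice ht.
have nU x : nbhs x (U x) by have [_ oU Ux _] := hU x; exact: open_nbhs_nbhs.
have [D' cov] := compact_finite_cover cX nU.
exists (tensor_sum D' t).
have st i : semi_metric A (t i) by have [] := hU i.
apply: semi_metric_riemannian; first exact: (semi_metric_sum hA).
move=> z phi Aphi dz v v0.
have [x xD Uz] := cov z.
rewrite tensor_sum_inner (big_rem x) //=.
have [_ _ _ pos] := hU x.
apply: ltr_pwDl; first exact: pos.
by apply: sumr_ge0 => i _; have [_ _ h _] := st i; exact: h.
Qed.

End Existence.

(** * Principal bundles *)

Section Topology.

Lemma connected_clopen (X : topologicalType) (E : set X) x :
  connected [set: X] -> open E -> open (~` E) -> E x -> forall y, E y.
Proof.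
move=> cX oE oCE Ex y.
suff -> : E = setT by [].
apply: cX; first by exists x.
  by exists E => //; rewrite setTI.
by exists E; rewrite ?setTI // -[E]setCK; exact: open_closedC.
Qed.

Lemma ultra_fmap (T U : Type) (f : T -> U) (F : set_system T) :
  UltraFilter F -> UltraFilter (f @ F).
Proof.
move=> FU; split; first exact: fmap_proper_filter.
move=> G PG sFG; apply/seteqP; split=> // A GA.
have [//|FnA] := in_ultra_setVsetC (f @^-1` A) FU.
have GnA : G (~` A) by apply: sFG.
exfalso; apply: (@filter_not_empty _ G).
by rewrite -(setICr A); exact: filterI.
Qed.

End Topology.

Section LocalPaths.
Variable R : realType.
Variables (X : topologicalType) (n : nat) (A : set (chart R X n)).
Hypothesis hA : smooth_manifold A.
Let cA := smooth_manifold_covering hA.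

(** Both directions come from straight segments, because [path_rev] involves a tensor and none is
    given here. The first shows that reachable sets are open, the second that their complements
    are. *)
Lemma near_path x : \forall y \near x,
  (exists s, piecewise_smooth_path A x s y) /\ (exists s, piecewise_smooth_path A y s x).
Proof.
have [phi Aphi dx] := cA.2 x.
have [r [r0 rim _]] := chart_ball hA Aphi dx (filterT : nbhs (cmap phi x) setT).
have [_ _ K cc _] := cA.1 _ Aphi.
have nr : nbhs x [set y | ball (cmap phi x) r (cmap phi y)] :=
  cc x dx _ (nbhsx_ballx _ _ r0).
apply: filterS2 nr (nbhs_dom (cA.1 _ Aphi) dx) => y yr dy.
have xr : ball (cmap phi x) r (cmap phi x) by exact: ballxx.
have seg u u' z z' : ball (cmap phi x) r u -> ball (cmap phi x) r u' ->
    cinv phi u = z -> cinv phi u' = z' -> piecewise_smooth_path A z [:: segment phi u u'] z'.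
  move=> hu hu' uz uz'; have [e e0 ac] := segment_arc hA Aphi rim hu hu'.
  split; first by exists e.
    by rewrite /segment scale0r addr0.
  by rewrite /= /segment scale1r addrC subrK.
split; first by exists [:: segment phi (cmap phi x) (cmap phi y)]; apply: seg; rewrite ?K.
by exists [:: segment phi (cmap phi y) (cmap phi x)]; apply: seg; rewrite ?K.
Qed.

Definition reachable x : set X := [set y | exists s, piecewise_smooth_path A x s y].

Lemma open_reachable x : open (reachable x).
Proof.
rewrite openE => y [s ps]; apply: filterS (near_path y) => z [[s' ps'] _].
by exists (s ++ s'); exact: path_cat ps ps'.
Qed.

Lemma open_reachableC x : open (~` reachable x).
Proof.
rewrite openE => y yn; apply: filterS (near_path y) => z [_ [s' ps']] [s ps].
by apply: yn; exists (s ++ s'); exact: path_cat ps ps'.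
Qed.

End LocalPaths.

Section Bundle.
Variable R : realType.
Variables (M : topologicalType) (m : nat) (AM : set (chart R M m)).
Variables (G : topologicalGroupType) (d : nat) (AG : set (chart R G d)).
Variables (P : topologicalType) (p : nat) (AP : set (chart R P p)).
Variables (pi : P -> M) (act : P -> G -> P).
Hypothesis bP : principal_bundle AM AG AP pi act.

Let hM : smooth_manifold AM. Proof. by case: bP => -[]. Qed.
Let hG : smooth_manifold AG. Proof. by case: bP => -[_ []]. Qed.
Let hP : smooth_manifold AP. Proof. by case: bP => -[]. Qed.
Let cM := smooth_manifold_covering hM.
Let cG := smooth_manifold_covering hG.
Let cP := smooth_manifold_covering hP.

Lemma act_smooth : smooth_map (prod_atlas AP AG) AP (fun z : P * G => act z.1 z.2).
Proof. by case: bP => _ _ []. Qed.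
Lemma act1 y : act y 1%g = y. Proof. by case: bP => _ _ []. Qed.
Lemma actM y a b : act (act y a) b = act y (a * b)%g. Proof. by case: bP => _ _ []. Qed.
Lemma pi_act y a : pi (act y a) = pi y. Proof. by case: bP. Qed.
Lemma pi_smooth : smooth_map AP AM pi. Proof. by case: bP. Qed.

(* For a local trivialisation (F, T), the section is s x = F (x, 1). *)
Lemma local_section (x0 : M) : exists (U : set M) (s : M -> P) (T : P -> G),
  [/\ open U, U x0, smooth_on AM AP U s, smooth_on AP AG (pi @^-1` U) T &
  [/\ (forall x, U x -> pi (s x) = x), (forall x, U x -> T (s x) = 1%g),
      (forall y a, U (pi y) -> T (act y a) = (T y * a)%g) &
      (forall y y', U (pi y) -> pi y = pi y' -> act y ((T y)^-1 * T y')%g = y')]].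
Proof.
have [_ _ _ _ /(_ x0)[U [F [T [[oU Ux0] sF sT [h1 h2 h3] h4]]]]] := bP.
exists U, (fun x => F (x, 1%g)), T; split=> //.
  apply: (smooth_on_comp (f := fun x => (x, 1%g)) (g := F) (W := U `*` setT)
    cM (covering_prod_atlas cM cG) cP oU) => //.
    rewrite openE => -[x a] [/= Ux _]; exists (U, setT) => //=.
    by split; [exact: open_nbhs_nbhs|exact: filterT].
  apply: smooth_on_pair => //; first exact: smooth_on_sub (smooth_map_id hM).
  exact: smooth_on_cst.
split=> [x Ux|x Ux|y a Uy|y y' Uy yy'].
- exact: h1.
- exact: h2.
- by rewrite -{1}(h3 y Uy) h4 // h2.
- rewrite -{1}(h3 y Uy) h4 // mulgA mulgV mul1g yy' h3 //.
  by rewrite -yy'.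
Qed.

Lemma fiber_transitive y y' : pi y = pi y' -> exists a, act y a = y'.
Proof.
move=> yy'; have [U [s [T [oU Ux _ _ [_ _ _ h]]]]] := local_section (pi y).
by exists ((T y)^-1 * T y')%g; exact: h.
Qed.

Lemma act_free y a b : act y a = act y b -> a = b.
Proof.
have [U [s [T [oU Ux _ _ [_ _ h _]]]]] := local_section (pi y).
by move=> /(congr1 T); rewrite !h // => /mulgI.
Qed.

Lemma pi_surj x : exists y, pi y = x.
Proof.
by have [U [s [T [_ Ux _ _ [h _ _ _]]]]] := local_section x; exists (s x); exact: h.
Qed.

Lemma act_right_smooth (a : G) : smooth_map AP AP (act^~ a).
Proof.
apply: (smooth_on_comp (f := fun y => (y, a)) (g := fun z : P * G => act z.1 z.2) (W := setT)
  cP (covering_prod_atlas cP cG) cP openT openT) => //.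
  apply: smooth_on_pair => //; first exact: openT.
    exact: smooth_map_id.
  exact: smooth_on_cst.
exact: act_smooth.
Qed.

Lemma act_left_smooth (y : P) : smooth_map AG AP (act y).
Proof.
apply: (smooth_on_comp (f := fun a => (y, a)) (g := fun z : P * G => act z.1 z.2) (W := setT)
  cG (covering_prod_atlas cP cG) cP openT openT) => //.
  apply: smooth_on_pair => //; first exact: openT.
    exact: smooth_on_cst.
  exact: smooth_map_id.
exact: act_smooth.
Qed.

(** The set [E] reachable from [y0] is open and closed. Its preimage under an orbit map is so too,
    hence all of the connected group: [E] is a union of fibres. Through local sections its image in
    M is then open and closed, hence everything. *)
Lemma bundle_path_connected : connected [set: M] -> connected [set: G] ->
  path_connected_atlas AP.
Proof.
move=> cM' cG' y0 y.
pose E := reachable AP y0.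
have oE : open E by exact: open_reachable.
have oEC : open (~` E) by exact: open_reachableC.
have Eact z a : E z -> E (act z a).
  move=> Ez; have ca : continuous (act z) by move=> b; exact: (act_left_smooth z).1.
  have : (act z @^-1` E) 1%g by rewrite /= act1.
  move=> /(connected_clopen cG') h; apply: h.
    by apply: open_comp => // b _; exact: ca.
  apply: (open_comp (f := act z) _ oEC) => b _; exact: ca.
pose S := [set x | exists2 z, pi z = x & E z].
have SE U s (x : M) : (forall x, U x -> pi (s x) = x) -> U x -> S x <-> E (s x).
  move=> hs Ux; split=> [[z zx Ez]|Es]; last by exists (s x) => //; exact: hs.
  by have [a <-] := fiber_transitive (etrans zx (esym (hs _ Ux))); exact: Eact.
have S1 x : S x -> nbhs x S.
  move=> Sx; have [U [s [T [oU Ux [cs _] _ [hs _ _ _]]]]] := local_section x.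
  have nU : nbhs x U by exact: open_nbhs_nbhs.
  have nE : nbhs x (s @^-1` E).
    by apply: (cs x Ux); apply: open_nbhs_nbhs; split => //; apply/(SE U s x hs Ux).
  by apply: filterS2 nU nE => x' Ux' Ex'; apply/(SE U s x' hs Ux').
have S2 x : ~ S x -> nbhs x (~` S).
  move=> Sx; have [U [s [T [oU Ux [cs _] _ [hs _ _ _]]]]] := local_section x.
  have nU : nbhs x U by exact: open_nbhs_nbhs.
  have nE : nbhs x (s @^-1` (~` E)).
    apply: (cs x Ux); apply: open_nbhs_nbhs; split => // Es.
    by apply: Sx; apply/(SE U s x hs Ux).
  by apply: filterS2 nU nE => x' Ux' Ex' Sx'; apply: Ex'; apply/(SE U s x' hs Ux').
have Sy0 : S (pi y0) by exists y0 => //; exists [::].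
have [z zy Ez] : S (pi y).
  apply: (connected_clopen cM' _ _ Sy0); first by rewrite openE.
  by rewrite openE.
by have [a <-] := fiber_transitive zy; exact: Eact.
Qed.

(** An ultrafilter on P converges after projection to some x0 in M, and after the fibre coordinate
    [T] of a trivialisation around x0 to some a in G. It then converges to s x0 acted on by a. *)
Lemma bundle_compact : compact [set: M] -> compact [set: G] -> compact [set: P].
Proof.
rewrite !compact_ultra => cM' cG' F UF _.
have UM : UltraFilter (pi @ F) by exact: ultra_fmap.
have [x0 [_ /= Fx0]] := cM' _ UM (filterT).
have [U [s [T [oU Ux [cs _] _ [hs hs1 _ hT]]]]] := local_section x0.
have UT : UltraFilter (T @ F) by exact: ultra_fmap.
have [a [_ /= Fa]] := cG' _ UT (filterT).
exists (act (s x0) a); split=> //=.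
have h1 : (fun y => (s (pi y), T y)) @ F --> (s x0, a).
  by apply: cvg_pair => //; apply: (@cvg_at _ _ _ _ _ _ s) Fx0; exact: cs.
have h2 : (fun y => act (s (pi y)) (T y)) @ F --> act (s x0) a.
  apply: (@cvg_at _ _ _ _ _ (fun y => (s (pi y), T y)) (fun z : P * G => act z.1 z.2) _ _ h1).
  exact: act_smooth.1.
(* [T] is meaningful over [U] only; the ultrafilter lives there since its projection tends to x0. *)
have nU : F (pi @^-1` U) by apply: Fx0; exact: open_nbhs_nbhs.
move=> V nV; have hV : F [set y | V (act (s (pi y)) (T y))] := h2 V nV.
apply: filterS2 nU hV => y Uy /=.
by have := hT (s (pi y)) y; rewrite hs // hs1 // invg1 mul1g => ->.
Qed.

End Bundle.

(** * The map to the coset space induced by a reduction *)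

Section Cosets.
Variables (G : topologicalGroupType) (H : set G).
Hypothesis sH : is_subgroup H.

Lemma coset_projE (a b : G) :
  coset_proj H a = coset_proj H b <-> exists2 h, H h & b = (a * h)%g.
Proof.
have [H1 HM HV] := sH.
split=> [/(@eqquotP _ _ _)/asboolP E|[h Hh ->]].
  have : lcoset b H b by exists 1%g => //; rewrite mulg1.
  by rewrite -E => -[h Hh <-]; exists h.
apply/(@eqquotP _ _ _)/asboolP/seteqP; split=> _ [h' Hh' <-].
  by exists (h^-1 * h')%g; [apply: HM => //; exact: HV|rewrite mulgA mulgK].
by exists (h * h')%g; [exact: HM|rewrite mulgA].
Qed.

Lemma coset_proj_surj (z : coset_space H) : exists a, coset_proj H a = z.
Proof. by exists (repr z); rewrite /coset_proj; exact: reprK. Qed.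

End Cosets.

Section Reduction.
Variable R : realType.
Variables (M : topologicalType) (m : nat) (AM : set (chart R M m)).
Variables (G : topologicalGroupType) (d : nat) (AG : set (chart R G d)).
Variables (P : topologicalType) (p : nat) (AP : set (chart R P p)).
Variables (pi : P -> M) (act : P -> G -> P).
Hypothesis bP : principal_bundle AM AG AP pi act.
Variable H : set G.
Hypotheses (sH : is_subgroup H) (cH : connected H).
Variables (k : nat) (AGH : set (chart R (coset_space H) k)).
Hypothesis hGH : smooth_manifold AGH.
Hypothesis sGH : submersion AG AGH (@coset_proj G H).
Variables (K : topologicalGroupType) (kK : nat) (AK : set (chart R K kK)) (i : K -> G).
Hypotheses (hK : lie_group AK) (iM : forall a b : K, i (a * b)%g = (i a * i b)%g).
Hypotheses (emb : embedding AK AG i) (iH : range i = H).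
Variables (Q : topologicalType) (q : nat) (AQ : set (chart R Q q)).
Variables (piQ : Q -> M) (actQ : Q -> K -> Q) (Psi : Q -> P).
Hypotheses (bQ : principal_bundle AM AK AQ piQ actQ) (sPsi : smooth_map AQ AP Psi).
Hypotheses (Psi_eq : forall y a, Psi (actQ y a) = act (Psi y) (i a)).
Hypothesis Psi_pi : forall y, pi (Psi y) = piQ y.

Let hM : smooth_manifold AM. Proof. by case: bP => -[]. Qed.
Let lG : lie_group AG. Proof. by case: bP => -[]. Qed.
Let hG : smooth_manifold AG. Proof. by case: lG. Qed.
Let hP : smooth_manifold AP. Proof. by case: bP => -[]. Qed.
Let hQ : smooth_manifold AQ. Proof. by case: bQ => -[]. Qed.
Let hK' : smooth_manifold AK. Proof. by case: hK. Qed.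
Let cM := smooth_manifold_covering hM.
Let cG := smooth_manifold_covering hG.
Let cP := smooth_manifold_covering hP.
Let cQ := smooth_manifold_covering hQ.
Let cK := smooth_manifold_covering hK'.
Let cGH := smooth_manifold_covering hGH.

Lemma range_i a : H (i a). Proof. by rewrite -iH; exists a. Qed.

Lemma i1 : i 1%g = 1%g.
Proof. by apply: (@mulgI _ (i 1%g)); rewrite -iM !mulg1. Qed.

Lemma iV a : i (a^-1)%g = ((i a)^-1)%g.
Proof. by apply: (@mulgI _ (i a)); rewrite -iM !mulgV i1. Qed.

(** An embedding carries the topology of K to the subspace topology of H, so the image of an open
    and closed set of K is relatively open and closed in H. *)
Lemma connected_subgroup : connected [set: K].
Proof.
have [_ inj opn] := emb.
move=> E [a Ea] [C oC EC] [C' cC' EC'].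
rewrite setTI in EC; rewrite setTI in EC'.
have [V oV CV] := opn _ oC.
have [V' oV' CV'] := opn _ (closed_openC cC').
have E1 : i @` E = H `&` V.
  apply/seteqP; split=> [_ [b Eb <-]|b [Hb Vb]].
    by split; [exact: range_i|move: Eb; rewrite EC CV].
  by move: Hb Vb; rewrite -iH => -[b' _ <-] Vb; exists b' => //; rewrite EC CV.
have E2 : i @` E = H `&` ~` V'.
  apply/seteqP; split=> [_ [b Eb <-]|b [Hb Vb]].
    split; first exact: range_i.
    by move=> Vb; have : (i @^-1` V') b by []; rewrite -CV'; apply; rewrite -EC'.
  move: Hb Vb; rewrite -iH => -[b' _ <-] Vb; exists b' => //.
  by rewrite EC'; apply: contrapT => nb; apply: Vb; have : (~` C') b' by []; rewrite CV'.
have EH : i @` E = H.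
  apply: cH; first by exists (i a), a.
    by exists V.
  by exists (~` V') => //; exact: open_closedC.
apply/seteqP; split=> // b _.
have : (i @` E) (i b) by rewrite EH; exact: range_i.
by move=> [b' Eb' /inj <-].
Qed.

Lemma reduction_coords y : exists qa : Q * G, act (Psi qa.1) qa.2 = y.
Proof.
have [z zy] := pi_surj bQ (pi y).
have [a ay] : exists a, act (Psi z) a = y.
  by apply: (fiber_transitive bP); rewrite Psi_pi.
by exists (z, a).
Qed.

(* P = Q x_H G fibres over G/H; the fibre over aH is Psi(Q) a^-1. *)
Definition coset_map (y : P) : coset_space H :=
  coset_proj H ((sval (cid (reduction_coords y))).2^-1)%g.

(** Independence of the representation of y: if [actQ z0 b] = z, freeness of the action forces a0 =
    i b * a, and the inverse of a0 differs from that of a by a right factor in H. *)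
Lemma coset_mapE z a : coset_map (act (Psi z) a) = coset_proj H (a^-1)%g.
Proof.
rewrite /coset_map; case: cid => -[z0 a0] /= E.
have Ez : piQ z0 = piQ z by rewrite -!Psi_pi -(pi_act bP (Psi z0) a0) E (pi_act bP).
have [b bz] := fiber_transitive bQ Ez.
rewrite -bz Psi_eq (actM bP) in E.
have -> : a0 = (i b * a)%g by exact: (act_free bP E).
apply/esym/(coset_projE sH); exists ((i b)^-1)%g; last by rewrite invgM.
by have [_ _ HV] := sH; apply: HV; exact: range_i.
Qed.

Lemma coset_map_surj c : [set: M] !=set0 -> exists y, coset_map y = c.
Proof.
move=> [x _]; have [a <-] := coset_proj_surj c; have [z _] := pi_surj bQ x.
by exists (act (Psi z) (a^-1)%g); rewrite coset_mapE invgK.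
Qed.

Lemma coset_map_smooth : smooth_map AP AGH coset_map.
Proof.
apply: (smooth_on_local cP cGH openT) => y _.
have [U [s [T [oU Ux [cs ss] sT [hs hs1 hT1 hT2]]]]] := local_section bP (pi y).
have [U' [s' [T' [oU' Ux' ss' sT' [hs' hs1' hT1' hT2']]]]] := local_section bQ (pi y).
have cpi : continuous pi by move=> z; exact: (pi_smooth bP).1.
pose V := pi @^-1` (U `&` U').
have oV : open V by apply: open_comp => [z _|]; [exact: cpi|exact: openI].
have oU1 : open (pi @^-1` U) by apply: open_comp => [z _|]; [exact: cpi|].
(* For z over [V], z is Psi (s' (pi z)) acted on by T (Psi (s' (pi z)))^-1 * T z; the map sends z to
   the coset of the inverse of this element. *)
exists V, (coset_proj H \o (fun y => (T y)^-1 * T (Psi (s' (pi y))))%g).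
split=> //.
- move=> z [Uz Uz'] /=.
  have e : pi (Psi (s' (pi z))) = pi z by rewrite Psi_pi hs'.
  have Uz1 : U (pi (Psi (s' (pi z)))) by rewrite e.
  by rewrite -{3}(hT2 _ _ Uz1 e) coset_mapE invgM invgK.
- apply: (smooth_on_comp (W := setT) cP cG cGH oV openT) => //; last exact: sGH.1.
  have [_ mul inv] := lG.
  have sV : smooth_on AP AM V pi by exact: smooth_on_sub (pi_smooth bP).
  have s1 : smooth_on AP AQ V (s' \o pi).
    by apply: (smooth_on_comp (W := U') cP cM cQ oV oU') => // z [].
  have s2 : smooth_on AP AP V (Psi \o (s' \o pi)).
    by apply: (smooth_on_comp (W := setT) cP cQ cP oV openT).
  have s3 : smooth_on AP AG V (T \o (Psi \o (s' \o pi))).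
    apply: (smooth_on_comp (W := pi @^-1` U) cP cP cG oV oU1) => // z [Uz Uz'] /=.
    by rewrite Psi_pi hs'.
  have s4 : smooth_on AP AG V ((fun a : G => a^-1)%g \o T).
    apply: (smooth_on_comp (W := setT) cP cG cG oV openT) => //.
    by apply: smooth_on_sub sT => z [].
  have s5 := smooth_on_pair cP cG cG oV s4 s3.
  exact: (smooth_on_comp (W := setT) cP (covering_prod_atlas cG cG) cG oV openT _ s5 mul).
Qed.

Lemma orbit_smooth z : smooth_map AG AP (fun a => act (Psi z) (a^-1)%g).
Proof.
have [_ mul inv] := lG.
exact: (smooth_on_comp (W := setT) (f := fun a : G => (a^-1)%g) (g := act (Psi z))
  cG cG cP openT openT (fun _ _ => I) inv (act_left_smooth bP (Psi z))).
Qed.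

(** The orbit map b -> Psi z b^-1 followed by [coset_map] is [coset_proj], so the surjectivity of
    the differential of the latter passes to the former. *)
Lemma coset_map_submersion : submersion AP AGH coset_map.
Proof.
split; first exact: coset_map_smooth.
move=> phi psi y Aphi Bpsi dy dfy w.
have [[z a] /= E] := reduction_coords y.
pose sg := fun b => act (Psi z) (b^-1)%g.
have sa : sg (a^-1)%g = y by rewrite /sg invgK.
have comp : coset_map \o sg = @coset_proj G H.
  by apply: funext => b; rewrite /= coset_mapE invgK.
have [chi Achi da] := cG.2 (a^-1)%g.
rewrite -sa in dy dfy *.
have dfy' : dom psi (coset_proj H (a^-1)%g) by rewrite -comp.
have [v <-] := sGH.2 chi psi (a^-1)%g Achi Bpsi da dfy' w.
exists (tangent chi phi sg (a^-1)%g v).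
have := tangent_comp cG cP openT (orbit_smooth z) coset_map_smooth Achi Aphi Bpsi I I da dy dfy v.
by rewrite -/sg comp => <-.
Qed.

Variable gT : tensor R (coset_space H) k.
Hypothesis sgT : semi_metric AGH gT.
Hypothesis cM' : connected [set: M].

(** Two points with the same image can be written with the same group element [a]. Since K is
    connected, so is Q by paths; a path of Q between the two base points is mapped by z -> Psi z a
    into the fibre, where lengths vanish. *)
Lemma coset_map_fiber y y' : coset_map y = coset_map y' ->
  riemannian_distance AP (pullback coset_map hGH gT) y y' = 0.
Proof.
have [[z a] /= <-] := reduction_coords y; have [[z' a'] /= <-] := reduction_coords y'.
rewrite !coset_mapE => /(coset_projE sH)[h Hh].
have [b _ <-] : range i h by rewrite iH.
move=> E.
have -> : act (Psi z') a' = act (Psi (actQ z' (b^-1)%g)) a.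
  rewrite Psi_eq (actM bP) iV; congr act.
  by apply: invg_inj; rewrite invgM invgK.
have [s ps] := bundle_path_connected bQ cM' connected_subgroup z (actQ z' (b^-1)%g).
have st : smooth_map AQ AP (fun z => act (Psi z) a).
  exact: (smooth_on_comp (W := setT) (f := Psi) (g := act^~ a)
    cQ cP cP openT openT (fun _ _ => I) sPsi (act_right_smooth bP a)).
have ps' := path_comp hQ hP st ps.
have sp := semi_metric_pullback hP hGH coset_map_smooth sgT.
apply/eqP; rewrite eq_le (dist_ge0 hP sp) andbT.
apply: le_trans (dist_le_path hP sp ps') _.
rewrite (fiber_path_length hP hGH coset_map_smooth sgT (z := coset_proj H (a^-1)%g) ps') //.
move=> c /List.in_map_iff[c' [<- _]] t /=; exact: coset_mapE.
Qed.

End Reduction.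

(** * Convergence of the perturbed distances *)

Section Perturbation.
Variables (R : realType) (X : topologicalType) (n : nat) (A : set (chart R X n)).
Hypothesis hA : smooth_manifold A.

(** With b = 0 this is the monotonicity of length; with [sqrt_tensor_add_le] it bounds the lengths
    of the perturbed tensor. *)
Lemma le_arc_length_add g1 g2 g3 (b : R) c :
  semi_metric A g1 -> semi_metric A g2 -> semi_metric A g3 ->
  (forall phi x v, A phi -> dom phi x -> Num.sqrt (inner g1 phi x v v) <=
     Num.sqrt (inner g2 phi x v v) + b * Num.sqrt (inner g3 phi x v v)) ->
  smooth_arc A c -> arc_length A g1 c <= arc_length A g2 c + b * arc_length A g3 c.
Proof.
move=> s1 s2 s3 le /smooth_arcP[e e0 ac].
have oI := @open_ival _ e.
have I01 := fun t => @ival01 R e t e0.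
have i1 := speed_integrable hA s1 (a := 0) (b := 1) oI ac I01.
have i2 := speed_integrable hA s2 (a := 0) (b := 1) oI ac I01.
have i3 := speed_integrable hA s3 (a := 0) (b := 1) oI ac I01.
have i4 : (@lebesgue_measure R).-integrable `[0, 1] (EFin \o (fun t => b * speed A g3 c t)).
  have -> : EFin \o (fun t => b * speed A g3 c t) = (fun t => b%:E * (EFin \o speed A g3 c) t)%E.
    by apply/funext => t; rewrite /= EFinM.
  exact: integrableZl.
rewrite /arc_length -(RintegralZl b _ i3) // -(RintegralD _ i2 i4) //.
apply: le_Rintegral => //.
  by have := integrableD _ i2 i4; apply; exact: measurable_itv.
move=> t; rewrite /= in_itv /= => t01.
have [phi Aphi ct] := (smooth_manifold_covering hA).2 (c t).
rewrite (speedE hA s1 oI ac Aphi (I01 t t01) ct) (speedE hA s2 oI ac Aphi (I01 t t01) ct).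
by rewrite (speedE hA s3 oI ac Aphi (I01 t t01) ct); exact: le.
Qed.

Lemma le_path_length_add g1 g2 g3 (b : R) x s y :
  semi_metric A g1 -> semi_metric A g2 -> semi_metric A g3 ->
  (forall phi x v, A phi -> dom phi x -> Num.sqrt (inner g1 phi x v v) <=
     Num.sqrt (inner g2 phi x v v) + b * Num.sqrt (inner g3 phi x v v)) ->
  piecewise_smooth_path A x s y ->
  \sum_(c <- s) arc_length A g1 c <=
    \sum_(c <- s) arc_length A g2 c + b * \sum_(c <- s) arc_length A g3 c.
Proof.
move=> s1 s2 s3 le ps; rewrite mulr_sumr -big_split /=.
elim: s x ps => [|c s IH] x /=; first by rewrite !big_nil.
by move=> [sc _ ps]; rewrite !big_cons lerD ?(IH _ ps) // (le_arc_length_add s1 s2 s3 le).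
Qed.

Hypothesis conn : path_connected_atlas A.

Lemma le_dist g1 g2 x y : semi_metric A g1 -> semi_metric A g2 ->
  (forall phi x v, A phi -> dom phi x -> inner g1 phi x v v <= inner g2 phi x v v) ->
  riemannian_distance A g1 x y <= riemannian_distance A g2 x y.
Proof.
move=> s1 s2 le; apply/ler_addgt0Pr => e e0.
have [s ps sl] := dist_path hA s2 conn x y e0.
apply: le_trans (dist_le_path hA s1 ps) _; apply: le_trans (ltW sl).
have := le_path_length_add (b := 0) s1 s2 s2 _ ps; rewrite mul0r addr0; apply.
move=> phi z v Aphi dz; rewrite mul0r addr0 ler_wsqrtr //; exact: le.
Qed.

Variables (g h : tensor R X n).
Hypotheses (sg : semi_metric A g) (sh : semi_metric A h).

(** The weight is a square so that lengths change linearly in [b]. Squaring the right-hand side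
    leaves only a nonnegative cross term to discard. *)
Lemma sqrt_tensor_add_le (b : R) phi x v : 0 <= b -> A phi -> dom phi x ->
  Num.sqrt (inner (tensor_add g (b ^+ 2) h) phi x v v) <=
    Num.sqrt (inner g phi x v v) + b * Num.sqrt (inner h phi x v v).
Proof.
move=> b0 Aphi dx; rewrite tensor_add_inner.
have [_ _ g0 _] := sg; have [_ _ h0 _] := sh.
set u := inner g _ _ _ _; set w := inner h _ _ _ _.
have u0 : 0 <= u by exact: g0.
have w0 : 0 <= w by exact: h0.
have r0 : 0 <= Num.sqrt u + b * Num.sqrt w by rewrite addr_ge0 ?mulr_ge0 ?sqrtr_ge0.
rewrite -(ger0_norm r0) -sqrtr_sqr ler_wsqrtr //.
rewrite sqrrD exprMn !sqr_sqrtr // addrAC lerDl mulrn_wge0 // mulr_ge0 ?mulr_ge0 ?sqrtr_ge0 //.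
Qed.

(** The net [N] is an e-net for g + h, whose distance dominates that of g + b^2 h for all b <= 1, so
    it can be fixed before [b]. Between its finitely many pairs of points, near-minimal paths for g
    have h-lengths bounded by [C]. *)
Lemma dist_tensor_add_approx (e : R) : compact [set: X] -> 0 < e ->
  exists2 a : R, 0 < a & forall x y,
    riemannian_distance A g x y <= riemannian_distance A (tensor_add g a h) x y
      <= riemannian_distance A g x y + e *+ 6.
Proof.
move=> cX e0.
have sa (a : R) : 0 <= a -> semi_metric A (tensor_add g a h).
  by move=> a0; exact: semi_metric_add.
have s1 := sa 1 ler01.
have [N cov] := compact_finite_cover cX (fun x => dist_near hA s1 x e0).
have paths (z : X * X) : exists s, piecewise_smooth_path A z.1 s z.2 /\
    \sum_(c <- s) arc_length A g c < riemannian_distance A g z.1 z.2 + e.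
  by have [s ps sl] := dist_path hA sg conn z.1 z.2 e0; exists s.
have [s hs] := choice paths.
pose l x y := \sum_(c <- s (x, y)) arc_length A h c.
have l0 x y : 0 <= l x y by exact: (path_length_ge0 hA sh (hs (x, y)).1).
pose C := \sum_(x <- N) \sum_(y <- N) l x y.
have lC x y : x \in N -> y \in N -> l x y <= C.
  move=> xN yN; rewrite /C (big_rem x) //= (big_rem y) //= -addrA lerDl.
  by rewrite addr_ge0 ?sumr_ge0 // => z _; rewrite sumr_ge0.
have C0 : 0 <= C by rewrite sumr_ge0 // => x _; rewrite sumr_ge0.
(* This choice ensures both b <= 1 and b * C <= e, also when C = 0. *)
pose b := e / (C + e).
have Ce : 0 < C + e by rewrite ltr_wpDl.
have b0 : 0 < b by rewrite divr_gt0.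
have b1 : b <= 1 by rewrite ler_pdivrMr // mul1r lerDr.
have bC : b * C <= e by rewrite mulrAC ler_pdivrMr // ler_wpM2l ?ltW // ltrDl.
have sb := sa _ (sqr_ge0 b).
have [_ _ g0 _] := sg; have [_ _ h0 _] := sh.
have lb x y : riemannian_distance A g x y <= riemannian_distance A (tensor_add g (b ^+ 2) h) x y.
  apply: le_dist => // phi z v Aphi dz.
  by rewrite tensor_add_inner lerDl mulr_ge0 ?sqr_ge0 // h0.
have ub x y : riemannian_distance A (tensor_add g (b ^+ 2) h) x y <=
    riemannian_distance A (tensor_add g 1 h) x y.
  apply: le_dist => // phi z v Aphi dz.
  by rewrite !tensor_add_inner lerD2l ler_wpM2r ?h0 // expr_le1 // ltW.
exists (b ^+ 2) => [|x y]; first by rewrite exprn_gt0.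
apply/andP; split; first exact: lb.
(* The budget of six: two e for moving x and y to the net in the perturbed distance, two on the net
   (near-minimality and b * C), two for moving back in the distance of g. *)
have [x' x'N xx'] := cov x; have [y' y'N yy'] := cov y.
have net : riemannian_distance A (tensor_add g (b ^+ 2) h) x' y' <=
    riemannian_distance A g x' y' + e *+ 2.
  have [ps sl] := hs (x', y').
  apply: le_trans (dist_le_path hA sb ps) _.
  apply: le_trans (le_path_length_add sb sg sh _ ps) _.
    by move=> phi z v Aphi dz; exact: (sqrt_tensor_add_le v (ltW b0) Aphi dz).
  rewrite mulr2n addrA lerD //; first exact: ltW.
  apply: le_trans bC; apply: ler_wpM2l (lC _ _ x'N y'N); exact: ltW.
have t1 := dist_triangle hA sb conn x x' y.
have t2 := dist_triangle hA sb conn x' y' y.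
have t3 := dist_triangle hA sg conn x' x y'.
have t4 := dist_triangle hA sg conn x y y'.
have u1 := ub x' x; have u2 := ub y' y; have u3 := lb x' x; have u4 := lb y' y.
rewrite (dist_sym hA sb x x') in t1; rewrite (dist_sym hA sg y y') in t4.
move: t1 t2 t3 t4 u1 u2 u3 u4 net xx' yy'; clear.
do 10 (move: (riemannian_distance _ _ _ _) => ?); lra.
Qed.

End Perturbation.

(** * The Gromov-Hausdorff estimate and the conclusion *)

Lemma distortion_ge0 (R : realType) (X Y : metricType R) (C : set (X * Y)) :
  0 <= distortion C.
Proof.
rewrite /distortion; set S := mkset _.
(* Where the supremum does not exist, [sup] takes its default value 0. *)
have [hS|nS] := pselect (has_sup S); last by rewrite sup_out.
have [[r Sr] _] := hS; apply: le_trans (sup_upper_bound hS Sr).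
by case: Sr => z [z' [_ _ ->]].
Qed.

Lemma GH_distance_le (R : realType) (X Y : metricType R) (f : Y -> X) (e : R) :
  [set: X] !=set0 -> (forall x, exists y, f y = x) ->
  (forall y y', `|mdist (f y) (f y') - mdist y y'| <= e) ->
  GH_distance X Y <= 2^-1 * e.
Proof.
move=> [x0 _] surj fe; rewrite /GH_distance ler_pM2l ?invr_gt0 //.
pose C := [set z : X * Y | z.1 = f z.2].
have corr : correspondence C.
  by split=> [x|y]; [have [y <-] := surj x; exists y|exists (f y)].
apply: (@le_trans _ _ (distortion C)).
  apply: ge_inf; last by exists C.
  by exists 0 => _ [C' _ <-]; exact: distortion_ge0.
apply: sup_le_ub.
  have [y0 y0x] := surj x0; pose z := (x0, y0).
  by exists `|mdist z.1 z.1 - mdist z.2 z.2|, z, z; split.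
by move=> _ [[x y] [[x' y'] [Cx Cx' ->]]] /=; rewrite [x]Cx [x']Cx'; exact: fe.
Qed.

Theorem theorem2 (R : realType)
  (M : topologicalType) (m : nat) (AM : set (chart R M m))
  (G : topologicalGroupType) (d : nat) (AG : set (chart R G d))
  (P : topologicalType) (p : nat) (AP : set (chart R P p))
  (pi : P -> M) (act : P -> G -> P)
  (bundleP : principal_bundle AM AG AP pi act)
  (M_nonempty : [set: M] !=set0)
  (M_compact : compact [set: M]) (M_connected : connected [set: M])
  (m_ge2 : (2 <= m)%N)
  (G_compact : compact [set: G]) (G_connected : connected [set: G])
  (gG : tensor R G d) (gG_bi_invariant : bi_invariant_metric AG gG)
  (H : set G) (H_subgroup : is_subgroup H)
  (H_closed : closed H) (H_connected : connected H)
  (* the quotient smooth structure on G/H, and the metric induced by gG *)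
  (k : nat) (AGH : set (chart R (coset_space H) k))
  (AGH_manifold : smooth_manifold AGH)
  (AGH_quotient : submersion AG AGH (@coset_proj G H))
  (gT : tensor R (coset_space H) k)
  (gT_metric : riemannian_metric AGH gT)
  (gT_invariant : forall a : G,
     preserves_metric AGH gT AGH gT (@coset_translate G H a))
  (gT_submersion : riemannian_submersion AG gG AGH gT (@coset_proj G H))
  (P_reducible : reducible AM AG AP pi act H) :
  exists2 X : metricType R,
    isometric_to X (riemannian_distance AGH gT) &
    GH_closure (riemannian_classes AP) X.
Proof.
have [K [k' [AK [i [hK iM emb iH [Q [q [AQ [piQ [actQ [Psi [bQ sPsi Psi_eq Psi_pi]]]]]]]]]]]] :=
  P_reducible.
have [[hM _ hP] _ _ _ _] := bundleP.
have cP := bundle_compact bundleP M_compact G_compact.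
have connP := bundle_path_connected bundleP M_connected G_connected.
pose f := coset_map bundleP H bQ Psi_pi.
have sf : submersion AP AGH f.
  exact: (coset_map_submersion bundleP H_subgroup AGH_manifold AGH_quotient iH bQ sPsi Psi_eq
    Psi_pi).
have surj z : exists y, f y = z
  by exact: (coset_map_surj bundleP H_subgroup iH bQ Psi_eq Psi_pi z M_nonempty).
have connT := path_connected_image hP AGH_manifold sf connP surj.
have sT := riemannian_semi_metric gT_metric.
have nT : [set: coset_space H] !=set0 by exists (coset_proj H 1%g).
have cT : compact [set: coset_space H].
  have <- : f @` [set: P] = setT.
    by apply/seteqP; split=> // z _; have [y <-] := surj z; exists y.
  by apply: continuous_compact cP; apply: continuous_subspaceT => y; exact: sf.1.1.
have nP : [set: P] !=set0 by have [y _] := surj (coset_proj H 1%g); exists y.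
have [h hh] := riemannian_metric_exists hP cP.
have sh := riemannian_semi_metric hh.
pose g : tensor R P p := pullback f AGH_manifold gT.
have sg : semi_metric AP g := semi_metric_pullback hP AGH_manifold sf.1 sT.
have distE y y' : riemannian_distance AP g y y' = riemannian_distance AGH gT (f y) (f y').
  apply/eqP; rewrite eq_le (dist_comp_le hP AGH_manifold sf.1 sT) // andbT.
  by apply: (dist_pullback_le hP sf sT connP surj) => y1 y2; exact: coset_map_fiber.
exists (riemannian_space AGH_manifold gT_metric connT).
  exact: riemannian_space_isometric.
split=> [|e e0]; first exact: riemannian_space_GH.
(* [dist_tensor_add_approx] loses six times its argument; the distortion is then at most e, and the
   factor 1/2 in [GH_distance] makes the bound strict. *)
have e6 : 0 < e / 6 by rewrite divr_gt0.
have [a a0 close] := dist_tensor_add_approx hP connP sg sh cP e6.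
have ga : riemannian_metric AP (tensor_add g a h).
  apply: semi_metric_riemannian; first exact: semi_metric_add (ltW a0) sg sh.
  move=> y phi Aphi dy v v0; rewrite tensor_add_inner.
  have [_ _ g0 _] := sg; have [_ _ h0 _] := hh.
  by rewrite ltr_wpDl ?g0 // mulr_gt0 ?h0.
exists (riemannian_space hP ga connP); split.
- exact: riemannian_space_GH.
- by exists (tensor_add g a h) => //; exact: riemannian_space_isometric.
- apply: (@le_lt_trans _ _ (2^-1 * e)).
    apply: (@GH_distance_le _ _ _ (f : riemannian_space hP ga connP -> riemannian_space
      AGH_manifold gT_metric connT)) => // y y'.
    rewrite ler_norml; have := close y y'; rewrite distE => /andP[c1 c2].
    have -> : mdist (f y : riemannian_space AGH_manifold gT_metric connT) (f y')
      = riemannian_distance AGH gT (f y) (f y') by [].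
    have -> : mdist (y : riemannian_space hP ga connP) y' = riemannian_distance AP (tensor_add g
      a h) y y' by [].
    by clear -c1 c2 e0; apply/andP; split; lra.
  by rewrite gtr_pMl // invf_lt1 ?ltr1n.
Qed.
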